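(* Let $1<p<\infty$ and $l,k\in\mathbb{R}$. Let $b$ be a holomorphic function on $\mathbb{C}_+$ such that $b=Pb$. Then the following assertions are equivalent. (a) $b\in\mathcal{B}_{\omega^{l+k}}(\mathbb{C}_+)$. (b) The Hankel operator $h_b$ is bounded from $A^p_{\omega^{-lp}}(\mathbb{C}_+)$ to $A^p_{\omega^{kp}}(\mathbb{C}_+)$. Moreover, $\|b\|_{\dot{\mathcal{B}}_{\omega^{l+k}}}\lesssim\|h_b\|_{A^p_{\omega^{-lp}}\to A^p_{\omega^{kp}}}\lesssim\|b\|_{\mathcal{B}_{\omega^{l+k}}}$, where $A\lesssim B$ means $A\le CB$ with a constant $C>0$ independent of $b$.
   Context: $\mathbb{C}_+=\{z\in\mathbb{C}:\operatorname{Im}z>0\}$, $dV(x+iy)=dx\,dy$. For $s>0$, $\ln_+s=\max\{0,\ln s\}$, and $\omega(z)=1+\ln_+|z|+\ln_+(1/\operatorname{Im}z)$ for $z\in\mathbb{C}_+$. For $m\in\mathbb{R}$, the $\omega^m$-Bloch space $\mathcal{B}_{\omega^m}(\mathbb{C}_+)$ is the space of holomorphic functions $b$ on $\mathbb{C}_+$ with $\|b\|_{\dot{\mathcal{B}}_{\omega^m}}:=\sup_{z\in\mathbb{C}_+}(\operatorname{Im}z)\,\omega^m(z)|b'(z)|<\infty$, with norm $\|b\|_{\mathcal{B}_{\omega^m}}:=|b(i)|+\|b\|_{\dot{\mathcal{B}}_{\omega^m}}$. For a positive function $\Omega$ on $\mathbb{C}_+$ and $1\le p<\infty$, $A^p_\Omega(\mathbb{C}_+)$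 is the space of holomorphic functions $f$ on $\mathbb{C}_+$ with $\|f\|_{A^p_\Omega}:=\left(\int_{\mathbb{C}_+}|f(z)|^p\,\Omega(z)\,dV(z)\right)^{1/p}<\infty$. The Bergman projection is $Pf(z)=\int_{\mathbb{C}_+}\frac{c_0}{(z-\bar w)^{2}}f(w)\,dV(w)$ (whenever the integral converges absolutely), where $c_0$ is the constant for which $P$ is the orthogonal projection of $L^2(\mathbb{C}_+,dV)$ onto its closed subspace of holomorphic functions. The Hankel operator with symbol $b$ is $h_b(f)=P(b\overline{f})$. Boundedness of $h_b$ on a space includes that $h_bf$ is well defined for every $f$ in that space. *)

(* Defs.v *)
(* MathComp-Analysis; the complex numbers over R : realType are R[i] from
   mathcomp-real-closed. *)
From HB Require Import structures.
From mathcomp Require Import all_boot all_order all_algebra.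
From mathcomp Require Import all_classical all_reals all_analysis.
From mathcomp Require Import complex.

Set Implicit Arguments.
Unset Strict Implicit.
Unset Printing Implicit Defensive.

Import Order.TTheory GRing.Theory Num.Theory.
Import numFieldNormedType.Exports.

Local Open Scope classical_set_scope.
Local Open Scope complex_scope.
Local Open Scope ring_scope.

(* Functions on the upper half-plane are represented by total functions
   R[i] -> R[i]; every definition below only looks at their values at points of
   [halfplane R]. *)

Section HalfPlane.
Context {R : realType}.
Implicit Types (z w c : R[i]) (f g b : R[i] -> R[i]) (Om : R[i] -> R).

(* The real-valued modulus; [`|z|] is the same number seen in R[i]. *)
Definition cabs z : R := Normc.normc z.

Definition halfplane : set R[i] := [set z | 0 < complex.Im z].

Definition planar (T : Type) (F : R[i] -> T) :
    measurableTypeR R * measurableTypeR R -> T :=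
  fun q => F (q.1 +i* q.2).

Definition halfplane2 : set (measurableTypeR R * measurableTypeR R) :=
  [set q | 0 < q.2].

Definition dV : set (measurableTypeR R * measurableTypeR R) -> \bar R :=
  (@lebesgue_measure R \x @lebesgue_measure R)%E.

Definition cintegrable f : Prop :=
  dV.-integrable halfplane2 (EFin \o planar (fun w => complex.Re (f w))) /\
  dV.-integrable halfplane2 (EFin \o planar (fun w => complex.Im (f w))).

(* Meaningful when [cintegrable f]. *)
Definition cintegral f : R[i] :=
  Rintegral dV halfplane2 (planar (fun w => complex.Re (f w))) +i*
  Rintegral dV halfplane2 (planar (fun w => complex.Im (f w))).

(* [R[i]^o] is R[i] as a normed space over itself, so that derivability in the
   direction 1 is complex differentiability. *)
Definition holomorphic f : Prop :=
  forall z, halfplane z -> derivable (f : R[i]^o -> R[i]^o) z 1.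

Definition cderiv f z : R[i] := derive1 (f : R[i]^o -> R[i]^o) z.

Definition lnp (s : R) : R := Num.max 0 (ln s).

Definition omega z : R := 1 + lnp (cabs z) + lnp ((complex.Im z)^-1).

Definition bloch_seminorm (m : R) b : \bar R :=
  ereal_sup [set (complex.Im z * omega z `^ m * cabs (cderiv b z))%:E
            | z in halfplane].

Definition bloch_norm (m : R) b : \bar R :=
  ((cabs (b 'i%C))%:E + bloch_seminorm m b)%E.

Definition bloch (m : R) b : Prop :=
  holomorphic b /\ (bloch_seminorm m b < +oo)%E.

Definition bergman_norm (p : R) Om f : \bar R :=
  (poweR (\int[dV]_(q in halfplane2)
            (planar (fun z => cabs (f z) `^ p * Om z) q)%:E) p^-1)%E.

Definition bergman_space (p : R) Om f : Prop :=
  holomorphic f /\ (bergman_norm p Om f < +oo)%E.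

(* The operator P with a constant c in place of the normalizing constant. *)
Definition projection_integrand c f z w : R[i] :=
  c / (z - w^*%C) ^+ 2 * f w.

Definition projection_defined c f z : Prop :=
  cintegrable (projection_integrand c f z).

Definition projection c f z : R[i] :=
  cintegral (projection_integrand c f z).

Definition square_integrable f : Prop :=
  [/\ measurable_fun halfplane2 (planar (fun z => complex.Re (f z))),
      measurable_fun halfplane2 (planar (fun z => complex.Im (f z))) &
      (\int[dV]_(q in halfplane2)
         (planar (fun z => cabs (f z) ^+ 2) q)%:E < +oo)%E].

Definition l2_inner f g : R[i] := cintegral (fun w => f w * (g w)^*%C).

(* c is the normalizing constant: [projection c] is the orthogonal projection
   of L^2 onto its subspace of holomorphic functions. (Its value is -1/pi.) *)
Definition bergman_constant c : Prop :=
  forall f, square_integrable f ->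
    [/\ forall z, halfplane z -> projection_defined c f z,
        holomorphic (projection c f),
        square_integrable (projection c f) &
        forall g, holomorphic g -> square_integrable g ->
          l2_inner (fun w => f w - projection c f w) g = 0].

(* b = P b, which includes the absolute convergence of the integrals. *)
Definition projection_fixed c b : Prop :=
  forall z, halfplane z -> projection_defined c b z /\ b z = projection c b z.

Definition hankel_arg b f : R[i] -> R[i] := fun w => b w * (f w)^*%C.

Definition hankel c b f : R[i] -> R[i] := projection c (hankel_arg b f).

Definition hankel_bounded c (p : R) Om1 Om2 b : Prop :=
  [/\ forall f, bergman_space p Om1 f ->
        forall z, halfplane z -> projection_defined c (hankel_arg b f) z,
      forall f, bergman_space p Om1 f -> bergman_space p Om2 (hankel c b f) &
      exists M : R, forall f, bergman_space p Om1 f ->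
        (bergman_norm p Om2 (hankel c b f) <= M%:E * bergman_norm p Om1 f)%E].

Definition hankel_norm c (p : R) Om1 Om2 b : \bar R :=
  ereal_sup [set bergman_norm p Om2 (hankel c b f)
            | f in [set f | bergman_space p Om1 f /\
                            (bergman_norm p Om1 f <= 1)%E]].

End HalfPlane.

(* Main.v *)
Require Import Defs.
From HB Require Import structures.
From mathcomp Require Import all_boot all_order all_algebra.
From mathcomp Require Import all_classical all_reals all_analysis.
From mathcomp Require Import measurable_realfun complex ring lra.

Set Implicit Arguments.
Unset Strict Implicit.
Unset Printing Implicit Defensive.

Import Order.TTheory GRing.Theory Num.Theory.
Import numFieldNormedType.Exports.

Local Open Scope classical_set_scope.
Local Open Scope complex_scope.
Local Open Scope ring_scope.

(** Both directions pass through derivatives of the symbol, and both rest on one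
    estimate of an integral.

    The kernel integral (kernel_integral): the integral of (Im w)^(k-1) |z - conj w|^-s
    over the half-plane is at most a constant times (Im z)^(k+1-s), when k > 0 and
    s > k + 1. The weight omega is logarithmic, hence varies less than any power of the
    invariant quantity kratio z w = |z - conj w|^2 / (Im z Im w) (omega_powR_le). So the
    same estimate holds with omega^m on both sides (kernel_integral_omega).

    (b) implies (a), hankel_to_bloch. Applied to the normalized test function
    (w - conj z)^-2, the operator h_b gives a function whose value at z is a multiple of
    b''(z), because b = P b can be differentiated under the integral sign. Point
    evaluation on the weighted Bergman space (point_evaluation) bounds this value. So
    (Im z)^2 omega(z)^(l+k) |b''(z)| is bounded, and integrating b'' along the vertical
    ray above z, on which b' tends to 0, gives the same for Im z omega(z)^(l+k) |b'(z)|.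

    (a) implies (b), bloch_to_hankel. The number h_b f (z) is c times the integral of
    b conj(g), with g(w) = f(w) (w - conj z)^-2. By Stokes' formula this integral is
    that of - 2 i Im(w) b'(w) conj(g(w)) (integral_by_parts, pairing_le), so the Bloch
    condition bounds |h_b f (z)| by a multiple of the integral of
    omega^-(l+k) |f| |z - conj w|^-2. A Schur test whose test functions are powers of
    Im w bounds this positive operator between the two weighted spaces (schur_bound).
    That the integrals converge absolutely follows from the slow growth of Bloch
    functions fixed by P (bloch_growth).

    Complex analysis enters through one property of the normalizing constant: P
    reproduces square integrable holomorphic functions (bergman_reproducing). Point
    evaluation follows from it, and so does the holomorphy of derivatives
    (holomorphic_cderiv), by mapping the half-plane onto a small disc. *)

(** * The modulus of a complex number *)

Section Modulus.
Context {R : realType}.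
Implicit Types (z w : R[i]).

Lemma cabsM z w : cabs (z * w) = cabs z * cabs w.
Proof. exact: Normc.normcM. Qed.

Lemma cabsV z : cabs z^-1 = (cabs z)^-1.
Proof. exact: Normc.normcV. Qed.

Lemma cabsE z : `|z| = (cabs z)%:C.
Proof. by rewrite normc_def /cabs; case: z. Qed.

Lemma cabs_ge0 z : 0 <= cabs z.
Proof. by case: z => a b; exact: sqrtr_ge0. Qed.

Lemma cabs_eq0 z : (cabs z == 0) = (z == 0).
Proof.
apply/eqP/eqP => [/Normc.eq0_normc//|->]; exact: Normc.normc0.
Qed.

Lemma cabs0 : cabs (0 : R[i]) = 0.
Proof. exact: Normc.normc0. Qed.

Lemma cabs1 : cabs (1 : R[i]) = 1.
Proof. exact: Normc.normc1. Qed.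

Lemma cabs_gt0 z : (0 < cabs z) = (z != 0).
Proof. by rewrite lt0r cabs_eq0 cabs_ge0 andbT. Qed.

Lemma cabsD z w : cabs (z + w) <= cabs z + cabs w.
Proof. by have := ler_normD z w; rewrite !cabsE -rmorphD lecR. Qed.

Lemma cabsN z : cabs (- z) = cabs z.
Proof. by have := normrN z; rewrite !cabsE => -[]. Qed.

Lemma cabsB z w : cabs (z - w) = cabs (w - z).
Proof. by rewrite -cabsN opprB. Qed.

Lemma cabs_sub z w : cabs z - cabs w <= cabs (z - w).
Proof. by rewrite lerBlDr (le_trans _ (cabsD _ _))// subrK. Qed.

Lemma cabsX z n : cabs (z ^+ n) = cabs z ^+ n.
Proof. by elim: n => [|n IH]; rewrite ?expr0 ?cabs1// !exprS cabsM IH. Qed.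

Lemma cabsR (x : R) : cabs x%:C = `|x|.
Proof. by rewrite /cabs /= expr0n addr0 sqrtr_sqr. Qed.

Lemma cabs_nat n : cabs (n%:R : R[i]) = n%:R.
Proof. by rewrite -(rmorph_nat (real_complex R)) cabsR ger0_norm. Qed.

Lemma cabs_conj z : cabs z^*%C = cabs z.
Proof. by case: z => a b; rewrite /cabs /= sqrrN. Qed.

Lemma sqr_cabs z : cabs z ^+ 2 = complex.Re z ^+ 2 + complex.Im z ^+ 2.
Proof. by case: z => a b; rewrite /cabs /= sqr_sqrtr// addr_ge0 ?sqr_ge0. Qed.

Lemma Re_le_cabs z : `|complex.Re z| <= cabs z.
Proof.
rewrite -(@ler_pXn2r _ 2) ?nnegrE ?cabs_ge0//.
by rewrite sqr_cabs real_normK ?num_real// lerDl sqr_ge0.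
Qed.

Lemma Im_le_cabs z : `|complex.Im z| <= cabs z.
Proof.
rewrite -(@ler_pXn2r _ 2) ?nnegrE ?cabs_ge0//.
by rewrite sqr_cabs real_normK ?num_real// lerDr sqr_ge0.
Qed.

Lemma cabs_le z : cabs z <= `|complex.Re z| + `|complex.Im z|.
Proof.
rewrite -(@ler_pXn2r _ 2) ?nnegrE ?cabs_ge0 ?addr_ge0//.
rewrite sqr_cabs sqrrD !real_normK ?num_real// -addrA lerD2l lerDr.
by rewrite mulrn_wge0// mulr_ge0.
Qed.

Lemma cReD z w : complex.Re (z + w) = complex.Re z + complex.Re w.
Proof. by case: z; case: w. Qed.
Lemma cImD z w : complex.Im (z + w) = complex.Im z + complex.Im w.
Proof. by case: z; case: w. Qed.
Lemma cReN z : complex.Re (- z) = - complex.Re z.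
Proof. by case: z. Qed.
Lemma cImN z : complex.Im (- z) = - complex.Im z.
Proof. by case: z. Qed.
Lemma cReM z w : complex.Re (z * w) =
  complex.Re z * complex.Re w - complex.Im z * complex.Im w.
Proof. by case: z; case: w. Qed.
Lemma cImM z w : complex.Im (z * w) =
  complex.Re z * complex.Im w + complex.Im z * complex.Re w.
Proof. by case: z; case: w. Qed.

End Modulus.

(** * Complex derivatives, in epsilon-delta form *)

Section ComplexDerivative.
Context {R : realType}.
Implicit Types (z w d h : R[i]) (f g : R[i] -> R[i]).

(** Estimates on difference quotients are inequalities between moduli, so the
    derivative is handled through this definition; cder_is_derive and is_derive_cder
    tie it to the derivative in R[i] as a normed space over itself. *)
Definition cder f z d := forall e : R, 0 < e -> exists2 r, 0 < r &
  forall h, cabs h < r -> cabs (f (z + h) - f z - d * h) <= e * cabs h.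

Lemma cder_is_derive f z d : cder f z d ->
  is_derive (z : R[i]^o) 1 (f : R[i]^o -> R[i]^o) d.
Proof.
move=> fd.
have fdz : (h^-1 *: (((f : R[i]^o -> R[i]^o) \o shift (z : R[i]^o))
    (h *: (1 : R[i]^o)) - f z) @[h --> (0:R[i]^o)^'] --> (d : R[i]^o)).
  apply/cvgrPdist_lt => -[e e'] /=; rewrite ltcE /= => /andP[/eqP -> e0].
  have [r r0 H] := fd _ (divr_gt0 e0 (ltr0Sn R 1)).
  near=> h.
  have h0 : h != 0 by near: h; rewrite near_withinE; apply: nearW.
  have hr : cabs h < r.
    have : `|h| < r%:C by near: h; apply: (@dnbhs0_lt _ (R[i]^o : normedModType R[i])); rewrite ltcR.
    by rewrite cabsE ltcR.
  have := H h hr; rewrite cabsE ltcR /= => Hh.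
  rewrite (_ : _ - _ = - (h^-1 * (f (z + h) - f z - d * h))); last first.
    rewrite [_%:A]mulr1 [(h + z)%R]addrC [h^-1 * (_ - _)]mulrBr.
    by rewrite [h^-1 * (d * h)]mulrCA mulVf// mulr1 opprB.
  rewrite cabsN cabsM cabsV mulrC ltr_pdivrMr ?cabs_gt0// (le_lt_trans Hh)//.
  by rewrite ltr_pM2r ?cabs_gt0// ltr_pdivrMr// ltr_pMr// ltr1n.
split; first exact: cvgP fdz.
exact: cvg_lim fdz.
Unshelve. all: by end_near. Qed.

Lemma derivable_cder f z : derivable (f : R[i]^o -> R[i]^o) z 1 ->
  cder f z (cderiv f z).
Proof.
rewrite /cderiv derive1E => fz; have := fz; rewrite /derivable => /cvg_ex[/= d fd].
have -> : 'D_1 (f : R[i]^o -> R[i]^o) (z : R[i]^o) = d by exact: cvg_lim fd.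
move/cvgrPdist_lt : fd => fd e e0.
have := fd e%:C; rewrite ltcR => /(_ e0).
rewrite near_withinE => /nbhs_ballP[[r r'] /=]; rewrite ltcE /= => /andP[/eqP -> r0] H.
exists r => // h hr; have [->|h0] := eqVneq h 0.
  by rewrite mulr0 subr0 addr0 subrr cabs0 mulr0.
have /(_ _ h0) := H h; rewrite -ball_normE /= sub0r normrN cabsE ltcR => /(_ hr).
rewrite cabsE ltcR => /ltW.
rewrite (_ : d - _ = - (h^-1 * (f (z + h) - f z - d * h))); last first.
  rewrite [_%:A]mulr1 [(h + z)%R]addrC [h^-1 * (_ - _)]mulrBr.
  by rewrite [h^-1 * (d * h)]mulrCA mulVf// mulr1 opprB.
by rewrite cabsN cabsM cabsV mulrC ler_pdivrMr ?cabs_gt0.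
Qed.

Lemma cder_derivable f z d : cder f z d -> derivable (f : R[i]^o -> R[i]^o) z 1.
Proof. by move=> /cder_is_derive[fz _]; exact: fz. Qed.

Lemma cderivE f z d : cder f z d -> cderiv f z = d.
Proof. by move=> /cder_is_derive[_ fd]; rewrite /cderiv derive1E; exact: fd. Qed.

Lemma cder_ext f g z d r : 0 < r ->
  (forall h, cabs h < r -> f (z + h) = g (z + h)) -> cder f z d -> cder g z d.
Proof.
move=> r0 fg fd e e0; have [s s0 H] := fd e e0.
exists (Num.min r s) => [|h]; first by rewrite lt_min r0.
rewrite lt_min => /andP[hr hs].
have fgz : f z = g z by have := fg 0; rewrite cabs0 addr0; exact.
by rewrite -fg// -fgz; exact: H.
Qed.

Lemma is_derive_cder f z d :
  is_derive (z : R[i]^o) 1 (f : R[i]^o -> R[i]^o) d -> cder f z d.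
Proof.
case=> fz <-; have := derivable_cder fz.
by rewrite /cderiv derive1E; apply.
Qed.

Lemma cder_cst (c z : R[i]) : cder (fun=> c) z 0.
Proof.
move=> e e0; exists 1 => // h _.
by rewrite subrr mul0r subr0 cabs0 mulr_ge0 ?cabs_ge0 ?ltW.
Qed.

Lemma cder_id z : cder id z 1.
Proof.
move=> e e0; exists 1 => // h _.
rewrite /= (_ : z + h - z - 1 * h = 0); last by ring.
by rewrite cabs0 mulr_ge0 ?cabs_ge0 ?ltW.
Qed.

Lemma cderD f g z d1 d2 : cder f z d1 -> cder g z d2 ->
  cder (fun w => f w + g w) z (d1 + d2).
Proof.
by move=> /cder_is_derive fd /cder_is_derive gd; apply: is_derive_cder; exact: (is_deriveD fd gd).
Qed.

Lemma cderM f g z d1 d2 : cder f z d1 -> cder g z d2 ->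
  cder (fun w => f w * g w) z (d1 * g z + f z * d2).
Proof.
move=> /cder_is_derive fd /cder_is_derive gd; apply: is_derive_cder.
have -> : d1 * g z + f z * d2 = f z *: (d2 : R[i]^o) + g z *: (d1 : R[i]^o).
  by rewrite addrC [d1 * _]mulrC.
exact: (is_deriveM fd gd).
Qed.

Lemma cder_scale f (c z d : R[i]) : cder f z d -> cder (fun w => c * f w) z (c * d).
Proof.
by move=> /(cderM (cder_cst c z)); rewrite mul0r add0r.
Qed.

Lemma cderB f g z d1 d2 : cder f z d1 -> cder g z d2 ->
  cder (fun w => f w - g w) z (d1 - d2).
Proof.
by move=> fd /(cder_scale (-1)); rewrite mulN1r => /(cderD fd); under eq_fun do rewrite mulN1r.
Qed.

Lemma cder_lip f z d : cder f z d -> exists2 r, 0 < r &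
  forall h, cabs h < r -> cabs (f (z + h) - f z) <= (cabs d + 1) * cabs h.
Proof.
move=> fd; have [r r0 H] := fd 1 ltr01; exists r => // h /H Hh.
rewrite -(subrK (d * h) (_ - _)) (le_trans (cabsD _ _))//.
by rewrite cabsM mulrDl addrC lerD2l.
Qed.

Lemma cder_continuous f z d : cder f z d -> forall e : R, 0 < e ->
  exists2 r, 0 < r & forall h, cabs h < r -> cabs (f (z + h) - f z) < e.
Proof.
move=> /cder_lip[r r0 H] e e0.
have d0 : 0 < cabs d + 1 by rewrite ltr_pwDr ?cabs_ge0.
exists (Num.min r (e / (cabs d + 1))); first by rewrite lt_min r0 divr_gt0.
move=> h; rewrite lt_min => /andP[/H hr he].
by rewrite (le_lt_trans hr)// mulrC -ltr_pdivlMr.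
Qed.

Lemma cder_comp f g z d1 d2 : cder f (g z) d1 -> cder g z d2 ->
  cder (fun w => f (g w)) z (d1 * d2).
Proof.
move=> fd gd e e0.
have c0 : 0 < cabs d2 + 1 by rewrite ltr_pwDr ?cabs_ge0.
have c1 : 0 < cabs d1 + 1 by rewrite ltr_pwDr ?cabs_ge0.
have e2 : 0 < e / 2 by rewrite divr_gt0.
have [r r0 Hf] := fd _ (divr_gt0 e2 c0).
have [s s0 Hg] := gd _ (divr_gt0 e2 c1).
have [t t0 Hl] := cder_lip gd.
exists (Num.min s (Num.min t (r / (cabs d2 + 1)))).
  by rewrite !lt_min s0 t0 divr_gt0.
move=> h; rewrite !lt_min => /and3P[hs ht hr].
set k := g (z + h) - g z.
have kh : cabs k <= (cabs d2 + 1) * cabs h by exact: Hl.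
have kr : cabs k < r by rewrite (le_lt_trans kh)// mulrC -ltr_pdivlMr.
have gk : g (z + h) = g z + k by rewrite /k [RHS]addrC subrK.
rewrite gk.
have -> : f (g z + k) - f (g z) - d1 * d2 * h =
  (f (g z + k) - f (g z) - d1 * k) + d1 * (k - d2 * h) by ring.
rewrite (le_trans (cabsD _ _))// cabsM [leRHS](splitr) lerD//.
  rewrite (le_trans (Hf _ kr))//.
  rewrite (le_trans (ler_wpM2l _ kh))//; first by rewrite divr_ge0 ?ltW.
  by rewrite mulrA divfK ?gt_eqF// -mulrA [_^-1 * _]mulrC mulrA.
rewrite (le_trans (ler_wpM2l (cabs_ge0 _) (Hg _ hs)))//.
rewrite mulrA (_ : e * cabs h / 2 = (e / 2) * cabs h); last by ring.
rewrite ler_wpM2r ?cabs_ge0// mulrCA ger_pMr//.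
by rewrite ler_pdivrMr// mul1r lerDl.
Qed.

Lemma cder_inv z : z != 0 -> cder (fun w => w^-1) z (- z ^- 2).
Proof.
move=> z0 e e0; have a0 : 0 < cabs z by rewrite cabs_gt0.
exists (Num.min (cabs z / 2) (e * cabs z ^+ 3 / 2)).
  by rewrite lt_min !divr_gt0// mulr_gt0// exprn_gt0.
move=> h; rewrite lt_min => /andP[h1 h2].
have zh : cabs z / 2 <= cabs (z + h).
  have := cabs_sub z (- h); rewrite opprK cabsN; lra.
have zh0 : z + h != 0 by rewrite -cabs_gt0 (lt_le_trans _ zh)// divr_gt0.
have -> : (z + h)^-1 - z^-1 - - z ^- 2 * h = h ^+ 2 / (z ^+ 2 * (z + h)).
  by field; rewrite zh0.
rewrite cabsM cabsV cabsM !cabsX ler_pdivrMr; last first.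
  by rewrite mulr_gt0 ?exprn_gt0// cabs_gt0.
rewrite expr2 -!mulrA mulrCA ler_wpM2l ?cabs_ge0// (le_trans (ltW h2))//.
rewrite (_ : e * _ / 2 = e * (cabs z * (cabs z * (cabs z / 2)))); last by field.
by do 3![apply: ler_wpM2l; [exact: ltW|]].
Qed.

(** Restriction to a real line through z turns complex derivatives into real ones,
    which gives access to the mean value theorem and to the fundamental theorem of
    calculus. Imaginary parts are obtained from f multiplied by -i. *)
Lemma is_derive_line f z v d (t : R) : cder f (z + t%:C * v) d ->
  is_derive t 1 (fun s : R => complex.Re (f (z + s%:C * v))) (complex.Re (d * v)).
Proof.
move=> fd.
suff fdt : (h^-1 *: (((fun s : R => complex.Re (f (z + s%:C * v))) \o shift t)
    (h *: (1 : R^o)) - complex.Re (f (z + t%:C * v))) @[h --> (0:R)^'] -->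
    (complex.Re (d * v) : R^o)).
  by split; [exact: cvgP fdt | exact: cvg_lim fdt].
apply/cvgrPdist_lt => e e0.
have v0 : 0 < cabs v + 1 by rewrite ltr_pwDr ?cabs_ge0.
have [r r0 H] := fd _ (divr_gt0 (divr_gt0 e0 (ltr0Sn R 1)) v0).
near=> h.
have h0 : h != 0 by near: h; exact: nbhs_dnbhs_neq.
have hr : `|h| < r / (cabs v + 1) by near: h; apply: dnbhs0_lt; rewrite divr_gt0.
have hv : cabs (h%:C * v) <= `|h| * (cabs v + 1).
  by rewrite cabsM cabsR ler_wpM2l// lerDl.
have /H {}H : cabs (h%:C * v) < r.
  by rewrite (le_lt_trans hv)// -ltr_pdivlMr.
rewrite /= [_%:A]mulr1.
have -> : (h + t)%:C * v = t%:C * v + h%:C * v.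
  by rewrite rmorphD mulrDl addrC.
rewrite addrA.
set A := f _ in H *; set B := f _ in H *.
have hB : complex.Re (A - B - d * (h%:C * v)) =
  complex.Re A - complex.Re B - h * complex.Re (d * v).
  by rewrite mulrCA !cReD !cReN [in complex.Re (h%:C * _)]cReM mul0r subr0.
rewrite (_ : _ - _ = - (h^-1 * complex.Re (A - B - d * (h%:C * v)))); last first.
  by rewrite hB mulrBr mulrA mulVf// mul1r opprB.
rewrite normrN normrM normfV mulrC ltr_pdivrMr ?normr_gt0//.
rewrite (le_lt_trans (Re_le_cabs _))// (le_lt_trans H)//.
rewrite (le_lt_trans (ler_wpM2l _ hv))//; first by rewrite ltW// !divr_gt0.
rewrite mulrCA divfK ?gt_eqF// mulrC ltr_pM2r ?normr_gt0//.
by rewrite ltr_pdivrMr// ltr_pMr// ltr1n.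
Unshelve. all: by end_near. Qed.

End ComplexDerivative.

(** * Measurability on the half-plane *)

Section Measurability.
Context {R : realType}.
Implicit Types (z w d h : R[i]) (f g : R[i] -> R[i]).
Local Notation RR := (measurableTypeR R * measurableTypeR R)%type.

(** Every point of A lies in a square contained in A, with rational centre and half-side
    1 / (n + 1), so A is a countable union of measurable rectangles. *)
Lemma box_open_measurable (A : set RR) :
  (forall p, A p -> exists2 e : R, 0 < e & forall q, `|q.1 - p.1| < e ->
     `|q.2 - p.2| < e -> A q) -> measurable A.
Proof.
move=> openA.
pose box (a b : rat) (n : nat) : set RR :=
  `](ratr a : R) - n.+1%:R^-1, (ratr a : R) + n.+1%:R^-1[ `*`
  `](ratr b : R) - n.+1%:R^-1, (ratr b : R) + n.+1%:R^-1[.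
pose B a b n := if pselect (box a b n `<=` A) then box a b n else set0.
have -> : A = \bigcup_(a : rat) \bigcup_(b : rat) \bigcup_(n : nat) B a b n.
  apply/seteqP; split => [p Ap|p [a _ [b _ [n _]]]]; last first.
    by rewrite /B; case: pselect => //= s /s.
  have [e e0 eA] := openA p Ap.
  have e2 : 0 < e / 2 by rewrite divr_gt0.
  have [n ne] := ltr_add_invr (ltr_pwDr e2 (lexx 0)).
  rewrite add0r add0r in ne.
  have n0 : 0 < n.+1%:R^-1 :> R by rewrite invr_gt0.
  have [a /itvP ha] := rat_in_itvoo (ltr_pwDr n0 (lexx p.1)).
  have [b /itvP hb] := rat_in_itvoo (ltr_pwDr n0 (lexx p.2)).
  have ha1 : p.1 < ratr a by rewrite ha.
  have ha2 : ratr a < p.1 + n.+1%:R^-1 by rewrite ha.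
  have hb1 : p.2 < ratr b by rewrite hb.
  have hb2 : ratr b < p.2 + n.+1%:R^-1 by rewrite hb.
  exists a => //; exists b => //; exists n => //.
  rewrite /B; case: pselect => [?|[]] /=.
    rewrite /box; split => /=; rewrite in_itv /= ltrBlDr ?ha2 ?hb2 /=.
      by rewrite (lt_trans ha1)// ltrDl.
    by rewrite (lt_trans hb1)// ltrDl.
  move=> q [/=]; rewrite !in_itv /= => /andP[q1 q2] /andP[q3 q4].
  have [u1 u2] : ratr a - e / 2 < q.1 /\ q.1 < ratr a + e / 2.
    split; first by rewrite (le_lt_trans _ q1)// lerB// ltW.
    by rewrite (lt_trans q2)// ltrD2l.
  have [v1 v2] : ratr b - e / 2 < q.2 /\ q.2 < ratr b + e / 2.
    split; first by rewrite (le_lt_trans _ q3)// lerB// ltW.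
    by rewrite (lt_trans q4)// ltrD2l.
  have ha3 : ratr a < p.1 + e / 2 by rewrite (lt_trans ha2)// ltrD2l.
  have hb3 : ratr b < p.2 + e / 2 by rewrite (lt_trans hb2)// ltrD2l.
  by apply: eA; rewrite ltr_norml; apply/andP; split; lra.
apply: bigcupT_measurable_rat => a; apply: bigcupT_measurable_rat => b.
apply: bigcupT_measurable => n; rewrite /B; case: pselect => //= _.
by apply: measurableX; exact: measurable_itv.
Qed.

Lemma measurable_halfplane2 : measurable (@halfplane2 R).
Proof.
apply: box_open_measurable => p p0; exists p.2 => // q _.
by rewrite ltr_norml => /andP[]; rewrite /halfplane2 /= => ? _; lra.
Qed.

Lemma measurable_halfplane_continuous (F : R[i] -> R) :
  (forall z, halfplane z -> forall e : R, 0 < e -> exists2 r : R, 0 < r &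
     forall h, cabs h < r -> `|F (z + h) - F z| < e) ->
  measurable_fun halfplane2 (planar F).
Proof.
move=> cF; apply: (measurability _ (RGenOInfty.measurableE R)).
move=> _ [_ [x ->] <-]; apply: box_open_measurable => -[a b] [/= b0].
rewrite /planar /= in_itv /= andbT => xF.
have [r r0 H] := cF (a +i* b) b0 _ (ltac:(by rewrite subr_gt0; exact: xF) : 0 < F (a +i* b) - x).
exists (Num.min b (r / 2)); first by rewrite lt_min b0 divr_gt0.
move=> [c d] /=; rewrite !lt_min => /andP[_ cr] /andP[db dr]; split => /=.
  by move: db; rewrite ltr_norml /halfplane2 /= => /andP[]; lra.
rewrite in_itv /= andbT.
have /H : cabs ((c - a) +i* (d - b)) < r by rewrite (le_lt_trans (cabs_le _))//=; lra.
rewrite (_ : a +i* b + ((c - a) +i* (d - b)) = c +i* d); last first.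
  by simpc; rewrite ![_ + (_ - _)]addrC !subrK.
by rewrite ltr_norml => /andP[]; lra.
Qed.

Definition cmeas f :=
  measurable_fun halfplane2 (planar (fun w => complex.Re (f w))) /\
  measurable_fun halfplane2 (planar (fun w => complex.Im (f w))).

Lemma cmeas_holomorphic f : holomorphic f -> cmeas f.
Proof.
move=> hf; split; apply: measurable_halfplane_continuous => z z0 e e0.
- have [r r0 H] := cder_continuous (derivable_cder (hf z z0)) e0.
  exists r => // h /H; apply: le_lt_trans.
  by rewrite -cReN -cReD Re_le_cabs.
- have [r r0 H] := cder_continuous (derivable_cder (hf z z0)) e0.
  exists r => // h /H; apply: le_lt_trans.
  by rewrite -cImN -cImD Im_le_cabs.
Qed.

Lemma cReJ z : complex.Re z^*%C = complex.Re z.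
Proof. by case: z. Qed.
Lemma cImJ z : complex.Im z^*%C = - complex.Im z.
Proof. by case: z. Qed.

Lemma cmeas_conj f : cmeas f -> cmeas (fun w => (f w)^*%C).
Proof.
case=> fr fi; split; rewrite /planar.
  by under eq_fun do rewrite cReJ.
by under eq_fun do rewrite cImJ; exact: measurableT_comp.
Qed.

Lemma cmeasM f g : cmeas f -> cmeas g -> cmeas (fun w => f w * g w).
Proof.
move=> [fr fi] [gr gi]; split; rewrite /planar.
  by under eq_fun do rewrite cReM; apply: measurable_funB; exact: measurable_funM.
by under eq_fun do rewrite cImM; apply: measurable_funD; exact: measurable_funM.
Qed.

Lemma cmeasD f g : cmeas f -> cmeas g -> cmeas (fun w => f w + g w).
Proof.
move=> [fr fi] [gr gi]; split; rewrite /planar.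
  by under eq_fun do rewrite cReD; exact: measurable_funD.
by under eq_fun do rewrite cImD; exact: measurable_funD.
Qed.

Lemma cmeas_cst (c : R[i]) : cmeas (fun=> c).
Proof. by split; exact: measurable_cst. Qed.

Lemma cmeasB f g : cmeas f -> cmeas g -> cmeas (fun w => f w - g w).
Proof.
move=> fm /(cmeasM (cmeas_cst (-1)))/(cmeasD fm).
by under eq_fun do rewrite mulN1r.
Qed.

Lemma measurable_cabs f : cmeas f ->
  measurable_fun halfplane2 (planar (fun w => cabs (f w))).
Proof.
move=> [fr fi]; rewrite /planar.
rewrite (_ : (fun q => _) = Num.sqrt \o
  (fun q => planar (fun w => complex.Re (f w)) q ^+ 2 +
            planar (fun w => complex.Im (f w)) q ^+ 2)).
  apply: measurableT_comp.
    by apply: continuous_measurable_fun; exact: sqrt_continuous.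
  by apply: measurable_funD; exact: measurable_funX.
by apply/funext => q /=; rewrite /planar /cabs; case: (f _).
Qed.

End Measurability.

(** * Area integrals of real and complex functions *)

Section AreaIntegral.
Context {R : realType}.
Implicit Types (z w d h c : R[i]) (f g : R[i] -> R[i]) (F G : R[i] -> R).

Definition hmeas F := measurable_fun (@halfplane2 R) (planar F).

Definition aint F : \bar R := (\int[dV]_(q in halfplane2) (planar F q)%:E)%E.

Let mH := @measurable_halfplane2 R.

Lemma aint_ge0 F : (forall w, halfplane w -> 0 <= F w) -> (0 <= aint F)%E.
Proof. by move=> F0; apply: integral_ge0 => q q0; rewrite lee_fin; exact: F0. Qed.

Lemma eq_aint F G : (forall w, halfplane w -> F w = G w) -> aint F = aint G.
Proof.
by move=> FG; apply: eq_integral => q; rewrite inE => q0; congr EFin; exact: FG.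
Qed.

Lemma aint_le F G : hmeas F -> hmeas G ->
  (forall w, halfplane w -> 0 <= F w <= G w) -> (aint F <= aint G)%E.
Proof.
move=> mF mG FG; apply: ge0_le_integral => //.
- by move=> q q0; rewrite lee_fin; have /andP[] := FG (q.1 +i* q.2) q0.
- exact/measurable_EFinP.
- exact/measurable_EFinP.
- by move=> q q0; rewrite lee_fin; have /andP[] := FG (q.1 +i* q.2) q0.
Qed.

Lemma aintZ F (k : R) : hmeas F -> (forall w, halfplane w -> 0 <= F w) -> 0 <= k ->
  aint (fun w => k * F w) = (k%:E * aint F)%E.
Proof.
move=> mF F0 k0; rewrite /aint.
under eq_integral do rewrite /planar EFinM.
rewrite ge0_integralZl//; first exact/measurable_EFinP.
by move=> q q0; rewrite lee_fin; exact: F0.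
Qed.

Lemma aintD F G : hmeas F -> hmeas G ->
  (forall w, halfplane w -> 0 <= F w) -> (forall w, halfplane w -> 0 <= G w) ->
  aint (fun w => F w + G w) = (aint F + aint G)%E.
Proof.
move=> mF mG F0 G0; rewrite /aint.
under eq_integral do rewrite /planar EFinD.
rewrite ge0_integralD//; do ?exact/measurable_EFinP.
by move=> q q0; rewrite lee_fin; exact: F0.
by move=> q q0; rewrite lee_fin; exact: G0.
Qed.

Lemma hintegrableP F : dV.-integrable halfplane2 (EFin \o planar F) <->
  hmeas F /\ (aint (fun w => `|F w|%R) < +oo)%E.
Proof.
split=> [/integrableP[/measurable_EFinP mF iF]|[mF iF]]; first by split.
by apply/integrableP; split=> //; exact/measurable_EFinP.
Qed.

Lemma hmeas_norm F : hmeas F -> hmeas (fun w => `|F w|).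
Proof. by move=> mF; exact: measurableT_comp. Qed.

Lemma cintegrableP f : cintegrable f <->
  cmeas f /\ (aint (fun w => cabs (f w)) < +oo)%E.
Proof.
split=> [[/hintegrableP[mr ir] /hintegrableP[mi ii]]|[[mr mi] fy]].
  split=> //; have mf : cmeas f by split.
  have mR := hmeas_norm mr; have mI := hmeas_norm mi.
  apply: (@le_lt_trans _ _ (aint (fun w => `|complex.Re (f w)| + `|complex.Im (f w)|)%R)).
    apply: aint_le; [exact: measurable_cabs|exact: measurable_funD|].
    by move=> w w0; rewrite cabs_ge0 cabs_le.
  by rewrite aintD//; exact: lte_add_pinfty.
have mc := @measurable_cabs _ f (conj mr mi).
split; apply/hintegrableP; split=> //; apply: le_lt_trans fy; apply: aint_le => //.
- exact: hmeas_norm.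
- by move=> w _; rewrite normr_ge0 Re_le_cabs.
- exact: hmeas_norm.
- by move=> w _; rewrite normr_ge0 Im_le_cabs.
Qed.

Lemma le_cintegrable f (G : R[i] -> R) : cmeas f -> hmeas G ->
  (forall w, halfplane w -> cabs (f w) <= G w) -> (aint G < +oo)%E -> cintegrable f.
Proof.
move=> mf mG fG Gy; apply/cintegrableP; split=> //; apply: le_lt_trans Gy.
by apply: aint_le => // [|w w0]; [exact: measurable_cabs|rewrite cabs_ge0 fG].
Qed.

Lemma cintegrable_cmeas f : cintegrable f -> cmeas f.
Proof. by move=> /cintegrableP[]. Qed.

Lemma cintegrableD f g : cintegrable f -> cintegrable g ->
  cintegrable (fun w => f w + g w).
Proof.
move=> /cintegrableP[mf fy] /cintegrableP[mg gy].
apply: (le_cintegrable (G := fun w => cabs (f w) + cabs (g w))).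
- exact: cmeasD.
- by apply: measurable_funD; exact: measurable_cabs.
- by move=> w _; exact: cabsD.
- rewrite aintD; [exact: lte_add_pinfty|exact: measurable_cabs..| |];
    by move=> *; exact: cabs_ge0.
Qed.

Lemma cintegrableZ c f : cintegrable f -> cintegrable (fun w => c * f w).
Proof.
move=> /cintegrableP[mf fy]; apply/cintegrableP; split.
  exact: cmeasM (cmeas_cst c) mf.
rewrite (eq_aint (G := fun w => cabs c * cabs (f w))); last by move=> w _; rewrite cabsM.
rewrite aintZ ?cabs_ge0//; [|exact: measurable_cabs|by move=> *; exact: cabs_ge0].
by rewrite lte_mul_pinfty ?lee_fin ?cabs_ge0.
Qed.

Lemma cintegralD f g : cintegrable f -> cintegrable g ->
  cintegral (fun w => f w + g w) = cintegral f + cintegral g.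
Proof.
move=> [fr fi] [gr gi]; rewrite /cintegral.
under eq_Rintegral do rewrite /planar cReD.
under [X in _ +i* X = _]eq_Rintegral do rewrite /planar cImD.
by rewrite !RintegralD.
Qed.

Lemma cintegralZ c f : cintegrable f ->
  cintegral (fun w => c * f w) = c * cintegral f.
Proof.
move=> [fr fi]; rewrite /cintegral.
under eq_Rintegral do rewrite /planar cReM.
under [X in _ +i* X = _]eq_Rintegral do rewrite /planar cImM.
case: c => a b /=.
have iZ k F : dV.-integrable halfplane2 (EFin \o planar F) ->
    dV.-integrable halfplane2 (EFin \o (fun q => k * planar F q)).
  by move=> iF; apply: (eq_integrable mH _ _ _ (integrableZl mH k iF)).
rewrite RintegralB//; [|exact: (iZ _ _ fr)|exact: (iZ _ _ fi)].
rewrite RintegralD//; [|exact: (iZ _ _ fi)|exact: (iZ _ _ fr)].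
by rewrite !RintegralZl//; simpc.
Qed.

Lemma eq_cintegral f g : (forall w, halfplane w -> f w = g w) ->
  cintegral f = cintegral g.
Proof.
move=> fg; rewrite /cintegral; congr (_ +i* _); apply: eq_Rintegral => q; rewrite inE => q0;
by rewrite /planar fg.
Qed.

(** The two coordinates of the integral are bounded separately, hence the factor 2. *)
Lemma cintegral_le f : cintegrable f ->
  ((cabs (cintegral f))%:E <= 2%:E * aint (fun w => cabs (f w)))%E.
Proof.
move=> fi; have /cintegrableP[mf fy] := fi; case: fi => ir ii.
have f0 : (0 <= aint (fun w => cabs (f w)))%E.
  by apply: aint_ge0 => *; exact: cabs_ge0.
have fin : aint (fun w => cabs (f w)) \is a fin_num by rewrite ge0_fin_numE.
apply: (@le_trans _ _ (`|complex.Re (cintegral f)| + `|complex.Im (cintegral f)|)%R%:E).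
  by rewrite lee_fin cabs_le.
rewrite -(fineK fin) -EFinM lee_fin mulr_natl mulr2n /=.
have H F : dV.-integrable halfplane2 (EFin \o planar F) ->
    (forall w, `|F w| <= cabs (f w)) ->
    `|Rintegral dV halfplane2 (planar F)| <= fine (aint (fun w => cabs (f w))).
  move=> iF Ff; apply: (le_trans (le_normr_Rintegral _ _)) => //.
  have /hintegrableP[mF Fy] := iF.
  apply: fine_le => //.
    rewrite ge0_fin_numE; first exact: Fy.
    exact: (aint_ge0 (F := fun w => `|F w|)).
  apply: (aint_le (F := fun w => `|F w|)); [exact: hmeas_norm|exact: measurable_cabs|].
  by move=> w _; rewrite normr_ge0 Ff.
by apply: lerD; apply: H => // w; rewrite ?Re_le_cabs ?Im_le_cabs.
Qed.

End AreaIntegral.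

(** * The kernel and its integral transforms *)

Section Kernel.
Context {R : realType}.
Implicit Types (z w d h c : R[i]) (f g : R[i] -> R[i]) (n : nat).

Lemma conjcB z w : (z - w)^*%C = z^*%C - w^*%C.
Proof. exact: rmorphB. Qed.

Lemma conjcM z w : (z * w)^*%C = z^*%C * w^*%C.
Proof. exact: rmorphM. Qed.

Lemma conjcX z n : (z ^+ n)^*%C = z^*%C ^+ n.
Proof. exact: rmorphXn. Qed.

(** The modulus of the inverse square root of the Bergman kernel: the distance from
    z to the reflection of w in the real axis. Unlike |z - w| it never vanishes, and it
    dominates both heights. *)
Definition kdist z w : R := cabs (z - w^*%C).

Lemma kdistC z w : kdist z w = kdist w z.
Proof.
rewrite /kdist -cabs_conj -cabsN; congr cabs.
by rewrite conjcB conjcK opprB.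
Qed.

Lemma kdist_Im z w : halfplane z -> halfplane w ->
  complex.Im z + complex.Im w <= kdist z w.
Proof.
move=> _ _; have := Im_le_cabs (z - w^*%C).
by rewrite cImD cImN cImJ opprK; apply: le_trans; exact: ler_norm.
Qed.

Lemma kdist_Re z w : `|complex.Re z - complex.Re w| <= kdist z w.
Proof. by have := Re_le_cabs (z - w^*%C); rewrite cReD cReN cReJ. Qed.

Lemma kdist_Iml z w : halfplane z -> halfplane w -> complex.Im z <= kdist z w.
Proof.
move=> z0 w0; apply: le_trans (kdist_Im z0 w0).
by rewrite lerDl ltW.
Qed.

Lemma kdist_gt0 z w : halfplane z -> halfplane w -> 0 < kdist z w.
Proof. by move=> z0 w0; exact: lt_le_trans (kdist_Iml z0 w0). Qed.

Lemma kernel_neq0 z w : halfplane z -> halfplane w -> z - w^*%C != 0.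
Proof. by move=> z0 w0; rewrite -cabs_gt0; exact: kdist_gt0. Qed.

Lemma kdist_shift z z' w : kdist z w <= kdist z' w + cabs (z - z').
Proof.
rewrite addrC /kdist (le_trans _ (cabsD _ _))// le_eqVlt; apply/orP; left.
by apply/eqP; congr cabs; ring.
Qed.

(** Changing the base point changes the kernel by a bounded factor, so convergence of
    an integral against it does not depend on the point. *)
Lemma kdist_le z z' w : halfplane z' -> halfplane w ->
  kdist z w <= (1 + cabs (z - z') / complex.Im z') * kdist z' w.
Proof.
move=> z0 w0; apply: (le_trans (kdist_shift _ z' _)).
rewrite mulrDl mul1r lerD2l -mulrA ler_peMr ?cabs_ge0//.
by rewrite mulrC ler_pdivlMr ?mul1r ?kdist_Iml.
Qed.

Lemma cmeas_kernel n z : halfplane z -> cmeas (fun w => (z - w^*%C) ^- n).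
Proof.
move=> z0; have -> : (fun w => (z - w^*%C) ^- n) =
    (fun w => ((z^*%C - w) ^- n)^*%C).
  by apply/funext => w; rewrite conjc_inv conjcX conjcB conjcK.
apply: cmeas_conj; apply: cmeas_holomorphic => w w0.
have w1 : z^*%C - w != 0.
  apply: contraTneq (kernel_neq0 z0 w0) => e; rewrite negbK.
  by rewrite -(conjcK z) -conjcB e conjc0.
elim: n => [|n IH].
  by under eq_fun do rewrite expr0 invr1; exact: cder_derivable (cder_cst _ _).
under eq_fun do rewrite exprS invfM.
have d1 : cder (fun w => (z^*%C - w)^-1) w (- (z^*%C - w) ^- 2 * (0 - 1)).
  apply: (cder_comp (f := fun z => z^-1)); first exact: cder_inv.
  by apply: cderB; [exact: cder_cst|exact: cder_id].
exact: cder_derivable (cderM d1 (derivable_cder IH)).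
Qed.

Fixpoint taylor_cst n : R := if n is m.+1 then 2 * taylor_cst m + 2 * m.+1%:R else 0.

Lemma taylor_cst_ge0 n : 0 <= taylor_cst n.
Proof. by elim: n => //= n IH; rewrite addr_ge0 ?mulr_ge0. Qed.

(** Second-order Taylor formula for a -> a^-n, with A = 1/a and B = 1/(a + h): the
    relation B - A = - h A B replaces division, and n is handled by induction. The
    remainder is of the size needed to differentiate under the integral sign. *)
Lemma inverse_power_taylor n (A B h : R[i]) : B - A = - (h * A * B) ->
  cabs B <= 2 * cabs A ->
  cabs (B ^+ n - A ^+ n + n%:R * h * A ^+ n.+1)
    <= taylor_cst n * cabs h ^+ 2 * cabs A ^+ n.+2.
Proof.
move=> BA hB; elim: n => [|n IH].
  by rewrite !expr0 subrr add0r !mul0r cabs0 lexx.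
have E1 : B - A + h * A ^+ 2 = h ^+ 2 * A ^+ 2 * B.
  rewrite BA (_ : - (h * A * B) + h * A ^+ 2 = - (h * A * (B - A))); last by ring.
  by rewrite BA; ring.
have -> : B ^+ n.+1 - A ^+ n.+1 + n.+1%:R * h * A ^+ n.+2 =
  B * (B ^+ n - A ^+ n + n%:R * h * A ^+ n.+1) + (B - A + h * A ^+ 2) * A ^+ n
  - n%:R * h * A ^+ n.+1 * (B - A).
  by rewrite [in LHS]mulrSr !exprS; ring.
rewrite E1 BA.
have c0 := cabs_ge0 A; have c1 := cabs_ge0 h.
have t1 : cabs (B * (B ^+ n - A ^+ n + n%:R * h * A ^+ n.+1)) <=
    2 * taylor_cst n * cabs h ^+ 2 * cabs A ^+ n.+3.
  rewrite cabsM (le_trans (ler_pM (cabs_ge0 _) (cabs_ge0 _) hB IH))//.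
  rewrite le_eqVlt; apply/orP; left; apply/eqP.
  by rewrite [cabs A ^+ n.+3]exprS; move: (taylor_cst n) (_ ^+ n.+2) => C X; ring.
have t2 : cabs (h ^+ 2 * A ^+ 2 * B * A ^+ n) <= 2 * cabs h ^+ 2 * cabs A ^+ n.+3.
  rewrite !cabsM !cabsX -!expr2.
  have -> : 2 * cabs h ^+ 2 * cabs A ^+ n.+3 =
    cabs h ^+ 2 * cabs A ^+ 2 * (2 * cabs A) * cabs A ^+ n by rewrite !exprS; ring.
  by rewrite ler_wpM2r ?exprn_ge0// ler_wpM2l// mulr_ge0 ?exprn_ge0.
have t3 : cabs (- (n%:R * h * A ^+ n.+1 * - (h * A * B))) <=
    2 * n%:R * cabs h ^+ 2 * cabs A ^+ n.+3.
  rewrite cabsN !cabsM cabsN !cabsM cabs_nat cabsX.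
  have -> : 2 * n%:R * cabs h ^+ 2 * cabs A ^+ n.+3 =
    n%:R * cabs h * cabs A ^+ n.+1 * (cabs h * cabs A * (2 * cabs A)).
    by rewrite !exprS; ring.
  by rewrite ler_wpM2l ?mulr_ge0 ?exprn_ge0// ler_wpM2l ?mulr_ge0.
apply: (le_trans (cabsD _ _)); apply: (le_trans (lerD (cabsD _ _) (lexx _))).
apply: (le_trans (lerD (lerD t1 t2) t3)).
rewrite /= le_eqVlt; apply/orP; left; apply/eqP.
by rewrite [n.+1%:R]mulrSr; move: (taylor_cst n) (_ ^+ n.+3) => C X; ring.
Qed.

Definition kint n f z : R[i] := cintegral (fun w => (z - w^*%C) ^- n * f w).

Definition kintegrable n f := forall z, halfplane z ->
  cintegrable (fun w => (z - w^*%C) ^- n * f w).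

Lemma kintegrableS n f : kintegrable n f -> kintegrable n.+1 f.
Proof.
move=> H z z0; have /cintegrableP[mk ky] := H z z0.
have mc : hmeas (fun w => cabs ((z - w^*%C) ^- n * f w)) by exact: measurable_cabs.
apply: (le_cintegrable
  (G := fun w => (complex.Im z)^-1 * cabs ((z - w^*%C) ^- n * f w))).
- have -> : (fun w => (z - w^*%C) ^- n.+1 * f w) =
      (fun w => (z - w^*%C) ^- 1 * ((z - w^*%C) ^- n * f w)).
    by apply/funext => w; rewrite exprS invfM expr1 mulrA.
  by apply: cmeasM => //; exact: cmeas_kernel.
- by apply: measurable_funM => //; exact: measurable_cst.
- move=> w w0; rewrite !cabsM mulrA ler_wpM2r ?cabs_ge0//.
  rewrite exprS invfM cabsM ler_wpM2r ?cabs_ge0//.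
  by rewrite cabsV lef_pV2 ?posrE ?kdist_gt0// kdist_Iml.
- rewrite aintZ//; first by rewrite lte_mul_pinfty ?lee_fin ?invr_ge0 ?ltW.
    by move=> *; exact: cabs_ge0.
  by rewrite invr_ge0 ltW.
Qed.

(** Differentiation under the integral sign: by inverse_power_taylor the error of the
    difference quotient is O(h^2) times an integrable function, for |h| small against
    the height of z. *)
Lemma cder_kint n f z : kintegrable n f -> halfplane z ->
  cder (kint n f) z (- n%:R * kint n.+1 f z).
Proof.
move=> H z0 e e0; set y := complex.Im z.
have y0 : 0 < y by [].
have /cintegrableP[mk ky] := H z z0.
have mc : hmeas (fun w => cabs ((z - w^*%C) ^- n * f w)) by exact: measurable_cabs.
have kfin : aint (fun w => cabs ((z - w^*%C) ^- n * f w)) \is a fin_num.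
  by rewrite ge0_fin_numE// aint_ge0// => *; exact: cabs_ge0.
set I := fine (aint (fun w => cabs ((z - w^*%C) ^- n * f w))).
have I0 : 0 <= I by rewrite fine_ge0// aint_ge0// => *; exact: cabs_ge0.
pose K := 2 * (taylor_cst n * y ^- 2 * I).
have K0 : 0 <= K by rewrite !mulr_ge0// ?taylor_cst_ge0// invr_ge0 exprn_ge0// ltW.
exists (Num.min (y / 2) (e / (K + 1))).
  by rewrite lt_min !divr_gt0// ltr_pwDr.
move=> h; rewrite lt_min => /andP[hy he].
have zh0 : halfplane (z + h).
  rewrite /halfplane /= cImD; have := Im_le_cabs h; rewrite ler_norml => /andP[+ _].
  rewrite -/y; lra.
have i1 := H _ zh0; have i2 := H _ z0; have i3 := kintegrableS H z0.
have -> : kint n f (z + h) - kint n f z - - n%:R * kint n.+1 f z * h =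
  cintegral (fun w => ((z + h - w^*%C) ^- n - (z - w^*%C) ^- n
    + n%:R * h * (z - w^*%C) ^- n.+1) * f w).
  rewrite (eq_cintegral (g := fun w => ((z + h - w^*%C) ^- n * f w +
     (-1) * ((z - w^*%C) ^- n * f w)) + (n%:R * h) * ((z - w^*%C) ^- n.+1 * f w))).
    have i4 := cintegrableZ (-1) i2; have i5 := cintegrableZ (n%:R * h) i3.
    rewrite cintegralD//; last exact: cintegrableD.
    rewrite cintegralD// !cintegralZ// -!/(kint _ _ _).
    by move: (kint n f (z + h)) (kint n f z) (kint n.+1 f z) n%:R => a b c m; ring.
  move=> w _; move: (_ ^- n) (_ ^- n) (_ ^- n.+1) n%:R => a b c m; ring.
have ei : cintegrable (fun w => ((z + h - w^*%C) ^- n - (z - w^*%C) ^- n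
    + n%:R * h * (z - w^*%C) ^- n.+1) * f w).
  have := cintegrableD (cintegrableD i1 (cintegrableZ (-1) i2)) (cintegrableZ (n%:R * h) i3).
  congr cintegrable; apply/funext => w.
  by move: (_ ^- n) (_ ^- n) (_ ^- n.+1) n%:R => a b c m; ring.
rewrite -lee_fin; apply: (le_trans (cintegral_le ei)).
have me := measurable_cabs (cintegrable_cmeas ei).
have tk0 : 0 <= taylor_cst n * cabs h ^+ 2 * y ^- 2.
  by rewrite !mulr_ge0 ?taylor_cst_ge0 ?exprn_ge0 ?cabs_ge0// invr_ge0 exprn_ge0// ltW.
have tay : (aint (fun w => cabs (((z + h - w^*%C) ^- n - (z - w^*%C) ^- n
    + n%:R * h * (z - w^*%C) ^- n.+1) * f w)%R) <=
    (taylor_cst n * cabs h ^+ 2 * y ^- 2 * I)%:E)%E.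
  rewrite EFinM /I fineK// -aintZ//; last by move=> *; exact: cabs_ge0.
  apply: aint_le => //.
    by apply: measurable_funM => //; exact: measurable_cst.
  move=> w w0; rewrite cabs_ge0/= !cabsM mulrA ler_wpM2r ?cabs_ge0//.
  rewrite -!exprVn (le_trans (inverse_power_taylor n _ _))//.
  - have zw := kernel_neq0 z0 w0; have zhw := kernel_neq0 zh0 w0.
    by field; rewrite zw zhw.
  - rewrite !cabsV ler_pdivlMr ?kdist_gt0// mulrC ler_pdivrMr ?kdist_gt0//.
    have := kdist_shift z (z + h) w; rewrite opprD addrA subrr sub0r cabsN.
    have := kdist_Iml z0 w0; rewrite -/(kdist _ _) -/y -/(kdist _ _); lra.
  - rewrite -[leRHS]mulrA ler_wpM2l ?mulr_ge0 ?taylor_cst_ge0 ?exprn_ge0 ?cabs_ge0//.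
    rewrite cabsX -[n.+2]addn2 exprD mulrC ler_wpM2r ?exprn_ge0 ?cabs_ge0//.
    rewrite cabsV; apply: lerXn2r; rewrite ?nnegrE ?invr_ge0 ?cabs_ge0 ?(ltW y0)//.
    by rewrite lef_pV2 ?posrE ?kdist_gt0//; exact: kdist_Iml.
apply: (le_trans (lee_wpmul2l _ tay)) => //.
rewrite -EFinM lee_fin.
have -> : 2 * (taylor_cst n * cabs h ^+ 2 * y ^- 2 * I) = (K * cabs h) * cabs h.
  by rewrite /K; ring.
rewrite ler_wpM2r ?cabs_ge0//.
move: he; rewrite ltr_pdivlMr ?ltr_pwDr// => he.
by rewrite (le_trans _ (ltW he))// mulrC ler_wpM2l ?cabs_ge0// lerDl.
Qed.

End Kernel.

(** * One-dimensional integrals *)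

Section RealIntegrals.
Context {R : realType}.
Implicit Types (f F : R -> R) (a b : R).
Local Notation mu := (@lebesgue_measure R).

Lemma integral_antiderivative f F a b : a < b ->
  (forall x, a <= x <= b -> {for x, continuous f}) ->
  (forall x, a <= x <= b -> is_derive x 1 F (f x)) ->
  (\int[mu]_(x in `[a, b]) (f x)%:E = (F b - F a)%:E)%E.
Proof.
move=> ab cf dF; rewrite (@continuous_FTC2 _ f F)//.
- by apply: continuous_in_subspaceT => x; rewrite inE/= in_itv/=; exact: cf.
- have : {within `[a, b], continuous F}.
    by apply: derivable_within_continuous => x; rewrite in_itv/= => /dF[].
  move/(continuous_within_itvP _ ab) => [_ ? ?]; split => // x.
  by rewrite in_itv/= => /andP[? ?]; have [] : is_derive x 1 F (f x) by apply: dF; rewrite !ltW.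
- move=> x; rewrite in_itv/= => /andP[? ?]; rewrite derive1E.
  by have [_ ->] : is_derive x 1 F (f x) by apply: dF; rewrite !ltW.
Qed.

(** An improper integral of a nonnegative derivative is bounded by the oscillation of
    the primitive; monotone convergence along the exhaustion avoids any limit of F. *)
Lemma integral_exhaustion_le (A : set R) f F (a b : nat -> R) (M : R) :
  (forall n, a n < b n) ->
  (forall n m, (n <= m)%N -> a m <= a n /\ b n <= b m) ->
  A = \bigcup_n [set` `[a n, b n]] ->
  (forall x, A x -> 0 <= f x) ->
  (forall x, A x -> {for x, continuous f}) ->
  (forall x, A x -> is_derive x 1 F (f x)) ->
  (forall x y, A x -> A y -> F y - F x <= M) ->
  (\int[mu]_(x in A) (f x)%:E <= M%:E)%E.
Proof.
move=> ab mon AE f0 cf dF FM.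
have inA n x : a n <= x <= b n -> A x.
  by move=> h; rewrite AE; exists n => //=; rewrite in_itv.
have lim : ((\int[mu]_(x in [set` `[a i, b i]]) (f x)%:E)%E @[i --> \oo] -->
    (\int[mu]_(x in \bigcup_i [set` `[a i, b i]]) (f x)%:E)%E).
  apply: ge0_nondecreasing_set_cvg_integral.
  - move=> n m nm; apply/subsetPset => x /=; rewrite !in_itv /= => /andP[ax xb].
    by have [am bm] := mon _ _ nm; rewrite (le_trans am)// (le_trans xb).
  - by move=> i; exact: measurable_itv.
  - move=> i; apply/measurable_EFinP.
    apply: subspace_continuous_measurable_fun; first exact: measurable_itv.
    by apply: continuous_in_subspaceT => x; rewrite inE/= in_itv/= => /inA; exact: cf.
  - by move=> i x /=; rewrite in_itv/= lee_fin => /inA; exact: f0.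
rewrite AE; apply: cvge_le lim; apply: nearW => n.
have -> := @integral_antiderivative f F _ _ (ab n) (fun x xI => cf x (inA n x xI))
  (fun x xI => dF x (inA n x xI)).
by rewrite lee_fin; apply: FM; apply: (inA n); rewrite ?lexx ltW.
Qed.

Lemma integral_oy_le f F c (M : R) :
  (forall x, c < x -> 0 <= f x) ->
  (forall x, c < x -> {for x, continuous f}) ->
  (forall x, c < x -> is_derive x 1 F (f x)) ->
  (forall x y, c < x -> c < y -> F y - F x <= M) ->
  (\int[mu]_(x in `]c, +oo[) (f x)%:E <= M%:E)%E.
Proof.
move=> f0 cf dF FM.
have E x : `]c, +oo[%classic x <-> c < x by rewrite /= in_itv/= andbT.
apply: (@integral_exhaustion_le _ _ F (fun n => c + n.+1%:R^-1) (fun n => c + n.+2%:R)).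
- move=> n; rewrite ltrD2l (le_lt_trans (_ : _ <= 1)) ?ltr1n//.
  by rewrite invf_le1// ler1n.
- move=> n m nm; split; rewrite lerD2l; last by rewrite ler_nat !ltnS.
  by rewrite lef_pV2 ?posrE// ler_nat.
- apply/seteqP; split => x; rewrite /= in_itv/= ?andbT.
    move=> cx; have [n nx] := ltr_add_invr cx.
    have := archi_boundP (ltW (ltac:(by rewrite subr_gt0) : 0 < x - c)).
    set m := Num.bound _ => mx.
    exists (maxn n m) => //=; rewrite in_itv/=; apply/andP; split.
      rewrite (le_trans _ (ltW nx))// lerD2l lef_pV2 ?posrE// ler_nat ltnS.
      exact: leq_maxl.
    rewrite -lerBlDl (le_trans (ltW mx))//= ler_nat.
    by rewrite (leq_trans (leq_maxr n m))// ltnW.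
  move=> [n _ /=]; rewrite in_itv/= => /andP[+ _]; apply: lt_le_trans.
  by rewrite ltrDl invr_gt0.
- by move=> x /E; exact: f0.
- by move=> x /E; exact: cf.
- by move=> x /E; exact: dF.
- by move=> x y /E ? /E; exact: FM.
Qed.

Lemma integral_yo_le f F c (M : R) :
  (forall x, x < c -> 0 <= f x) ->
  (forall x, x < c -> {for x, continuous f}) ->
  (forall x, x < c -> is_derive x 1 F (f x)) ->
  (forall x y, x < c -> y < c -> F y - F x <= M) ->
  (\int[mu]_(x in `]-oo, c[) (f x)%:E <= M%:E)%E.
Proof.
move=> f0 cf dF FM.
have E x : `]-oo, c[%classic x <-> x < c by rewrite /= in_itv/=.
apply: (@integral_exhaustion_le _ _ F (fun n => c - n.+2%:R) (fun n => c - n.+1%:R^-1)).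
- move=> n; rewrite ltrD2l ltrN2 (le_lt_trans (_ : _ <= 1)) ?ltr1n//.
  by rewrite invf_le1// ler1n.
- move=> n m nm; split; rewrite lerD2l lerN2; first by rewrite ler_nat !ltnS.
  by rewrite lef_pV2 ?posrE// ler_nat.
- apply/seteqP; split => x; rewrite /= in_itv/= ?andbT.
    move=> cx; have [n nx] := ltr_add_invr cx.
    have := archi_boundP (ltW (ltac:(by rewrite subr_gt0) : 0 < c - x)).
    set m := Num.bound _ => mx.
    exists (maxn n m) => //=; rewrite in_itv/=; apply/andP; split.
      rewrite lerBlDl -lerBlDr (le_trans (ltW mx))//= ler_nat.
      by rewrite (leq_trans (leq_maxr n m))// ltnW.
    rewrite lerBrDr (le_trans _ (ltW nx))// lerD2l lef_pV2 ?posrE// ler_nat ltnS.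
    exact: leq_maxl.
  move=> [n _ /=]; rewrite in_itv/= => /andP[_]; move/le_lt_trans; apply.
  by rewrite ltrBlDr ltrDl invr_gt0.
- by move=> x /E; exact: f0.
- by move=> x /E; exact: cf.
- by move=> x y /E ? /E; exact: FM.
Qed.

Lemma powRDp (x r s : R) : 0 < x -> x `^ (r + s) = x `^ r * x `^ s.
Proof. by move=> x0; rewrite powRD// (gt_eqF x0) implybT. Qed.

Lemma powRN_le (x y r : R) : 0 < x -> x <= y -> 0 <= r -> y `^ (- r) <= x `^ (- r).
Proof.
move=> x0 xy r0; have y0 := lt_le_trans x0 xy.
rewrite !powRN lef_pV2 ?posrE ?powR_gt0//.
by apply: ge0_ler_powR; rewrite ?nnegrE ?(ltW x0) ?(ltW y0).
Qed.

Lemma powR_mono (x y r : R) : 0 <= x -> x <= y -> 0 <= r -> x `^ r <= y `^ r.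
Proof.
move=> x0 xy r0; apply: ge0_ler_powR; rewrite ?nnegrE//; exact: le_trans xy.
Qed.

Lemma powR_continuous (r x : R) : 0 < x -> {for x, continuous (fun t : R => t `^ r)}.
Proof.
move=> x0; have [d _] := is_derive1_powR r x0.
exact/differentiable_continuous/derivable1_diffP.
Qed.

(** The integrand is even about x and has the primitive - t^-r / r on each side. *)
Lemma integral_translation_kernel (x y r : R) : 0 < y -> 0 < r ->
  (\int[mu]_u ((`|x - u| + y) `^ (- (1 + r)))%:E <= (2 * (y `^ (- r) / r))%:E)%E.
Proof.
move=> y0 r0; set g := fun u => (`|x - u| + y) `^ (- (1 + r)).
have p0 u : 0 < `|x - u| + y by rewrite ltr_wpDl.
have mg : measurable_fun setT g.
  have mn : measurable_fun setT (fun u : R => `|x - u| + y).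
    apply: measurable_funD => //; apply: measurableT_comp => //.
    exact: measurable_funB.
  exact: (measurableT_comp (measurable_powR _) mn).
rewrite -(@setUv R `]-oo, x]%classic) setCitvl ge0_integral_setU//=; first last.
- by rewrite disj_set2E -setCitvl setICr.
- by move=> u _; rewrite lee_fin powR_ge0.
- by apply/measurable_EFinP; exact: measurable_funTS.
have F1 (t : R) : 0 <= t -> 0 <= (t + y) `^ (- r) / r <= y `^ (- r) / r.
  move=> t0; apply/andP; split; first by rewrite divr_ge0 ?powR_ge0// ltW.
  by rewrite ler_pM2r ?invr_gt0// powRN_le ?lerDr// ltW.
have dpow (t : R) : 0 < t -> is_derive t 1 (fun t : R => t `^ (- r) / r) (- (t `^ (- (1 + r)))).
  move=> t0; have d2 := is_derive1_powR (- r) t0.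
  have d3 := @is_deriveM _ _ _ (cst r^-1) t 1 _ _ d2 (is_derive_cst _ _ _).
  apply: (is_derive_eq d3).
  rewrite /= scaler0 add0r /cst /GRing.scale/= opprD [- r - 1]addrC.
  by field; rewrite gt_eqF.
rewrite mulr_natl mulr2n EFinD; apply: leeD.
- rewrite -integral_itv_bndo_bndc; last first.
    by apply/measurable_EFinP; exact: measurable_funTS.
  under eq_integral => u.
    rewrite inE/= in_itv/= => ux.
    rewrite /g ger0_norm ?subr_ge0 ?ltW//.
    over.
  apply: (@integral_yo_le _ (fun u => (x - u + y) `^ (- r) / r)).
  + by move=> *; rewrite powR_ge0.
  + move=> u ux; apply: (@continuous_comp _ _ _ (fun u => x - u + y) (fun t => t `^ _)).
      by apply: cvgD; [apply: cvgB; [exact: cvg_cst|exact: cvg_id]|exact: cvg_cst].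
    by apply: powR_continuous; rewrite ltr_wpDl// subr_ge0 ltW.
  + move=> u ux; have q0 : 0 < x - u + y by rewrite ltr_wpDl// subr_ge0 ltW.
    have d1 : is_derive u 1 (fun u : R => x - u + y) (-1).
      have d := is_deriveD (is_deriveB (is_derive_cst x u 1) (is_derive_id u 1))
        (is_derive_cst y u 1).
      by apply: (is_derive_eq d); rewrite addr0 sub0r.
    have d2 : is_derive u 1 (fun u : R => (x - u + y) `^ (- r) / r) _ :=
      @is_derive1_comp _ (fun t : R => t `^ (- r) / r) (fun u => x - u + y) u _ _ (dpow _ q0) d1.
    by apply: (is_derive_eq d2); rewrite mulrN1 opprK.
  + move=> s t sx tx.
    have /F1/andP[_ h1] : 0 <= x - t by rewrite subr_ge0 ltW.
    have /F1/andP[h2 _] : 0 <= x - s by rewrite subr_ge0 ltW.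
    by rewrite lerBlDr (le_trans h1)// lerDl.
- under eq_integral => u.
    rewrite inE/= in_itv/= andbT => ux.
    rewrite /g ltr0_norm ?subr_lt0// opprB.
    over.
  apply: (@integral_oy_le _ (fun u => - ((u - x + y) `^ (- r) / r))).
  + by move=> *; rewrite powR_ge0.
  + move=> u ux; apply: (@continuous_comp _ _ _ (fun u => u - x + y) (fun t => t `^ _)).
      by apply: cvgD; [apply: cvgB; [exact: cvg_id|exact: cvg_cst]|exact: cvg_cst].
    by apply: powR_continuous; rewrite ltr_wpDl// subr_ge0 ltW.
  + move=> u ux; have q0 : 0 < u - x + y by rewrite ltr_wpDl// subr_ge0 ltW.
    have d1 : is_derive u 1 (fun u : R => u - x + y) 1.
      have d := is_deriveD (is_deriveB (is_derive_id u 1) (is_derive_cst x u 1))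
        (is_derive_cst y u 1).
      by apply: (is_derive_eq d); rewrite addr0 subr0.
    have d2 : is_derive u 1 (fun u : R => (u - x + y) `^ (- r) / r) _ :=
      @is_derive1_comp _ (fun t : R => t `^ (- r) / r) (fun u => u - x + y) u _ _ (dpow _ q0) d1.
    by apply: (is_derive_eq (is_deriveN d2)); rewrite mulr1 opprK.
  + move=> s t sx tx.
    have /F1/andP[h1 _] : 0 <= t - x by rewrite subr_ge0 ltW.
    have /F1/andP[_ h2] : 0 <= s - x by rewrite subr_ge0 ltW.
    by rewrite opprK addrC lerBlDr (le_trans h2)// lerDl.
Qed.

(** A weakened Beta integral. The substitution s = v^m has been built into the
    integrand, so that it has the elementary primitive - (m (y^m + v^m))^-1. *)
Lemma integral_beta_kernel (m y : R) : 0 < m -> 0 < y ->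
  (\int[mu]_(v in `](0 : R)%R, +oo[) (v `^ (m - 1) * (y `^ m + v `^ m) `^ (- 2))%:E
     <= (y `^ (- m) / m)%:E)%E.
Proof.
move=> m0 y0; have ym := powR_gt0 m y0.
have dm (v : R) : 0 < v -> is_derive v 1 (fun v : R => v `^ m) (m * v `^ (m - 1)).
  by move=> v0; exact: is_derive1_powR.
have p0 (v : R) : 0 < y `^ m + v `^ m by rewrite ltr_pwDl// powR_ge0.
have ds (v : R) : 0 < v -> is_derive v 1 (fun v : R => y `^ m + v `^ m) (m * v `^ (m - 1)).
  move=> v0; have d := is_deriveD (is_derive_cst (y `^ m) v 1) (dm v v0).
  by apply: (is_derive_eq d); rewrite add0r.
apply: (@integral_oy_le _ (fun v => - ((y `^ m + v `^ m)^-1 / m))).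
- by move=> v v0; rewrite mulr_ge0 ?powR_ge0.
- move=> v v0; apply: cvgM; first exact: powR_continuous.
  apply: (@continuous_comp _ _ _ (fun v => y `^ m + v `^ m) (fun t => t `^ _)).
    by apply: cvgD; [exact: cvg_cst|exact: powR_continuous].
  exact: powR_continuous.
- move=> v v0; have n0 : y `^ m + v `^ m != 0 by rewrite gt_eqF.
  have d1 := @is_deriveV _ (fun v : R => y `^ m + v `^ m) v _ _ n0 (ds v v0).
  have d2 := is_deriveN (is_deriveM d1 (is_derive_cst m^-1 v 1)).
  apply: (is_derive_eq d2).
  rewrite scaler0 add0r /GRing.scale/= /cst (powR_invn 2) ?ltW//.
  by field; rewrite n0 gt_eqF.
- move=> s t s0 t0; rewrite opprK addrC lerBlDr.
  apply: (@le_trans _ _ (y `^ (- m) / m)).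
    rewrite ler_pM2r ?invr_gt0// powRN lef_pV2 ?posrE// lerDl powR_ge0//.
  by rewrite lerDl divr_ge0 ?invr_ge0 ?ltW.
Qed.

End RealIntegrals.

(** * The kernel integral with a power weight *)

Section KernelIntegral.
Context {R : realType}.
Implicit Types (z w : R[i]) (F G : R[i] -> R).
Local Notation mu := (@lebesgue_measure R).
Let mH := @measurable_halfplane2 R.

Lemma aint_iterated F : hmeas F -> (forall w, halfplane w -> 0 <= F w) ->
  aint F = (\int[mu]_(v in `](0 : R)%R, +oo[) \int[mu]_u (F (u +i* v))%:E)%E.
Proof.
move=> mF F0; rewrite /aint integral_mkcond.
have mG : measurable_fun setT ((fun q => (planar F q)%:E) \_ (@halfplane2 R)).
  by apply/(measurable_restrictT _ mH); exact/measurable_EFinP.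
rewrite fubini_tonelli2//; last first.
  by apply: erestrict_ge0 => q q0; rewrite lee_fin F0.
rewrite [RHS]integral_mkcond; apply: eq_integral => v _.
rewrite /fubini_G /= /patch; case: ifPn => vI.
  apply: eq_integral => u _ /=; rewrite ifT ?inE//.
  by move: vI; rewrite inE/= in_itv/= andbT.
apply: integral0_eq => u _ /=; rewrite ifF//.
apply/negbTE; apply: contra vI; rewrite !inE /= in_itv/= andbT.
by [].
Qed.

Lemma measurable_horizontal_integral F : hmeas F -> (forall w, halfplane w -> 0 <= F w) ->
  measurable_fun `](0 : R)%R, +oo[ (fun v => \int[mu]_u (F (u +i* v))%:E)%E.
Proof.
move=> mF F0.
have E v : `](0 : R)%R, +oo[%classic v -> 0 < v by rewrite /= in_itv/= andbT.
have mG : measurable_fun setT ((fun q => (planar F q)%:E) \_ (@halfplane2 R)).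
  by apply/(measurable_restrictT _ mH); exact/measurable_EFinP.
have h := @measurable_fun_fubini_tonelli_G _ _ _ _ R mu _ mG.
have := @measurable_funTS _ _ _ _ `](0 : R)%R, +oo[%classic _ (h _).
move=> /(_ _)/eq_measurable_fun; apply.
  move=> v; rewrite inE => /E v0; apply: eq_integral => u _ /=.
  by rewrite /patch ifT// inE.
by apply: erestrict_ge0 => q q0; rewrite lee_fin F0.
Qed.

Lemma aint_iterated_le F (g : R -> R) : hmeas F ->
  (forall w, halfplane w -> 0 <= F w) ->
  measurable_fun `](0 : R)%R, +oo[ g -> (forall v, 0 < v -> 0 <= g v) ->
  (forall v, 0 < v -> (\int[mu]_u (F (u +i* v))%:E <= (g v)%:E)%E) ->
  (aint F <= \int[mu]_(v in `](0 : R)%R, +oo[) (g v)%:E)%E.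
Proof.
move=> mF F0 mg g0 Fg; rewrite aint_iterated//.
have E v : `](0 : R)%R, +oo[%classic v -> 0 < v by rewrite /= in_itv/= andbT.
apply: ge0_le_integral => //.
- move=> v /E v0; apply: integral_ge0 => u _; rewrite lee_fin; exact: F0.
- exact: measurable_horizontal_integral.
- exact/measurable_EFinP.
- by move=> v /E v0; exact: Fg.
Qed.

Lemma hmeas_section F v : hmeas F -> 0 < v -> measurable_fun setT (fun u : R => F (u +i* v)).
Proof.
move=> mF v0.
have mG : measurable_fun setT (planar F \_ (@halfplane2 R)).
  exact/(measurable_restrictT _ mH).
have := measurable_fun_pair1 v mG; apply: eq_measurable_fun => u _ /=.
by rewrite /patch ifT// inE.
Qed.

Lemma hmeas_Im : hmeas (fun w : R[i] => complex.Im w).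
Proof. by rewrite /hmeas /planar; apply: measurable_funTS; exact: measurable_snd. Qed.

Lemma hmeasM F G : hmeas F -> hmeas G -> hmeas (fun w => F w * G w).
Proof. by move=> *; exact: measurable_funM. Qed.

Lemma hmeas_cst (c : R) : hmeas (fun=> c).
Proof. exact: measurable_cst. Qed.

Lemma hmeas_powR F (r : R) : hmeas F -> hmeas (fun w => F w `^ r).
Proof. by move=> mF; exact: (measurableT_comp (measurable_powR r) mF). Qed.

Lemma hmeas_kdist z : halfplane z -> hmeas (kdist z).
Proof.
move=> z0; have := measurable_cabs (cmeas_kernel 1 z0).
rewrite -[planar _]/(planar (fun w => _)) => /(measurableT_comp (@measurable_powR R (-1))).
congr measurable_fun; apply/funext => q /=; rewrite /planar powR_inv1 ?cabs_ge0//.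
by rewrite expr1 cabsV invrK.
Qed.

Lemma kdist_half_sum z w : halfplane z -> halfplane w ->
  (`|complex.Re z - complex.Re w| + complex.Im z) / 2 <= kdist z w.
Proof.
move=> z0 w0; have := kdist_Re z w; have := kdist_Iml z0 w0; lra.
Qed.

(** The classical estimate of the integral of v^(k-1) |z - conj w|^-s. The horizontal
    integral takes a power 1 + r of the kernel, with r half of the excess s - k - 1; the
    remaining power k + r makes the vertical integral converge at 0 and at infinity.
    To stay with elementary primitives, that vertical integrand is majorized by the one
    of integral_beta_kernel with m = min k r. *)
Lemma kernel_integral (k s : R) : 0 < k -> k + 1 < s -> exists2 C : R, 0 <= C &
  forall z, halfplane z ->
    (aint (fun w => complex.Im w `^ (k - 1) * kdist z w `^ (- s))%R
      <= (C * complex.Im z `^ (k + 1 - s))%:E)%E.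
Proof.
move=> k0 ks; pose r := (s - k - 1) / 2; pose m := Num.min k r.
have r0 : 0 < r by rewrite divr_gt0//; lra.
have m0 : 0 < m by rewrite lt_min k0.
have mk : m <= k by rewrite ge_min lexx.
have mr : m <= r by rewrite ge_min lexx orbT.
pose A : R := 2 `^ (1 + r) * (2 / r) * 4.
have A0 : 0 <= A by rewrite !mulr_ge0 ?powR_ge0 ?invr_ge0 ?(ltW r0).
exists (A / m); first by rewrite divr_ge0 ?(ltW m0).
move=> z z0; set y := complex.Im z; have y0 : 0 < y by [].
pose b v := v `^ (m - 1) * (y `^ m + v `^ m) `^ (- 2).
pose g v := A * y `^ (m - r - r) * b v.
have mF : hmeas (fun w => complex.Im w `^ (k - 1) * kdist z w `^ (- s)).
  by apply: hmeasM; apply: hmeas_powR; [exact: hmeas_Im|exact: hmeas_kdist].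
have b0 v : 0 <= b v by rewrite mulr_ge0 ?powR_ge0.
have mb : measurable_fun `](0 : R)%R, +oo[ b.
  apply: measurable_funTS; apply: measurable_funM; first exact: measurable_powR.
  have ms : measurable_fun setT (fun v : R => y `^ m + v `^ m).
    by apply: measurable_funD => //; exact: measurable_powR.
  exact: (measurableT_comp (measurable_powR _) ms).
apply: (@le_trans _ _ (\int[mu]_(v in `](0 : R)%R, +oo[) (g v)%:E)%E).
  apply: aint_iterated_le => //.
  - by move=> w _; rewrite mulr_ge0 ?powR_ge0.
  - exact: measurable_funM.
  - by move=> v v0; rewrite /g mulr_ge0// mulr_ge0 ?powR_ge0.
  move=> v v0.
  pose c := 2 `^ (1 + r) * (y `^ (m - r) * 4 * b v).
  have c0 : 0 <= c by rewrite !mulr_ge0 ?powR_ge0.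
  have mN : measurable_fun setT (fun u : R => (`|complex.Re z - u| + y) `^ (- (1 + r))).
    have mN : measurable_fun setT (fun u : R => `|complex.Re z - u| + y).
      apply: measurable_funD => //; apply: measurableT_comp => //.
      exact: measurable_funB.
    exact: (measurableT_comp (measurable_powR _) mN).
  apply: (@le_trans _ _ (\int[mu]_u (c%:E *
      ((`|complex.Re z - u| + y) `^ (- (1 + r)))%:E))%E).
    apply: ge0_le_integral => //.
    + by move=> u _; rewrite lee_fin mulr_ge0 ?powR_ge0.
    + by apply/measurable_EFinP; exact: hmeas_section mF v0.
    + by apply: measurable_funeM; exact/measurable_EFinP.
    move=> u _; rewrite -EFinM lee_fin /c.
    have w0 : halfplane (u +i* v) by [].
    have D0 := kdist_gt0 z0 w0.
    have -> : kdist z (u +i* v) `^ (- s) =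
        kdist z (u +i* v) `^ (- (1 + r)) * kdist z (u +i* v) `^ (- (k + r)).
      by rewrite -powRDp//; congr (_ `^ _); rewrite /r; field.
    have h1 : kdist z (u +i* v) `^ (- (1 + r)) <=
        2 `^ (1 + r) * (`|complex.Re z - u| + y) `^ (- (1 + r)).
      have q0 : 0 < `|complex.Re z - u| + y by rewrite ltr_wpDl.
      have -> : 2 `^ (1 + r) * (`|complex.Re z - u| + y) `^ (- (1 + r)) =
          ((`|complex.Re z - u| + y) / 2) `^ (- (1 + r)).
        rewrite powRM ?ltW ?invr_ge0// mulrC -[2^-1]powR_inv1// -powRrM.
        by rewrite mulN1r opprK.
      rewrite powRN_le ?divr_gt0//; last by rewrite addr_ge0 ?ltW.
      exact: (kdist_half_sum z0 w0).
    have h2 : v `^ (k - 1) * kdist z (u +i* v) `^ (- (k + r)) <=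
        y `^ (m - r) * 4 * b v.
      have yv0 : 0 < y + v by rewrite addr_gt0.
      apply: (@le_trans _ _ (v `^ (k - 1) * (y + v) `^ (- (k + r)))).
        rewrite ler_wpM2l ?powR_ge0// powRN_le ?(kdist_Im z0 w0)//.
        by rewrite addr_ge0 ?ltW.
      have -> : v `^ (k - 1) = v `^ (m - 1) * v `^ (k - m).
        by rewrite -powRDp//; congr (_ `^ _); ring.
      have -> : (y + v) `^ (- (k + r)) = (y + v) `^ (- (k - m)) *
          ((y + v) `^ (- m) * (y + v) `^ (- m) * (y + v) `^ (- (r - m))).
        by rewrite -!powRDp//; congr (_ `^ _); ring.
      rewrite /b.
      have e1 : v `^ (k - m) * (y + v) `^ (- (k - m)) <= 1.
        rewrite [(y + v) `^ _]powRN ler_pdivrMr ?powR_gt0// mul1r powR_mono ?subr_ge0//.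
          exact: ltW.
        by rewrite lerDr ltW.
      have e2 : (y + v) `^ (- (r - m)) <= y `^ (m - r).
        by rewrite -(opprB r m) powRN_le ?subr_ge0// lerDl ltW.
      have e3 : (y + v) `^ (- m) * (y + v) `^ (- m) <= 4 * (y `^ m + v `^ m) `^ (- 2).
        have pm : 0 < y `^ m + v `^ m by rewrite addr_gt0 ?powR_gt0.
        rewrite (powR_invn 2 (ltW pm)) [(y + v) `^ _]powRN -invfM -expr2.
        rewrite -[4]invrK -invfM lef_pV2 ?posrE ?exprn_gt0 ?powR_gt0//; last first.
          by rewrite mulr_gt0 ?invr_gt0 ?exprn_gt0.
        have -> : 4^-1 * (y `^ m + v `^ m) ^+ 2 = ((y `^ m + v `^ m) / 2) ^+ 2 by field.
        apply: lerXn2r; rewrite ?nnegrE ?powR_ge0 ?divr_ge0 ?(ltW pm)//.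
        rewrite ler_pdivrMr// mulr_natr mulr2n lerD// powR_mono ?(ltW m0)// ?(ltW y0) ?(ltW v0)//.
          by rewrite lerDl ltW.
        by rewrite lerDr ltW.
      set E1 := v `^ (k - m) in e1 *; set E2 := (y + v) `^ (- (k - m)) in e1 *.
      set E3 := (y + v) `^ (- m) in e3 *; set E4 := (y + v) `^ (- (r - m)) in e2 *.
      have -> : v `^ (m - 1) * E1 * (E2 * (E3 * E3 * E4)) =
        v `^ (m - 1) * ((E1 * E2) * ((E3 * E3) * E4)) by ring.
      have -> : y `^ (m - r) * 4 * (v `^ (m - 1) * (y `^ m + v `^ m) `^ (-2)) =
        v `^ (m - 1) * (1 * ((4 * (y `^ m + v `^ m) `^ (-2)) * y `^ (m - r))) by ring.
      rewrite ler_wpM2l ?powR_ge0//; apply: ler_pM => //.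
      - by rewrite mulr_ge0 ?powR_ge0.
      - by rewrite !mulr_ge0 ?powR_ge0.
      - by apply: ler_pM; rewrite ?mulr_ge0 ?powR_ge0.
    rewrite mulrCA [leRHS]mulrAC.
    by apply: ler_pM; rewrite ?mulr_ge0 ?powR_ge0.
  rewrite ge0_integralZl//; last 2 first.
  - exact/measurable_EFinP.
  - by move=> u _; rewrite lee_fin powR_ge0.
  apply: (le_trans (lee_wpmul2l _ (integral_translation_kernel (complex.Re z) y0 r0))).
    by rewrite lee_fin.
  rewrite -EFinM lee_fin /g /c /A.
  rewrite [y `^ (m - r - r)]powRDp//.
  rewrite le_eqVlt; apply/orP; left; apply/eqP.
  set a1 := 2 `^ (1 + r); set a2 := y `^ (m - r); set a3 := y `^ (- r).
  by move: a1 a2 a3 (b v) => a1 a2 a3 a4; field; rewrite gt_eqF.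
under eq_integral do rewrite EFinM.
rewrite ge0_integralZl//; last 3 first.
- exact/measurable_EFinP.
- by move=> v _; rewrite lee_fin.
- by rewrite lee_fin mulr_ge0 ?powR_ge0.
apply: (le_trans (lee_wpmul2l _ (integral_beta_kernel m0 y0))).
  by rewrite lee_fin mulr_ge0 ?powR_ge0.
rewrite -EFinM lee_fin le_eqVlt; apply/orP; left; apply/eqP.
have -> : k + 1 - s = - r - r by rewrite /r; field.
rewrite [y `^ (m - r - r)]powRDp// [y `^ (m - r)]powRDp// [y `^ (- r - r)]powRDp// [y `^ (- m)]powRN; have ym0 := powR_gt0 m y0.
move: (y `^ m) (y `^ (- r)) ym0 => a2 a3 a20.
by field; rewrite !gt_eqF.
Qed.

End KernelIntegral.

(** * The logarithmic weight *)

Section LogWeight.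
Context {R : realType}.
Implicit Types (z w : R[i]) (s t : R).

Lemma lnp_ge0 s : 0 <= lnp s.
Proof. by rewrite le_max lexx. Qed.

Lemma le_lnp s t : 0 < s -> s <= t -> lnp s <= lnp t.
Proof.
move=> s0 st; rewrite /lnp ge_max le_max lexx /= le_max ler_ln ?posrE ?st ?orbT//.
exact: lt_le_trans st.
Qed.

Lemma lnpM s t : 0 < s -> 1 <= t -> lnp (s * t) <= lnp s + ln t.
Proof.
move=> s0 t1; have t0 : 0 < t by exact: lt_le_trans t1.
rewrite {1}/lnp ge_max addr_ge0 ?lnp_ge0 ?ln_ge0//= lnM ?posrE// lerD2r.
by rewrite le_max lexx orbT.
Qed.

Lemma omega_ge1 z : 1 <= omega z.
Proof. by rewrite /omega -addrA lerDl addr_ge0 ?lnp_ge0. Qed.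

Lemma omega_gt0 z : 0 < omega z.
Proof. exact: lt_le_trans (omega_ge1 z). Qed.

Lemma hmeas_omega : hmeas (@omega R).
Proof.
have mlnp : measurable_fun setT (@lnp R).
  by apply: measurable_maxr => //; exact: measurable_ln.
have hid : holomorphic (fun z : R[i] => z) by move=> z _; exact: cder_derivable (cder_id z).
apply: measurable_funD.
  apply: measurable_funD => //.
  exact: (measurableT_comp mlnp (measurable_cabs (cmeas_holomorphic hid))).
have := measurableT_comp mlnp (hmeas_powR (-1) (@hmeas_Im R)).
apply: eq_measurable_fun => q; rewrite inE => q0.
by rewrite /planar/= powR_inv1// ltW.
Qed.

Lemma dist_le_kdist z w : halfplane z -> halfplane w -> cabs (z - w) <= kdist z w.
Proof.
rewrite /halfplane /= => z0 w0.
rewrite -(@ler_pXn2r _ 2) ?nnegrE ?cabs_ge0// !sqr_cabs !cReD !cImD !cReN !cImN cReJ cImJ.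
rewrite opprK lerD2l !sqrrD sqrrN lerD2r lerD2l ler_wMn2r// mulrN.
have := mulr_ge0 (ltW z0) (ltW w0); lra.
Qed.

(** A conformally invariant measure of how far apart z and w are: it is at least 1, and
    its logarithm is comparable with 1 plus the hyperbolic distance. *)
Definition kratio z w : R := kdist z w ^+ 2 / (complex.Im z * complex.Im w).

Lemma kratioC z w : kratio z w = kratio w z.
Proof. by rewrite /kratio kdistC mulrC [_ * complex.Im z]mulrC mulrC. Qed.

Lemma kratio_ge1 z w : halfplane z -> halfplane w -> 1 <= kratio z w.
Proof.
move=> z0 w0; rewrite /kratio ler_pdivlMr ?mulr_gt0// mul1r expr2.
apply: ler_pM; [exact: ltW|exact: ltW|exact: kdist_Iml|].
by rewrite kdistC; exact: kdist_Iml.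
Qed.

(** The weight is logarithmic, so it changes at most by a factor that is logarithmic in
    kratio: with D = kdist z w, |w| is at most 2 |z| (D / Im z) and 1 / Im w is at most
    (1 / Im z) (D / Im w), and the product of the two ratios is kratio z w. *)
Lemma omega_le z w : halfplane z -> halfplane w ->
  omega w <= omega z * (2 + ln (kratio z w)).
Proof.
move=> z0 w0; set y := complex.Im z; set v := complex.Im w; set D := kdist z w.
have y0 : 0 < y by []; have v0 : 0 < v by [].
have D0 : 0 < D by exact: kdist_gt0.
have yD : y <= D by exact: kdist_Iml.
have vD : v <= D by rewrite /D kdistC; exact: kdist_Iml.
have yz : y <= cabs z by rewrite (le_trans _ (Im_le_cabs z))// ler_norm.
have vw : v <= cabs w by rewrite (le_trans _ (Im_le_cabs w))// ler_norm.
have cz0 : 0 < cabs z by exact: lt_le_trans yz.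
have Dy : 1 <= D / y by rewrite ler_pdivlMr ?mul1r.
have Dv : 1 <= D / v by rewrite ler_pdivlMr ?mul1r.
have h1 : lnp (cabs w) <= lnp (cabs z) + ln (2 * (D / y)).
  have w2 : cabs w <= cabs z * (2 * (D / y)).
    have := cabsD z (w - z); rewrite addrC subrK.
    have := dist_le_kdist z0 w0; rewrite cabsB -/D => d1 d2.
    apply: (le_trans d2); rewrite (le_trans (lerD (lexx _) d1))//.
    rewrite mulrCA mulr_natl mulr2n; apply: lerD; first by rewrite ler_peMr// ltW.
    by rewrite mulrA ler_pdivlMr// [leRHS]mulrC ler_wpM2l// ltW.
  apply: (le_trans (le_lnp _ w2)); first exact: lt_le_trans vw.
  by rewrite lnpM//; lra.
have h2 : lnp v^-1 <= lnp y^-1 + ln (D / v).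
  apply: (@le_trans _ _ (lnp (y^-1 * (D / v)))).
    apply: le_lnp; first by rewrite invr_gt0.
    by rewrite mulrA ler_pMl ?invr_gt0// ler_pdivlMl// mulr1.
  by rewrite lnpM ?invr_gt0.
have h3 : ln (2 * (D / y)) + ln (D / v) = ln 2 + ln (kratio z w).
  have Dy0 : 0 < D / y by rewrite divr_gt0.
  have Dv0 : 0 < D / v by rewrite divr_gt0.
  rewrite [ln (2 * _)]lnM ?posrE// -addrA; congr (_ + _).
  rewrite -lnM ?posrE//; congr ln.
  by rewrite /kratio -/D -/y -/v; field; rewrite !gt_eqF.
have h4 : ln 2 <= 1 :> R.
  rewrite -[leRHS]expRK ler_ln ?posrE ?expR_gt0//.
  by have := expR_ge1Dx (1 : R); lra.
have h5 : 0 <= ln (kratio z w) by rewrite ln_ge0// kratio_ge1.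
have h6 := omega_ge1 z.
have h7 : ln (kratio z w) <= omega z * ln (kratio z w) by rewrite ler_peMl.
have h8 : omega w <= omega z + (ln (2 * (D / y)) + ln (D / v)).
  rewrite /omega -/y -/v; lra.
rewrite (le_trans h8)// h3 mulrDr; lra.
Qed.

Lemma ln_le_powR (e t : R) : 0 < e -> 1 <= t -> 2 + ln t <= (2 + e^-1) * t `^ e.
Proof.
move=> e0 t1; have t0 : 0 < t by exact: lt_le_trans t1.
have p1 : 1 <= t `^ e.
  by have := powR_mono ler01 t1 (ltW e0); rewrite powR1.
have h : e * ln t <= t `^ e.
  rewrite -ln_powR; have p0 := powR_gt0 e t0.
  by have := le_ln1Dx (ltac:(by rewrite ltrBrDl addrN) : -1 < t `^ e - 1);
    rewrite addrC subrK; lra.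
rewrite mulrDl; apply: lerD; first by rewrite ler_peMr.
by rewrite mulrC ler_pdivlMr// mulrC.
Qed.

Lemma powRM3 (a b c r : R) : 0 <= a -> 0 <= b -> 0 <= c ->
  (a * b * c) `^ r = a `^ r * b `^ r * c `^ r.
Proof. by move=> a0 b0 c0; rewrite powRM ?mulr_ge0// powRM. Qed.

(** A logarithm is dominated by any positive power, so moving omega from w to z costs
    an arbitrarily small power of kratio. For m < 0 the roles of z and w are exchanged,
    which is harmless because kratio is symmetric. Every estimate with the weight omega
    is reduced by this lemma to one without it. *)
Lemma omega_powR_le (m d : R) : 0 < d -> exists2 C : R, 0 < C &
  forall z w, halfplane z -> halfplane w ->
    omega w `^ m <= C * omega z `^ m * kratio z w `^ d.
Proof.
move=> d0; pose e := d / (`|m| + 1).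
have m1 : 0 < `|m| + 1 by rewrite ltr_pwDr.
have e0 : 0 < e by rewrite divr_gt0.
pose K : R := 2 + e^-1; have K0 : 0 < K by rewrite addr_gt0 ?invr_gt0.
have H z w : halfplane z -> halfplane w -> omega w <= K * omega z * kratio z w `^ e.
  move=> z0 w0; apply: (le_trans (omega_le z0 w0)).
  rewrite [K * _]mulrC -mulrA ler_wpM2l ?(ltW (omega_gt0 z))//.
  exact: ln_le_powR e0 (kratio_ge1 z0 w0).
exists (K `^ `|m|); first exact: powR_gt0.
move=> z w z0 w0.
have t1 := kratio_ge1 z0 w0; have t0 : 0 < kratio z w by exact: lt_le_trans t1.
have te : (kratio z w `^ e) `^ `|m| <= kratio z w `^ d.
  rewrite -powRrM; apply: ler_powR => //.
  rewrite /e mulrAC ler_pdivrMr// ler_wpM2l ?ltW//; lra.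
have oz := omega_gt0 z; have ow := omega_gt0 w; have p0 := powR_gt0 e t0.
have [mp|mn] := leP 0 m.
  rewrite ger0_norm// in te *.
  have := powR_mono (ltW ow) (H _ _ z0 w0) mp.
  rewrite (powRM3 _ (ltW K0) (ltW oz) (ltW p0)) => h.
  apply: (le_trans h); rewrite ler_wpM2l//.
  by rewrite mulr_ge0 ?powR_ge0.
rewrite ltr0_norm// in te *.
have nm : 0 <= - m by rewrite oppr_ge0 ltW.
have := powR_mono (ltW oz) (H _ _ w0 z0) nm.
rewrite (powRM3 _ (ltW K0) (ltW ow) (powR_ge0 _ _)) kratioC => h.
have {}h : omega z `^ (- m) <= K `^ (- m) * omega w `^ (- m) * kratio z w `^ d.
  apply: (le_trans h); rewrite ler_wpM2l//.
  by rewrite mulr_ge0 ?powR_ge0.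
have oz1 : omega z `^ (- m) * omega z `^ m = 1.
  by rewrite -powRDp// addNr powRr0.
have ow1 : omega w `^ (- m) * omega w `^ m = 1.
  by rewrite -powRDp// addNr powRr0.
rewrite -[leLHS]mulr1 -oz1 mulrA.
apply: (@le_trans _ _ (omega w `^ m * (K `^ (- m) * omega w `^ (- m) * kratio z w `^ d)
   * omega z `^ m)).
  by rewrite ler_wpM2r ?powR_ge0// ler_wpM2l ?powR_ge0.
rewrite (_ : _ * omega z `^ m = (omega w `^ (- m) * omega w `^ m) *
  (K `^ (- m) * omega z `^ m * kratio z w `^ d)); last by ring.
by rewrite ow1 mul1r.
Qed.

(** omega_powR_le moves the weight out of the integral, at the price of kratio^d; for d
    small the exponents still satisfy the strict inequalities of kernel_integral. *)
Lemma kernel_integral_omega (m k s : R) : 0 < k -> k + 1 < s ->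
  exists2 C : R, 0 <= C & forall z, halfplane z ->
    (aint (fun w => omega w `^ m * (complex.Im w `^ (k - 1) * kdist z w `^ (- s)))%R
      <= (C * (omega z `^ m * complex.Im z `^ (k + 1 - s)))%:E)%E.
Proof.
move=> k0 ks; pose d := Num.min k (s - k - 1) / 2.
have d0 : 0 < d by rewrite divr_gt0// lt_min k0; lra.
have dk : 0 < k - d.
  have : d <= k / 2 by rewrite ler_pM2r ?invr_gt0// ge_min lexx.
  lra.
have ds : (k - d) + 1 < s - (d + d).
  have : d <= (s - k - 1) / 2 by rewrite ler_pM2r ?invr_gt0// ge_min lexx orbT.
  lra.
have [C1 C10 H1] := omega_powR_le m d0.
have [C2 C20 H2] := kernel_integral dk ds.
exists (C1 * C2); first by rewrite mulr_ge0// ltW.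
move=> z z0; set y := complex.Im z; have y0 : 0 < y by [].
have mw := hmeas_powR (k - d - 1) (@hmeas_Im R).
have mD r := hmeas_powR r (hmeas_kdist z0).
pose c := C1 * omega z `^ m * y `^ (- d).
have c0 : 0 <= c by rewrite /c mulr_ge0 ?powR_ge0// mulr_ge0 ?powR_ge0// ltW.
apply: (@le_trans _ _ (aint (fun w => c *
    (complex.Im w `^ (k - d - 1) * kdist z w `^ (- (s - (d + d)))))%R)).
  apply: aint_le.
  - apply: hmeasM; first exact: hmeas_powR hmeas_omega.
    by apply: hmeasM => //; exact: hmeas_powR (@hmeas_Im R).
  - by apply: hmeasM; [exact: hmeas_cst|exact: hmeasM].
  move=> w w0; set v := complex.Im w; have v0 : 0 < v by [].
  have D0 := kdist_gt0 z0 w0; set D := kdist z w in D0 *.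
  apply/andP; split; first by rewrite !mulr_ge0 ?powR_ge0.
  have Hw := H1 z w z0 w0.
  have kr : kratio z w `^ d = D `^ (d + d) * (y `^ (- d) * v `^ (- d)).
    have yv : 0 <= y * v by rewrite mulr_ge0 ?(ltW y0) ?(ltW v0).
    rewrite /kratio -/D -/y -/v powRM ?invr_ge0 ?exprn_ge0 ?(ltW D0)//.
    rewrite -powR_mulrn ?(ltW D0)// -powRrM (_ : 2 * d = d + d); last by ring.
    rewrite -(powR_inv1 yv) -powRrM mulN1r.
    by rewrite powRM ?(ltW y0) ?(ltW v0).
  apply: (le_trans (ler_wpM2r _ Hw)); first by rewrite mulr_ge0 ?powR_ge0.
  have -> : v `^ (k - d - 1) = v `^ (k - 1) * v `^ (- d).
    by rewrite -powRDp//; congr (_ `^ _); ring.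
  have -> : D `^ (- (s - (d + d))) = D `^ (- s) * D `^ (d + d).
    by rewrite -powRDp//; congr (_ `^ _); ring.
  rewrite kr /c le_eqVlt; apply/orP; left; apply/eqP.
  set E1 := omega z `^ m; set E2 := D `^ (d + d); set E3 := y `^ (- d).
  set E4 := v `^ (- d); set E5 := v `^ (k - 1); set E6 := D `^ (- s).
  by move: E1 E2 E3 E4 E5 E6 => *; ring.
rewrite aintZ//; last by move=> w _; rewrite mulr_ge0 ?powR_ge0.
  apply: (le_trans (lee_wpmul2l _ (H2 z z0))); first by rewrite lee_fin.
  rewrite -EFinM lee_fin /c -/y.
  have -> : y `^ (k - d + 1 - (s - (d + d))) = y `^ (k + 1 - s) * y `^ d.
    by rewrite -powRDp//; congr (_ `^ _); ring.
  rewrite [y `^ (- d)]powRN; have := powR_gt0 d y0.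
  set E1 := omega z `^ m; set E2 := y `^ (k + 1 - s).
  move: E1 E2 (y `^ d) => E1 E2 E3 E30.
  by rewrite le_eqVlt; apply/orP; left; apply/eqP; field; rewrite gt_eqF.
exact: hmeasM.
Qed.

End LogWeight.

(** * The reproducing formula *)

Section Reproducing.
Context {R : realType}.
Implicit Types (z w c : R[i]) (f g : R[i] -> R[i]).
Let mH := @measurable_halfplane2 R.

Lemma holomorphic_cder f z : holomorphic f -> halfplane z -> cder f z (cderiv f z).
Proof. by move=> hf z0; exact: derivable_cder (hf z z0). Qed.

Lemma holomorphicB f g : holomorphic f -> holomorphic g ->
  holomorphic (fun w => f w - g w).
Proof.
move=> hf hg z z0.
exact: cder_derivable (cderB (holomorphic_cder hf z0) (holomorphic_cder hg z0)).
Qed.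

Lemma holomorphicM f g : holomorphic f -> holomorphic g ->
  holomorphic (fun w => f w * g w).
Proof.
move=> hf hg z z0.
exact: cder_derivable (cderM (holomorphic_cder hf z0) (holomorphic_cder hg z0)).
Qed.

Lemma square_integrableP f : square_integrable f <->
  cmeas f /\ (aint (fun w => cabs (f w) ^+ 2)%R < +oo)%E.
Proof. by split=> [[? ? ?]|[[? ?] ?]]; split. Qed.

Lemma hmeasZ k (F : R[i] -> R) : hmeas F -> hmeas (fun w => k * F w).
Proof. by move=> mF; apply: (hmeasM (hmeas_cst k) mF). Qed.

Lemma hmeasD (F G : R[i] -> R) : hmeas F -> hmeas G -> hmeas (fun w => F w + G w).
Proof. by move=> mF mG; exact: measurable_funD. Qed.

Lemma hmeasX (F : R[i] -> R) n : hmeas F -> hmeas (fun w => F w ^+ n).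
Proof. by move=> mF; exact: measurable_funX. Qed.

Lemma aint_box_gt0 (F : R[i] -> R) z r e : hmeas F ->
  (forall w, halfplane w -> 0 <= F w) -> halfplane z -> 0 < r -> 0 < e ->
  (forall h, cabs h < r -> e <= F (z + h)) -> (0 < aint F)%E.
Proof.
move=> mF F0; case: z => x y z0 r0 e0 H; have y0 : 0 < y by [].
pose d := Num.min y (r / 2).
have d0 : 0 < d by rewrite lt_min y0 divr_gt0.
pose B : set (measurableTypeR R * measurableTypeR R) :=
  [set` `]x - d, x + d[] `*` [set` `]y - d, y + d[].
have mB : measurable B by apply: measurableX; exact: measurable_itv.
have BH q : B q -> halfplane2 q /\ e <= planar F q.
  case: q => u v [/=]; rewrite !in_itv/= => /andP[u1 u2] /andP[v1 v2].
  have dy : d <= y by rewrite ge_min lexx.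
  have dr : d <= r / 2 by rewrite ge_min lexx orbT.
  split; first by rewrite /halfplane2 /=; lra.
  have /H : cabs ((u - x) +i* (v - y)) < r.
    rewrite (le_lt_trans (cabs_le _))//=.
    have : `|u - x| < d by rewrite ltr_norml; apply/andP; split; lra.
    have : `|v - y| < d by rewrite ltr_norml; apply/andP; split; lra.
    lra.
  rewrite (_ : x +i* y + ((u - x) +i* (v - y)) = u +i* v)//.
  by simpc; rewrite ![_ + (_ - _)]addrC !subrK.
apply: (@lt_le_trans _ _ (\int[dV]_(q in B) e%:E)%E).
  rewrite integral_cst// mule_gt0 ?lte_fin//.
  have BE : dV B = _ := @product_measure1E _ _ _ _ R lebesgue_measure lebesgue_measure _ _
    (measurable_itv `]x - d, x + d[) (measurable_itv `]y - d, y + d[).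
  suff : (0 < dV B)%E by apply.
  rewrite BE.
  have L (a : R) : (0 < @lebesgue_measure R [set` `](a - d)%R, (a + d)%R[])%E.
    by rewrite lebesgue_measure_itv/= ifT lte_fin; lra.
  exact: mule_gt0 (L x) (L y).
apply: (@le_trans _ _ (\int[dV]_(q in B) (planar F q)%:E)%E).
  apply: ge0_le_integral => //.
  - by move=> q _; rewrite lee_fin ltW.
  - apply/measurable_EFinP; apply: measurable_funS mF => //.
    by move=> q /BH[].
  - by move=> q /BH[_]; rewrite lee_fin.
apply: ge0_subset_integral => //.
- exact/measurable_EFinP.
- by move=> q q0; rewrite lee_fin F0.
- by move=> q /BH[].
Qed.

(** If g z were nonzero, |g|^2 would be bounded below on a small disc by continuity. *)
Lemma holomorphic_l2_eq0 g : holomorphic g ->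
  aint (fun w => cabs (g w) ^+ 2) = 0%E -> forall z, halfplane z -> g z = 0.
Proof.
move=> hg g0 z z0; apply/eqP; rewrite -cabs_eq0; apply/negPn/negP => gz.
have gz0 : 0 < cabs (g z) by rewrite lt_neqAle eq_sym gz cabs_ge0.
have [r r0 H] := cder_continuous (holomorphic_cder hg z0) (divr_gt0 gz0 (ltr0Sn R 1)).
have e0 : 0 < (cabs (g z) / 2) ^+ 2 by rewrite exprn_gt0// divr_gt0.
have mg : hmeas (fun w => cabs (g w) ^+ 2).
  by apply: hmeasX; exact: measurable_cabs (cmeas_holomorphic hg).
have := aint_box_gt0 mg (fun w _ => exprn_ge0 2 (cabs_ge0 (g w))) z0 r0 e0.
rewrite g0 ltxx => hF; suff : false by [].
apply: hF => h /H hh; apply: lerXn2r; rewrite ?nnegrE ?cabs_ge0 ?divr_ge0 ?cabs_ge0//.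
have := cabs_sub (g z) (- (g (z + h) - g z)).
rewrite opprK cabsN (_ : g z + (g (z + h) - g z) = g (z + h)); last by ring.
lra.
Qed.

Lemma square_integrableB f g : square_integrable f -> square_integrable g ->
  square_integrable (fun w => f w - g w).
Proof.
move=> /square_integrableP[mf fy] /square_integrableP[mg gy].
apply/square_integrableP; split; first exact: cmeasB.
have nf := hmeasX 2 (measurable_cabs mf); have ng := hmeasX 2 (measurable_cabs mg).
apply: (@le_lt_trans _ _ (aint (fun w => 2 * cabs (f w) ^+ 2 + 2 * cabs (g w) ^+ 2)%R)).
  apply: aint_le.
  - by apply: hmeasX; apply: measurable_cabs; exact: cmeasB.
  - exact: hmeasD (hmeasZ 2 nf) (hmeasZ 2 ng).
  - move=> w _; rewrite exprn_ge0 ?cabs_ge0//=.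
    have h : cabs (f w - g w) <= cabs (f w) + cabs (g w).
      by have := cabsD (f w) (- g w); rewrite cabsN.
    have := cabs_ge0 (f w - g w); have := cabs_ge0 (f w); have := cabs_ge0 (g w).
    move: h; move: (cabs _) (cabs _) (cabs _) => a b d h d0 b0 a0.
    have : d ^+ 2 <= (b + a) ^+ 2 by apply: lerXn2r; rewrite ?nnegrE ?addr_ge0.
    have := sqr_ge0 (b - a); nra.
rewrite (aintD (hmeasZ 2 nf) (hmeasZ 2 ng));
  do ?[by move=> w _; rewrite mulr_ge0 ?exprn_ge0 ?cabs_ge0].
rewrite !aintZ//; do ?[by move=> w _; rewrite exprn_ge0 ?cabs_ge0].
by apply: lte_add_pinfty; rewrite lte_mul_pinfty ?lee_fin.
Qed.

(** f - P f is holomorphic and orthogonal to all holomorphic functions, hence to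
    itself. This is the only access to c: its value is never computed. *)
Lemma bergman_reproducing c f : bergman_constant c -> holomorphic f ->
  square_integrable f ->
  forall z, halfplane z -> projection_defined c f z /\ f z = projection c f z.
Proof.
move=> hc hf sf z z0; have [dP hP sP ortho] := hc f sf; split; first exact: dP.
set g := fun w => f w - projection c f w.
have hg : holomorphic g by exact: holomorphicB.
have sg : square_integrable g by exact: square_integrableB.
have /eqP := ortho g hg sg; rewrite /l2_inner eq_complex => /andP[/eqP + _].
have /square_integrableP[mg gy] := sg.
have -> : complex.Re (cintegral (fun w => (f w - projection c f w) * (g w)^*%C)) =
    fine (aint (fun w => cabs (g w) ^+ 2)).
  rewrite /cintegral /= /Rintegral /aint; congr fine; apply: eq_integral => q _.
  rewrite /planar -/(g _); case: (g _) => a b; congr EFin.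
  by rewrite sqr_cabs cReM /= mulrN opprK !expr2.
move=> /= int0; apply/eqP; rewrite -subr_eq0; apply/eqP.
apply: (holomorphic_l2_eq0 hg) => //.
rewrite -[LHS]fineK ?int0// ge0_fin_numE//.
by apply: aint_ge0 => w _; rewrite exprn_ge0 ?cabs_ge0.
Qed.

Lemma projectionE c f z : cintegrable (fun w => (z - w^*%C) ^- 2 * f w) ->
  projection c f z = c * kint 2 f z.
Proof.
move=> i; rewrite /kint -cintegralZ//; apply: eq_cintegral => w _.
by rewrite /projection_integrand mulrA.
Qed.

Lemma projection_defined_kintegrable c f z : c != 0 -> projection_defined c f z ->
  cintegrable (fun w => (z - w^*%C) ^- 2 * f w).
Proof.
move=> c0 /(cintegrableZ c^-1); congr cintegrable; apply/funext => w.
by rewrite /projection_integrand !mulrA mulVf// mul1r.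
Qed.

Lemma kintegrable_projection_defined c f z :
  cintegrable (fun w => (z - w^*%C) ^- 2 * f w) -> projection_defined c f z.
Proof.
move=> /(cintegrableZ c); congr cintegrable; apply/funext => w.
by rewrite /projection_integrand !mulrA.
Qed.

(** As a function of w this is a holomorphic function on the half-plane; its
    conjugate is the n-th power of 1 / (z - conj w), n = 2 being the Bergman kernel. *)
Definition test_fun n z w : R[i] := (w - z^*%C) ^- n.

Lemma cabs_test_fun n z w : cabs (test_fun n z w) = kdist z w ^- n.
Proof. by rewrite /test_fun cabsV cabsX kdistC. Qed.

Lemma holomorphic_test_fun n z : halfplane z -> holomorphic (test_fun n z).
Proof.
move=> z0 w w0; have wz := kernel_neq0 w0 z0.
rewrite /test_fun; elim: n => [|n IH].
  by under eq_fun do rewrite expr0 invr1; exact: cder_derivable (cder_cst _ _).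
under eq_fun do rewrite exprS invfM.
have d1 : cder (fun w => (w - z^*%C)^-1) w (- (w - z^*%C) ^- 2 * (1 - 0)).
  apply: (cder_comp (f := fun z => z^-1)); first exact: cder_inv.
  by apply: cderB; [exact: cder_id|exact: cder_cst].
exact: cder_derivable (cderM d1 (derivable_cder IH)).
Qed.

Lemma square_integrable_test_fun z : halfplane z -> square_integrable (test_fun 2 z).
Proof.
move=> z0; apply/square_integrableP; split.
  exact: cmeas_holomorphic (holomorphic_test_fun z0).
have [C C0 H] := @kernel_integral R 1 4 ltr01 (ltac:(lra)).
apply: (le_lt_trans _ (ltry (C * complex.Im z `^ (1 + 1 - 4)))).
rewrite (le_trans _ (H z z0))// le_eqVlt; apply/orP; left; apply/eqP.
apply: eq_aint => w w0.
rewrite cabs_test_fun subrr powRr0 mul1r (powR_invn 4) ?cabs_ge0//.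
by rewrite exprVn -exprM.
Qed.

(** With c = 0 the projection would be 0, but it reproduces the test function, which
    does not vanish. *)
Lemma bergman_constant_neq0 c : bergman_constant c -> c != 0.
Proof.
move=> hc; have i0 : halfplane ('i%C : R[i]) by rewrite /halfplane /=.
have [_] := bergman_reproducing hc (@holomorphic_test_fun 2 _ i0)
  (square_integrable_test_fun i0) i0.
move=> e; apply/eqP => c0; move: e.
have -> : projection c (test_fun 2 'i%C) 'i%C = 0.
  rewrite /projection (eq_cintegral (g := fun=> 0)).
    by rewrite /cintegral /Rintegral /planar/= !integral0.
  by move=> w _; rewrite /projection_integrand c0 !mul0r.
by apply/eqP; rewrite invr_eq0 expf_eq0/= (negbTE (kernel_neq0 i0 i0)).
Qed.

End Reproducing.

(** * Derivatives of holomorphic functions are holomorphic *)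

Section Regularity.
Context {R : realType}.
Implicit Types (z w a c : R[i]) (f g b : R[i] -> R[i]).

Lemma halfplane_shift z h : halfplane z -> cabs h < complex.Im z -> halfplane (z + h).
Proof.
rewrite /halfplane /= => z0 hz; rewrite cImD.
by have := Im_le_cabs h; rewrite ler_norml => /andP[+ _]; lra.
Qed.

Lemma cder_eq f z d d' : cder f z d -> d = d' -> cder f z d'.
Proof. by move=> fd <-. Qed.

Lemma holomorphic_compose f g : holomorphic f ->
  (forall z, halfplane z -> halfplane (g z)) -> holomorphic g ->
  holomorphic (fun z => f (g z)).
Proof.
move=> hf gH hg z z0.
exact: cder_derivable (cder_comp (holomorphic_cder hf (gH z z0)) (holomorphic_cder hg z0)).
Qed.

Lemma halfplane_i : halfplane ('i%C : R[i]).
Proof. by rewrite /halfplane /=. Qed.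

Section FixedByProjection.
Variables (c : R[i]) (b : R[i] -> R[i]).
Hypotheses (c0 : c != 0) (bP : projection_fixed c b).

Lemma projection_fixed_kintegrable : kintegrable 2 b.
Proof. by move=> z z0; apply: projection_defined_kintegrable c0 (bP z0).1. Qed.

Lemma projection_fixed_kint z : halfplane z -> b z = c * kint 2 b z.
Proof.
by move=> z0; rewrite (bP z0).2 projectionE//; exact: projection_fixed_kintegrable.
Qed.

Lemma cder_projection_fixed z : halfplane z -> cder b z (c * (- 2%:R * kint 3 b z)).
Proof.
move=> z0; have h := cder_scale c (cder_kint projection_fixed_kintegrable z0).
apply: (cder_ext z0 _ h) => k kz.
by rewrite [RHS]projection_fixed_kint//; exact: halfplane_shift.
Qed.

Lemma cderiv_projection_fixed z : halfplane z -> cderiv b z = c * (- 2%:R * kint 3 b z).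
Proof. by move=> z0; exact: cderivE (cder_projection_fixed z0). Qed.

(** Two differentiations under the integral sign; no Cauchy theory is involved. *)
Lemma cder_cderiv_projection_fixed z : halfplane z ->
  cder (cderiv b) z (6%:R * c * kint 4 b z).
Proof.
move=> z0.
have h := cder_scale (c * - 2%:R)
  (cder_kint (kintegrableS projection_fixed_kintegrable) z0).
apply: (cder_ext z0 _ (cder_eq h _)) => [k kz|]; last by rewrite mulNr; ring.
by rewrite cderiv_projection_fixed ?mulrA//; exact: halfplane_shift.
Qed.

End FixedByProjection.

Lemma holomorphic_box_bounded f x y r : holomorphic f -> 0 < r -> r < y ->
  exists M : R, forall u v, `|u - x| <= r -> `|v - y| <= r -> cabs (f (u +i* v)) <= M.
Proof.
move=> hf r0 ry.
pose A : set (R * R) := [set` `[x - r, x + r]] `*` [set` `[y - r, y + r]].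
have A0 : A !=set0.
  by exists (x, y); split; rewrite /= in_itv/=; apply/andP; split; lra.
have cA : compact A by apply: compact_setX; exact: segment_compact.
have cf : {within A, continuous (fun q : R * R => cabs (f (q.1 +i* q.2)))}.
  apply: continuous_in_subspaceT => -[u v]; rewrite inE => -[_ /=].
  rewrite in_itv/= => /andP[v1 _].
  have w0 : halfplane (u +i* v) by rewrite /halfplane/=; lra.
  apply/cvgrPdist_lt => e e0.
  have [d d0 H] := cder_continuous (holomorphic_cder hf w0) e0.
  have d2 : 0 < d / 2 by rewrite divr_gt0.
  near=> q.
  have [q1 q2] : `|u - q.1| < d / 2 /\ `|v - q.2| < d / 2.
    near: q; exists (ball u (d / 2), ball v (d / 2)); last by move=> [? ?] [].
    by split; exact: nbhsx_ballx.
  have := H ((q.1 - u) +i* (q.2 - v)).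
  have -> : u +i* v + ((q.1 - u) +i* (q.2 - v)) = q.1 +i* q.2.
    by simpc; rewrite ![_ + (_ - _)]addrC !subrK.
  have -> : cabs (((q.1 - u) +i* (q.2 - v)) : R[i]) < d.
    rewrite (le_lt_trans (cabs_le _))//= distrC [`|q.2 - _|]distrC; lra.
  move=> /(_ isT) h.
  have h1 := cabs_sub (f (q.1 +i* q.2)) (f (u +i* v)).
  have h2 := cabs_sub (f (u +i* v)) (f (q.1 +i* q.2)).
  rewrite cabsB in h2.
  by rewrite ltr_norml; apply/andP; split => /=; lra.
have [q _ qmax] := compact_EVT_max A0 cA cf.
exists (cabs (f (q.1 +i* q.2))) => u v ux vy.
apply: (qmax (u, v)); rewrite inE; split; rewrite /= in_itv/=.
- by move: ux; rewrite ler_norml => /andP[? ?]; apply/andP; split; lra.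
- by move: vy; rewrite ler_norml => /andP[? ?]; apply/andP; split; lra.
Unshelve. all: by end_near. Qed.

Lemma square_integrable_bounded_test f M : holomorphic f ->
  (forall z, halfplane z -> cabs (f z) <= M) -> forall a, halfplane a ->
  square_integrable (fun z => f z * test_fun 2 a z).
Proof.
move=> hf fM a a0.
have ht := @holomorphic_test_fun R 2 a a0.
have /square_integrableP[mt ty] := square_integrable_test_fun a0.
apply/square_integrableP; split; first exact: cmeasM (cmeas_holomorphic hf) mt.
have m2 := hmeasX 2 (measurable_cabs mt).
apply: (@le_lt_trans _ _ (aint (fun z => M ^+ 2 * cabs (test_fun 2 a z) ^+ 2)%R)).
  apply: aint_le.
  - apply: hmeasX; apply: measurable_cabs; exact: cmeasM (cmeas_holomorphic hf) mt.
  - exact: hmeasZ m2.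
  - move=> z z0; rewrite exprn_ge0 ?cabs_ge0//= cabsM exprMn ler_wpM2r ?exprn_ge0 ?cabs_ge0//.
    have M0 : 0 <= M by rewrite (le_trans _ (fM z z0))// cabs_ge0.
    by apply: lerXn2r; rewrite ?nnegrE ?cabs_ge0// fM.
rewrite aintZ ?sqr_ge0//; last by move=> w _; rewrite exprn_ge0 ?cabs_ge0.
by rewrite lte_mul_pinfty ?lee_fin ?sqr_ge0.
Qed.

(** A Moebius transformation of the half-plane onto the disc of centre a and radius r,
    taking i to a. *)
Definition disc_map a (r : R) z : R[i] :=
  a + r%:C * ((z - 'i%C) / (z - 'i%C^*%C)).

Lemma disc_map_close a r z : 0 < r -> halfplane z -> cabs (disc_map a r z - a) <= r.
Proof.
move=> r0 z0; rewrite /disc_map addrAC subrr add0r cabsM cabsR gtr0_norm//.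
rewrite ger_pMr// cabsM cabsV ler_pdivrMr; last exact: kdist_gt0 z0 halfplane_i.
by rewrite mul1r; exact: dist_le_kdist z0 halfplane_i.
Qed.

Lemma holomorphic_disc_map a r : holomorphic (disc_map a r).
Proof.
move=> z z0.
have d1 : cder (fun z => z - 'i%C) z (1 - 0).
  by apply: cderB; [exact: cder_id|exact: cder_cst].
have d2 : cder (fun z => (z - 'i%C^*%C)^-1) z (cderiv (test_fun 1 'i%C) z).
  have := holomorphic_cder (@holomorphic_test_fun R 1 _ halfplane_i) z0.
  by rewrite /test_fun; under eq_fun do rewrite expr1.
exact: cder_derivable (cderD (cder_cst a z) (cder_scale r%:C (cderM d1 d2))).
Qed.

(** Derivatives of holomorphic functions are holomorphic, without Cauchy's formula.
    Composition with disc_map makes f a bounded function on the half-plane; multiplied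
    by the square integrable test function at i it becomes a square integrable
    holomorphic G, which the Bergman projection reproduces. By differentiation under the
    integral sign G is twice differentiable, and near a the function f is recovered from G
    by algebraic operations and the inverse Moebius map phi. *)
Lemma holomorphic_cderiv c f : bergman_constant c -> holomorphic f ->
  holomorphic (cderiv f).
Proof.
move=> hc hf [x y] a0; set a := x +i* y; have y0 : 0 < y by [].
have c0 := bergman_constant_neq0 hc.
pose r := y / 2; have r0 : 0 < r by rewrite divr_gt0.
have ry : r < y by rewrite /r; lra.
have [M fM] := holomorphic_box_bounded x hf r0 ry.
have discH z : halfplane z -> halfplane (disc_map a r z).
  move=> z0; have := disc_map_close a r0 z0.
  rewrite -{2}(subrK a (disc_map a r z)) [_ + a]addrC => h.
  by apply: halfplane_shift => //; exact: le_lt_trans h ry.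
pose G z := f (disc_map a r z) * test_fun 2 'i%C z.
have hfd : holomorphic (fun z => f (disc_map a r z)).
  exact: holomorphic_compose hf discH (@holomorphic_disc_map a r).
have hG : holomorphic G.
  exact: (holomorphicM hfd (@holomorphic_test_fun R 2 _ halfplane_i)).
have sG : square_integrable G.
  apply: (@square_integrable_bounded_test _ M hfd _ _ halfplane_i) => z z0.
   have := disc_map_close a r0 z0.
  case: (disc_map a r z) => u v uv; apply: fM.
    by apply: le_trans uv; apply: le_trans (Re_le_cabs _); rewrite /a.
  by apply: le_trans uv; apply: le_trans (Im_le_cabs _); rewrite /a.
have GP : projection_fixed c G by exact: bergman_reproducing.
have dG z : halfplane z -> cder G z (cderiv G z) by exact: holomorphic_cder.
have ddG z : halfplane z -> cder (cderiv G) z (6%:R * c * kint 4 G z).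
  exact: cder_cderiv_projection_fixed.
pose rC := r%:C : R[i].
have rC0 : rC != 0 by rewrite -cabs_gt0 cabsR gtr0_norm.
(* phi = i (2 s - 1) is the inverse of disc_map a r, and phi + i = 2 i s. *)
pose s z := rC / (rC - (z - a)).
have near_neq h : cabs h < r -> rC - (a + h - a) != 0.
  move=> hr; rewrite addrAC subrr add0r subr_eq0; apply: contraTneq hr => <-.
  by rewrite cabsR gtr0_norm// ltxx.
have ds h : cabs h < r -> cder s (a + h) (s (a + h) * s (a + h) / rC).
  move=> hr; have n0 := near_neq h hr.
  have d1 : cder (fun z => rC - (z - a)) (a + h) (0 - (1 - 0)).
    apply: cderB; first exact: cder_cst.
    by apply: cderB; [exact: cder_id|exact: cder_cst].
  have d2 := cder_scale rC (cder_comp (f := fun z => z^-1) (g := fun z => rC - (z - a))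
    (cder_inv n0) d1).
  by apply: (cder_eq d2); rewrite /s; field; rewrite rC0 n0.
have sH h : cabs h < r -> halfplane ('i%C * (2%:R * s (a + h) - 1)).
  move=> hr; have n0 := near_neq h hr.
  have s0 : s (a + h) != 0 by rewrite mulf_neq0// invr_neq0.
  have s1 : s (a + h) - 1 = (h / rC) * s (a + h).
    by rewrite /s; field; rewrite rC0 n0.
  have : cabs (s (a + h) - 1) < cabs (s (a + h)).
    rewrite s1 cabsM gtr_pMl ?cabs_gt0// cabsM cabsV cabsR gtr0_norm//.
    by rewrite ltr_pdivrMr ?mul1r.
  rewrite -(@ltr_pXn2r _ 2) ?nnegrE ?cabs_ge0// !sqr_cabs.
  case: (s (a + h)) => p q /=; rewrite oppr0 addr0 /halfplane.
  by rewrite mulr_natl mulr2n/= => h1; nra.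
pose phi z := 'i%C * (2%:R * s z - 1).
have dphi h : cabs h < r -> cder phi (a + h) ('i%C * (2%:R * (s (a + h) * s (a + h) / rC) - 0)).
  move=> hr; apply: cder_scale; apply: cderB; last exact: cder_cst.
  by apply: cder_scale; exact: ds.
have fE h : cabs h < r -> f (a + h) = - 4%:R * (G (phi (a + h)) * (s (a + h) * s (a + h))).
  move=> hr; have n0 := near_neq h hr.
  have s0 : s (a + h) != 0 by rewrite mulf_neq0// invr_neq0.
  have i0 : ('i%C : R[i]) != 0 by rewrite eq_complex /= oner_eq0 andbF.
  have ii : ('i%C : R[i])^*%C = - 'i%C by rewrite /=; simpc.
  have i2 : ('i%C : R[i]) ^+ 2 = - 1 by rewrite expr2; simpc.
  have s1 : s (a + h) - 1 = (h / rC) * s (a + h).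
    by rewrite /s; field; rewrite rC0 n0.
  have e1 : phi (a + h) - 'i%C^*%C = 2%:R * ('i%C * s (a + h)).
    by rewrite /phi ii; move: (s (a + h)) => t; ring.
  have e2 : phi (a + h) - 'i%C = 2%:R * ('i%C * ((h / rC) * s (a + h))).
    by rewrite -s1 /phi; move: (s (a + h)) => t; ring.
  have e3 : disc_map a r (phi (a + h)) = a + h.
    rewrite /disc_map e1 e2 -/rC; move: (s (a + h)) s0 => t t0.
    by field; rewrite t0 rC0 i0.
  rewrite /G e3 /test_fun e1; move: (s (a + h)) s0 => t t0.
  rewrite !exprMn i2; move: (f _) => X.
  by field; rewrite t0.
pose H z := - 4%:R * ((cderiv G (phi z) * ('i%C * (2%:R * (s z * s z / rC) - 0))) * (s z * s z)
  + G (phi z) * ((s z * s z / rC) * s z + s z * (s z * s z / rC))).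
have fH h : cabs h < r -> cderiv f (a + h) = H (a + h).
  move=> hr; apply: cderivE.
  have d1 := cder_comp (f := G) (g := phi) (dG _ (sH h hr)) (dphi h hr).
  have d2 := cder_scale (- 4%:R) (cderM d1 (cderM (ds h hr) (ds h hr))).
  apply: (cder_ext (r := r - cabs h) _ _ d2); first by rewrite subr_gt0.
  move=> k; rewrite ltrBrDr => kr; rewrite -addrA fE ?addrA//.
  by rewrite addrC (le_lt_trans (cabsD _ _)).
have h0 : cabs (0 : R[i]) < r by rewrite cabs0.
have d0 : exists d, cder H a d.
  have := ds 0 h0; have := dphi 0 h0; have := sH 0 h0.
  rewrite addr0 => sHa dphia dsa.
  have dss := cderM dsa dsa.
  have dsr : cder (fun z => s z * s z / rC) a _ := cderM dss (cder_cst rC^-1 a).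
  have dp : cder (fun z => 'i%C * (2%:R * (s z * s z / rC) - 0)) a _ :=
    cder_scale 'i%C (cderB (cder_scale 2%:R dsr) (cder_cst 0 a)).
  have dG1 := cder_comp (f := cderiv G) (g := phi) (ddG _ sHa) dphia.
  have dG0 := cder_comp (f := G) (g := phi) (dG _ sHa) dphia.
  eexists; apply: (cder_scale (- 4%:R)); apply: cderD.
    exact: (cderM (cderM dG1 dp) dss).
  exact: (cderM dG0 (cderD (cderM dsr dsa) (cderM dsa dsr))).
case: d0 => d Hd; apply: (@cder_derivable _ _ _ d).
by apply: (cder_ext r0 _ Hd) => k kr; rewrite fH.
Qed.

End Regularity.

(** * Translation, Hoelder inequality, weighted Bergman norms *)

Section Shift.
Context {R : realType}.
Local Notation mu := (@lebesgue_measure R).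

Lemma lebesgue_measure_shift (e : R) (A : set R) : measurable A ->
  pushforward mu ((fun x => x + e) : _ -> measurableTypeR R) A = mu A.
Proof.
move=> mA.
have me : measurable_fun setT ((fun x => x + e) : measurableTypeR R -> measurableTypeR R).
  exact: measurable_funD.
pose f : {mfun measurableTypeR R >-> measurableTypeR R} :=
  HB.pack (fun x : measurableTypeR R => x + e) (isMeasurableFun.Build _ _ _ _ _ me).
apply/esym; apply: (@lebesgue_measure_unique R (pushforward mu f)) => //= _ [[a b]] _ <-.
rewrite /pushforward.
have -> : (fun x : R => x + e) @^-1` [set` `]a, b]] = [set` `]a - e, b - e]].
  by apply/seteqP; split => x /=; rewrite !in_itv/= ltrBlDr lerBrDr.
rewrite !lebesgue_measure_itv/= !lte_fin ltrD2r.
by rewrite -!EFinD; case: ifP => // _; congr EFin; ring.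
Qed.

Lemma integral_shift_le (e : R) (g : R -> \bar R) : 0 < e ->
  measurable_fun `](0 : R), +oo[ g -> (forall v, 0 < v -> (0 <= g v)%E) ->
  (\int[mu]_(v in `](0 : R)%R, +oo[) g (v + e)%R
     <= \int[mu]_(v in `](0 : R)%R, +oo[) g v)%E.
Proof.
move=> e0 mg g0.
have sub : `]e, +oo[ `<=` `](0 : R), +oo[ by apply: subset_itvr; rewrite bnd_simp ltW.
have pe : `](0 : R), +oo[%classic = ((fun x => x + e) : _ -> measurableTypeR R) @^-1` `]e, +oo[.
  by apply/seteqP; split => x /=; rewrite !in_itv/= !andbT ltrDr.
have me : measurable_fun setT ((fun x => x + e) : measurableTypeR R -> measurableTypeR R).
  exact: measurable_funD.
rewrite [X in (X <= _)%E](_ : _ = \int[mu]_(v in `]e, +oo[) g v)%E; last first.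
  rewrite [in LHS]pe.
  have <- := @ge0_integral_pushforward _ _ _ _ R _ me mu `]e, +oo[%classic g.
  - by apply: eq_measure_integral => //= A mA AS; exact: lebesgue_measure_shift.
  - exact: measurable_itv.
  - exact: measurable_funS mg.
  - by move=> v; rewrite inE => /sub; rewrite /= in_itv/= andbT; exact: g0.
apply: ge0_subset_integral => // v.
by rewrite /= in_itv/= andbT; exact: g0.
Qed.

(** An upward translation maps the half-plane into itself and preserves area. *)
Lemma aint_shift_le (e : R) (F : R[i] -> R) : 0 < e -> hmeas F ->
  hmeas (fun z => F (z + e%:C * 'i%C)) -> (forall z, halfplane z -> 0 <= F z) ->
  (aint (fun z => F (z + e%:C * 'i%C)%R) <= aint F)%E.
Proof.
move=> e0 mF mFe F0.
have E (z : R[i]) : z + e%:C * 'i%C = complex.Re z +i* (complex.Im z + e).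
  by case: z => a b; simpc.
rewrite !aint_iterated//; last first.
  by move=> z z0; apply: F0; rewrite E /halfplane /= addr_gt0.
under eq_integral do under eq_integral do rewrite E/=.
apply: (@integral_shift_le e (fun v => \int[mu]_u (F (u +i* v))%:E)%E e0).
  exact: measurable_horizontal_integral.
by move=> v v0; apply: integral_ge0 => u _; rewrite lee_fin F0.
Qed.

End Shift.

Section Hoelder.
Context {R : realType}.
Implicit Types (F G : R[i] -> R).
Let mH := @measurable_halfplane2 R.

Lemma aint_restrict F : aint F = (\int[dV]_q ((planar F \_ (@halfplane2 R)) q)%:E)%E.
Proof.
rewrite /aint integral_mkcond; apply: eq_integral => q _.
by rewrite /patch; case: ifP.
Qed.

Lemma aint_hoelder F G (p q A B : R) : 0 < p -> 0 < q -> p^-1 + q^-1 = 1 ->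
  hmeas F -> hmeas G -> (forall z, halfplane z -> 0 <= F z) ->
  (forall z, halfplane z -> 0 <= G z) -> 0 <= A -> 0 <= B ->
  (aint (fun z => (F z `^ p)%R) <= (A `^ p)%:E)%E ->
  (aint (fun z => (G z `^ q)%R) <= (B `^ q)%:E)%E ->
  (aint (fun z => F z * G z)%R <= (A * B)%:E)%E.
Proof.
move=> p0 q0 pq mF mG F0 G0 A0 B0 FA GB.
pose f := planar F \_ (@halfplane2 R); pose g := planar G \_ (@halfplane2 R).
have mf : measurable_fun setT f by exact/(measurable_restrictT _ mH).
have mg : measurable_fun setT g by exact/(measurable_restrictT _ mH).
have N (H : R[i] -> R) r (C : R) : 0 < r -> 0 <= C -> (forall z, halfplane z -> 0 <= H z) ->
    (aint (fun z => (H z `^ r)%R) <= (C `^ r)%:E)%E ->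
    ('N[dV]_r%:E[EFin \o (planar H \_ (@halfplane2 R))] <= C%:E)%E.
  move=> r0 C0 H0 HC; rewrite unlock /=.
  have -> : (\int[dV]_x `|((planar H \_ (@halfplane2 R)) x)%:E| `^ r)%E =
      aint (fun z => H z `^ r).
    rewrite aint_restrict; apply: eq_integral => x _.
    rewrite /patch; case: ifPn => [|_]; last by rewrite /= normr0 powR0 ?gt_eqF.
    by rewrite inE => x0; rewrite /= ger0_norm//; exact: H0.
  rewrite -[leRHS](_ : (C `^ r)%:E `^ r^-1 = _)%E; last first.
    by rewrite poweR_EFin -powRrM mulfV ?gt_eqF// powRr1.
  apply: gt0_ler_poweR => //; first by rewrite invr_ge0 ltW.
  - by rewrite in_itv/= leey andbT; apply: aint_ge0 => z _; exact: powR_ge0.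
  - by rewrite in_itv/= leey andbT lee_fin powR_ge0.
have := hoelder dV mf mg p0 q0 pq; rewrite Lnorm1.
have -> : (\int[dV]_x `|(EFin \o (f \* g)%R) x|)%E = aint (fun z => F z * G z).
  rewrite aint_restrict; apply: eq_integral => x _; rewrite /f /g /patch /=.
  case: ifPn => [|_]; last by rewrite mulr0 normr0.
  by rewrite inE => x0; rewrite ger0_norm// mulr_ge0//; [exact: F0|exact: G0].
move/le_trans; apply; rewrite EFinM.
by apply: lee_pmul; rewrite ?Lnorm_ge0//; [exact: N|exact: N].
Qed.

End Hoelder.

Section BergmanNorm.
Context {R : realType}.
Implicit Types (f : R[i] -> R[i]) (Om : R[i] -> R) (p N : R).

Lemma bergman_normE p Om f :
  bergman_norm p Om f = (aint (fun z => cabs (f z) `^ p * Om z)%R `^ p^-1)%E.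
Proof. by []. Qed.

(** Bounds of the norm by a real number are bounds of the integral: this replaces
    extended real powers by real ones. *)
Lemma bergman_norm_le p Om f N : 0 < p -> (forall z, 0 <= Om z) -> 0 <= N ->
  (bergman_norm p Om f <= N%:E)%E <->
  (aint (fun z => cabs (f z) `^ p * Om z)%R <= (N `^ p)%:E)%E.
Proof.
move=> p0 Om0 N0; rewrite bergman_normE; set I := aint _.
have I0 : (0 <= I)%E by apply: aint_ge0 => z _; rewrite mulr_ge0 ?powR_ge0.
have inI (x : \bar R) : (0 <= x)%E -> x \in `[0%E, +oo%E].
  by move=> x0; rewrite in_itv/= x0 leey.
split=> h.
- have : ((I `^ p^-1) `^ p <= N%:E `^ p)%E.
    apply: gt0_ler_poweR; rewrite ?inI ?poweR_ge0 ?lee_fin//; exact: ltW.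
  by rewrite -poweRrM mulVf ?gt_eqF// poweRe1// poweR_EFin.
- have : (I `^ p^-1 <= (N `^ p)%:E `^ p^-1)%E.
    by apply: gt0_ler_poweR; rewrite ?inI ?lee_fin ?powR_ge0// invr_ge0 ltW.
  by rewrite poweR_EFin -powRrM mulfV ?gt_eqF// powRr1.
Qed.

Lemma bergman_norm_ge0 p Om f : (0 <= bergman_norm p Om f)%E.
Proof. exact: poweR_ge0. Qed.

End BergmanNorm.

(** * Growth along vertical lines *)

Section VerticalDecay.
Context {R : realType}.
Implicit Types (z w c : R[i]) (f g b : R[i] -> R[i]).

Lemma derive_nonneg_le (F F' : R -> R) (y T : R) : y <= T ->
  (forall s, y <= s <= T -> is_derive s 1 F (F' s)) ->
  (forall s, y <= s <= T -> 0 <= F' s) -> F y <= F T.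
Proof.
move=> yT dF F0; rewrite -subr_ge0.
have cF : {within `[y, T], continuous F}.
  by apply: derivable_within_continuous => s; rewrite in_itv/= => /dF[].
have dF' s : s \in `]y, T[ -> is_derive s 1 F (F' s).
  by rewrite in_itv/= => /andP[? ?]; apply: dF; rewrite !ltW.
have [s sI ->] := MVT_segment yT dF' cF.
by rewrite mulr_ge0 ?subr_ge0// F0//; move: sI; rewrite in_itv.
Qed.

(** Integrating |f'| over [y, T]. A real antiderivative is all that is available, so
    f is paired with the fixed number B = f (x + i y): the real part of conj B f minus
    |B| A / e s^-e is nondecreasing in s. *)
Lemma vertical_decay f g (x y T A e : R) : 0 < y -> y <= T -> 0 < e -> 0 <= A ->
  (forall s, y <= s <= T -> cder f (x +i* s) (g (x +i* s))) ->
  (forall s, y <= s <= T -> cabs (g (x +i* s)) <= A * s `^ (- (1 + e))) ->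
  cabs (f (x +i* y)) <= cabs (f (x +i* T)) + A / e * y `^ (- e).
Proof.
move=> y0 yT e0 A0 df gA; set B := f (x +i* y).
have [B0|Bn] := eqVneq B 0.
  by rewrite B0 cabs0 addr_ge0 ?cabs_ge0// mulr_ge0 ?powR_ge0// divr_ge0// ltW.
have Bp : 0 < cabs B by rewrite cabs_gt0.
have E s : x +i* s = x%:C + s%:C * 'i%C by simpc.
pose rho s := complex.Re (B^*%C * f (x%:C + s%:C * 'i%C)).
pose sig s := rho s - cabs B * A / e * s `^ (- e).
have dsig s : y <= s <= T -> is_derive s 1 sig
    (complex.Re (B^*%C * g (x +i* s) * 'i%C) + cabs B * A * s `^ (- (1 + e))).
  move=> sI; have s0 : 0 < s by case/andP: sI => ys _; exact: lt_le_trans ys.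
  have d1 : is_derive s 1 rho (complex.Re (B^*%C * g (x +i* s) * 'i%C)).
    apply: (@is_derive_line _ (fun w => B^*%C * f w) x%:C 'i%C).
    by apply: cder_scale; rewrite -E; exact: df.
  have d2 := is_derive1_powR (- e) s0.
  have d3 := @is_deriveM _ _ (cst (cabs B * A / e)) _ s 1 _ _ (is_derive_cst _ _ _) d2.
  apply: (is_derive_eq (is_deriveB d1 d3)).
  rewrite scaler0 addr0 /GRing.scale/= /cst (_ : - e - 1 = - (1 + e)); last by ring.
  by field; rewrite gt_eqF.
have sigle : sig y <= sig T.
  apply: (derive_nonneg_le yT dsig) => s sI.
  have h1 : - cabs (B^*%C * g (x +i* s) * 'i%C) <= complex.Re (B^*%C * g (x +i* s) * 'i%C).
    by have := Re_le_cabs (B^*%C * g (x +i* s) * 'i%C); rewrite ler_norml => /andP[].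
  have h2 : cabs (B^*%C * g (x +i* s) * 'i%C) <= cabs B * A * s `^ (- (1 + e)).
    have i1 : cabs ('i%C : R[i]) = 1 by rewrite /cabs/= expr0n/= expr1n add0r sqrtr1.
    by rewrite !cabsM i1 mulr1 cabs_conj -mulrA ler_wpM2l ?cabs_ge0// gA.
  lra.
have rhoy : rho y = cabs B ^+ 2.
  by rewrite /rho -E -/B sqr_cabs; move: (B) => [p q] /=; ring.
have rhoT : rho T <= cabs B * cabs (f (x +i* T)).
  rewrite /rho -E (le_trans (ler_norm _))// (le_trans (Re_le_cabs _))//.
  by rewrite cabsM cabs_conj.
rewrite -(ler_pM2l Bp) -expr2 mulrDr -rhoy.
move: sigle; rewrite /sig => sigle.
have p0 : 0 <= cabs B * A / e * T `^ (- e).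
  by rewrite mulr_ge0 ?powR_ge0// divr_ge0 ?(ltW e0)// mulr_ge0// ltW.
have -> : cabs B * (A / e * y `^ (- e)) = cabs B * A / e * y `^ (- e) by ring.
lra.
Qed.

Lemma kdist_vertical_le (x y T : R) w : 0 < y -> y <= T -> halfplane w ->
  kdist (x +i* y) w <= kdist (x +i* T) w.
Proof.
move=> y0 yT; case: w => u v w0; have v0 : 0 < v by [].
rewrite /kdist -(@ler_pXn2r _ 2) ?nnegrE ?cabs_ge0// !sqr_cabs /= opprK lerD2l.
by apply: lerXn2r; rewrite ?nnegrE; lra.
Qed.

End VerticalDecay.

(** * Point evaluation and test functions *)

Section PointEvaluation.
Context {R : realType}.
Implicit Types (z w c : R[i]) (f g b F : R[i] -> R[i]) (e M N p k : R).

Definition up e z : R[i] := z + e%:C * 'i%C.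

Lemma upE e z : up e z = complex.Re z +i* (complex.Im z + e).
Proof. by rewrite /up; case: z => a b; simpc. Qed.

Lemma halfplane_up e z : 0 <= e -> halfplane z -> halfplane (up e z).
Proof. by move=> e0 z0; rewrite upE /halfplane /= ltr_wpDr. Qed.

Lemma kdist_up e z w : kdist z (up e w) = kdist (up e z) w.
Proof.
by rewrite /kdist !upE; case: z => a b; case: w => a' b'; congr cabs; simpc; rewrite [b' + e]addrC addrA.
Qed.

Lemma kdist_diag z : halfplane z -> kdist z z = 2 * complex.Im z.
Proof.
case: z => x y z0; have y0 : 0 < y by [].
rewrite /kdist /cabs /= opprK subrr expr0n add0r sqrtr_sqr -mulr2n mulr_natl ger0_norm//.
by rewrite mulrn_wge0// ltW.
Qed.

Lemma holomorphic_up e F : 0 <= e -> holomorphic F -> holomorphic (fun z => F (up e z)).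
Proof.
move=> e0 hF; apply: (holomorphic_compose hF).
  by move=> z; exact: halfplane_up.
move=> z z0; exact: cder_derivable (cderD (cder_id z) (cder_cst (e%:C * 'i%C) z)).
Qed.

Lemma hmeas_kernel n z : halfplane z -> hmeas (fun w => kdist z w ^- n).
Proof.
move=> z0; have := measurable_cabs (cmeas_kernel n z0).
by congr measurable_fun; apply/funext => q; rewrite /planar cabsV cabsX.
Qed.

(** The reproducing formula for F (w + i e) (w - conj z)^-2, evaluated at w = z, where
    the kernel is of size (2 Im z)^-2. The upward translation supplies the boundedness
    that makes this function square integrable. *)
Lemma weighted_mean_bound c F e M z : bergman_constant c -> holomorphic F -> 0 < e ->
  (forall w, halfplane w -> cabs (F (up e w)) <= M) -> halfplane z ->
  ((cabs (F (up e z)))%:E <= (8 * cabs c * complex.Im z ^+ 2)%:E *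
     aint (fun w => cabs (F (up e w)) * kdist z w ^- 4)%R)%E.
Proof.
move=> hc hF e0 FM z0; have hFe := holomorphic_up (ltW e0) hF.
pose H w := F (up e w) * test_fun 2 z w.
have hH : holomorphic H by exact: (holomorphicM hFe (@holomorphic_test_fun R 2 z z0)).
have sH : square_integrable H by exact: (square_integrable_bounded_test hFe FM z0).
have [Pd HP] := bergman_reproducing hc hH sH z0.
have mF := measurable_cabs (cmeas_holomorphic hFe).
have mk := hmeasM mF (hmeas_kernel 4 z0).
have y0 : 0 < complex.Im z by [].
have := cintegral_le Pd; rewrite -/(projection c H z) -HP.
have -> : aint (fun w => cabs (projection_integrand c H z w)) =
    ((cabs c)%:E * aint (fun w => cabs (F (up e w)) * kdist z w ^- 4)%R)%E.
  rewrite -aintZ ?cabs_ge0//; last first.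
    by move=> w _; rewrite mulr_ge0 ?cabs_ge0// invr_ge0 exprn_ge0 ?cabs_ge0.
  apply: eq_aint => w _; rewrite /projection_integrand !cabsM cabs_test_fun cabsV cabsX.
  rewrite -/(kdist z w) -!mulrA; congr (_ * _); rewrite mulrCA; congr (_ * _).
  by rewrite -invfM -exprD.
have hz : cabs (H z) = cabs (F (up e z)) * (2 * complex.Im z) ^- 2.
  by rewrite cabsM cabs_test_fun kdist_diag.
rewrite hz => h.
have -> : cabs (F (up e z)) = (4 * complex.Im z ^+ 2) * (cabs (F (up e z)) * (2 * complex.Im z) ^- 2).
  by field; rewrite gt_eqF.
rewrite EFinM; apply: (@le_trans _ _ ((4 * complex.Im z ^+ 2)%:E * (2%:E * ((cabs c)%:E *
   aint (fun w => cabs (F (up e w)) * kdist z w ^- 4)%R)))%E).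
  by rewrite lee_wpmul2l// lee_fin mulr_ge0// sqr_ge0.
rewrite !muleA -!EFinM (_ : 4 * complex.Im z ^+ 2 * 2 * cabs c = 8 * cabs c * complex.Im z ^+ 2)//.
by ring.
Qed.

Lemma conjugate_exponent p : 1 < p ->
  [/\ 0 < p, 1 < p / (p - 1) & p^-1 + (p / (p - 1))^-1 = 1].
Proof.
move=> p1; have p0 : 0 < p by lra. have q0 : 0 < p - 1 by lra.
split => //; first by rewrite ltr_pdivlMr// mul1r; lra.
by field; rewrite !gt_eqF.
Qed.

(** Translate by half the height of z, apply weighted_mean_bound at the lower point,
    then remove the translation under the integral and use the Hoelder inequality with
    the weight omega^(k p). The bound M is qualitative only: it does not enter C. *)
Lemma point_evaluation c p k : bergman_constant c -> 1 < p ->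
  exists2 C : R, 0 <= C & forall F z M N, holomorphic F -> halfplane z -> 0 <= N ->
    (forall w, halfplane w -> cabs (F (up (complex.Im z / 2) w)) <= M) ->
    (aint (fun w => cabs (F w) `^ p * omega w `^ (k * p))%R <= (N `^ p)%:E)%E ->
    cabs (F z) <= C * N * omega z `^ (- k) * complex.Im z `^ (- (2 / p)).
Proof.
move=> hc p1; have [p0 q1 pq] := conjugate_exponent p1.
set q := p / (p - 1) in q1 pq; have q0 : 0 < q by lra.
have [C1 C10 H1] := @kernel_integral_omega R (- k * q) 1 (4 * q) ltr01 (ltac:(lra)).
exists (8 * cabs c * 81 * C1 `^ q^-1); first by rewrite !mulr_ge0 ?powR_ge0 ?cabs_ge0.
move=> F [x y] M N hF z0 N0 FM FN; set z := x +i* y in z0 FM *; rewrite /= in FM *.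
have y0 : 0 < y by []. set e := y / 2 in FM; have e0 : 0 < e by rewrite divr_gt0.
pose z1 := x +i* e; have z10 : halfplane z1 by [].
have zz1 : up e z1 = z by rewrite upE /z1 /z /e/= -splitr.
have hFe := holomorphic_up (ltW e0) hF.
have mF := measurable_cabs (cmeas_holomorphic hF).
have mFe := measurable_cabs (cmeas_holomorphic hFe).
pose Psi w := 81 * (cabs (F w) * kdist z w ^- 4).
have mk := hmeasM mF (hmeas_kernel 4 z0).
have mPsi : hmeas Psi by exact: hmeasZ mk.
have z20 := halfplane_up (ltW e0) z0.
have mPsie : hmeas (fun w => Psi (up e w)).
  have := hmeasZ 81 (hmeasM mFe (hmeas_kernel 4 z20)).
  by congr measurable_fun; apply/funext => w; rewrite /Psi /planar kdist_up.
have kn0 w : 0 <= kdist z w ^- 4 by rewrite invr_ge0 exprn_ge0 ?cabs_ge0.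
have Psi0 w : 0 <= Psi w by rewrite mulr_ge0// mulr_ge0 ?cabs_ge0.
have step1 := weighted_mean_bound hc hF e0 FM z10.
have step2 : (aint (fun w => cabs (F (up e w)) * kdist z1 w ^- 4)%R <= aint Psi)%E.
  apply: (le_trans _ (aint_shift_le e0 mPsi mPsie (fun w _ => Psi0 w))).
  apply: aint_le => //; first exact: hmeasM mFe (hmeas_kernel 4 z10).
  move=> w w0; rewrite mulr_ge0 ?cabs_ge0 ?invr_ge0 ?exprn_ge0 ?cabs_ge0//=.
  rewrite /Psi -/(up e w) mulrCA ler_wpM2l ?cabs_ge0//.
  have d0 := kdist_gt0 z10 w0.
  have d1 : 0 < kdist z (up e w) by apply: kdist_gt0 => //; exact: halfplane_up (ltW e0) w0.
  (* 81 = 3^4: translating both points costs a factor 3 in the kernel. *)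
  have d3 : kdist z (up e w) <= 3 * kdist z1 w.
    rewrite -zz1 kdist_up (le_trans (kdist_shift _ z1 _))//.
    have -> : up e (up e z1) - z1 = (2 * e)%:C * 'i%C.
      by rewrite !upE /z1 /=; simpc; congr (_ +i* _); ring.
    rewrite cabsM cabsR (_ : cabs 'i%C = 1) ?mulr1; last first.
      by rewrite /cabs/= expr0n/= expr1n add0r sqrtr1.
    have := kdist_Iml z10 w0; rewrite /= ger0_norm; last by rewrite mulr_ge0// ltW.
    lra.
  rewrite -[81]invrK -invfM lef_pV2 ?posrE ?exprn_gt0 ?mulr_gt0 ?invr_gt0 ?exprn_gt0//.
  rewrite ler_pdivrMl// (_ : 81 = 3 ^+ 4 :> R); last by ring.
  by rewrite -exprMn; apply: lerXn2r; rewrite ?nnegrE ?mulr_ge0 ?cabs_ge0.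
pose B := C1 `^ q^-1 * (omega z `^ (- k) * y `^ (2 / q - 4)).
have B0 : 0 <= B by rewrite !mulr_ge0 ?powR_ge0.
have step3 : (aint (fun w => cabs (F w) * kdist z w ^- 4)%R <= (N * B)%:E)%E.
  pose F1 w := cabs (F w) * omega w `^ k.
  pose G1 w := omega w `^ (- k) * kdist z w `^ (- 4).
  have ow w := omega_gt0 w.
  rewrite (eq_aint (G := fun w => F1 w * G1 w)); last first.
    move=> w w0; rewrite /F1 /G1 -mulrA (mulrA (omega w `^ k)) -powRDp// subrr powRr0.
    by rewrite mul1r (powR_invn 4) ?cabs_ge0.
  apply: (@aint_hoelder _ F1 G1 p q) => //.
  - exact: (hmeasM mF (hmeas_powR k (@hmeas_omega R))).
  - exact: (hmeasM (hmeas_powR (- k) (@hmeas_omega R)) (hmeas_powR (- 4) (hmeas_kdist z0))).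
  - by move=> w _; rewrite mulr_ge0 ?cabs_ge0 ?powR_ge0.
  - by move=> w _; rewrite mulr_ge0 ?powR_ge0.
  - rewrite (eq_aint (G := fun w => cabs (F w) `^ p * omega w `^ (k * p)))//.
    by move=> w _; rewrite /F1 powRM ?cabs_ge0 ?powR_ge0// -powRrM.
  - rewrite (eq_aint (G := fun w => omega w `^ (- k * q) *
        (complex.Im w `^ (1 - 1) * kdist z w `^ (- (4 * q))))); last first.
      move=> w _; rewrite /G1 powRM ?powR_ge0// -!powRrM subrr powRr0 mul1r.
      by rewrite (mulNr 4 q).
    apply: (le_trans (H1 z z0)); rewrite lee_fin /B /=.
    have c0 := powR_ge0 C1 q^-1.
    rewrite !powRM ?mulr_ge0 ?powR_ge0// -!powRrM mulVf ?gt_eqF// powRr1//.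
    rewrite (_ : (2 / q - 4) * q = 1 + 1 - 4 * q)//.
    by field; rewrite gt_eqF.
have step4 : aint Psi = (81%:E * aint (fun w => cabs (F w) * kdist z w ^- 4)%R)%E.
  by rewrite -aintZ// => w _; rewrite mulr_ge0 ?cabs_ge0.
rewrite zz1 in step1.
have cc : 0 <= 8 * cabs c * e ^+ 2 by rewrite mulr_ge0 ?sqr_ge0// mulr_ge0 ?cabs_ge0.
have : ((cabs (F z))%:E <= (8 * cabs c * e ^+ 2 * (81 * (N * B)))%:E)%E.
  apply: (le_trans step1); rewrite [leRHS]EFinM; apply: lee_wpmul2l; first by rewrite lee_fin.
  apply: (le_trans step2); rewrite step4 [leRHS]EFinM; apply: lee_wpmul2l => //.
rewrite lee_fin => /le_trans; apply.
have -> : y `^ (- (2 / p)) = y ^+ 2 * y `^ (2 / q - 4).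
  rewrite -powR_mulrn ?(ltW y0)// -powRDp//; congr (_ `^ _).
  by rewrite /q; field; rewrite !gt_eqF//; lra.
rewrite /B /e.
set T1 := C1 `^ _; set T2 := omega z `^ _; set T3 := y `^ _.
have T0 : 0 <= cabs c * N * T1 * T2 * T3 * y ^+ 2.
  by rewrite mulr_ge0 ?sqr_ge0// !mulr_ge0 ?cabs_ge0 ?powR_ge0.
rewrite expr_div_n.
have -> : 8 * cabs c * (y ^+ 2 / 2 ^+ 2) * (81 * (N * (T1 * (T2 * T3)))) =
  162 * (cabs c * N * T1 * T2 * T3 * y ^+ 2).
  by field.
have -> : 8 * cabs c * 81 * T1 * N * T2 * (y ^+ 2 * T3) =
  648 * (cabs c * N * T1 * T2 * T3 * y ^+ 2).
  by ring.
by rewrite ler_wpM2r// ler_nat.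
Qed.

Lemma test_fun_norm p l : 1 < p -> exists2 C : R, 0 < C & forall z, halfplane z ->
  (aint (fun w => cabs (test_fun 2 z w) `^ p * omega w `^ (- l * p))%R
    <= ((C * (omega z `^ (- l) * complex.Im z `^ (2 / p - 2))) `^ p)%:E)%E.
Proof.
move=> p1; have p0 : 0 < p by lra.
have [C1 C10 H1] := @kernel_integral_omega R (- l * p) 1 (2 * p) ltr01 (ltac:(lra)).
exists ((C1 + 1) `^ p^-1); first by rewrite powR_gt0// ltr_pwDr.
move=> z z0; rewrite (eq_aint (G := fun w => omega w `^ (- l * p) *
   (complex.Im w `^ (1 - 1) * kdist z w `^ (- (2 * p))))); last first.
  move=> w w0; have D0 := kdist_gt0 z0 w0.
  rewrite subrr powRr0 mul1r mulrC; congr (_ * _).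
  by rewrite cabs_test_fun -(powR_invn 2) ?cabs_ge0// -powRrM mulNr.
apply: (le_trans (H1 z z0)); rewrite lee_fin.
have c0 : 0 <= (C1 + 1) `^ p^-1 by exact: powR_ge0.
rewrite !powRM ?mulr_ge0 ?powR_ge0// -!powRrM mulVf ?gt_eqF// powRr1 ?addr_ge0//.
rewrite (_ : (2 / p - 2) * p = 1 + 1 - 2 * p); last by field; rewrite gt_eqF.
by rewrite ler_wpM2r ?mulr_ge0 ?powR_ge0// lerDl.
Qed.

End PointEvaluation.

(** * A bounded Hankel operator has a Bloch symbol *)

Section HankelToBloch.
Context {R : realType}.
Implicit Types (z w c : R[i]) (f g b F : R[i] -> R[i]) (p l k m : R).

Lemma le_of_le_add_inv (a B K y : R) : 0 < y -> 0 <= K ->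
  (forall T, y <= T -> a <= K / T + B) -> a <= B.
Proof.
move=> y0 K0 H; apply/ler_addgt0Pr => e e0.
have T0 : 0 < y + K / e by rewrite ltr_pwDl// divr_ge0// ltW.
apply: (le_trans (H (y + K / e) _)); first by rewrite lerDl divr_ge0// ltW.
rewrite addrC lerD2l ler_pdivrMr// mulrDr mulrCA mulfV ?gt_eqF// mulr1 lerDr.
by rewrite mulr_ge0// ltW.
Qed.

(** One factor of the kernel is at most 1 / T, and the others only decrease as the
    point moves up. *)
Lemma kint_high_le n b (x y : R) : 0 < y -> kintegrable n b ->
  exists2 K : R, 0 <= K & forall T, y <= T -> cabs (kint n.+1 b (x +i* T)) <= K / T.
Proof.
move=> y0 bi; set z := x +i* y; have z0 : halfplane z by [].
have /cintegrableP[mk ky] := bi z z0.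
have mc : hmeas (fun w => cabs ((z - w^*%C) ^- n * b w)) by exact: measurable_cabs.
have I0 : (0 <= aint (fun w => cabs ((z - w^*%C) ^- n * b w))%R)%E.
  by apply: aint_ge0 => *; exact: cabs_ge0.
have kfin : aint (fun w => cabs ((z - w^*%C) ^- n * b w)) \is a fin_num.
  by rewrite ge0_fin_numE.
exists (2 * fine (aint (fun w => cabs ((z - w^*%C) ^- n * b w)))).
  by rewrite mulr_ge0// fine_ge0.
move=> T yT; have T0 : 0 < T by exact: lt_le_trans yT.
have zT0 : halfplane (x +i* T) by [].
have iT := kintegrableS bi zT0.
rewrite -lee_fin; apply: (le_trans (cintegral_le iT)).
rewrite -mulrA [_ / T]mulrC !EFinM fineK//.
apply: lee_wpmul2l => //; rewrite -aintZ ?invr_ge0 ?(ltW T0)//; last by move=> *; exact: cabs_ge0.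
apply: aint_le => //.
- exact: measurable_cabs (cintegrable_cmeas iT).
- exact: hmeasZ mc.
move=> w w0; rewrite cabs_ge0/= !cabsM mulrA ler_wpM2r ?cabs_ge0//.
rewrite exprS invfM cabsM; apply: ler_pM; rewrite ?cabs_ge0//.
  by rewrite cabsV lef_pV2 ?posrE ?kdist_gt0//; exact: kdist_Iml zT0 w0.
rewrite !cabsV !cabsX lef_pV2 ?posrE ?exprn_gt0 ?kdist_gt0//.
by apply: lerXn2r; rewrite ?nnegrE ?cabs_ge0//; exact: kdist_vertical_le.
Qed.

Lemma kratio_vertical (x y s : R) : 0 < y -> y <= s ->
  kratio (x +i* y) (x +i* s) <= 4 * (s / y).
Proof.
move=> y0 ys; have s0 := lt_le_trans y0 ys.
rewrite /kratio ler_pdivrMr ?mulr_gt0//= sqr_cabs /= subrr expr0n add0r opprK.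
have -> : 4 * (s / y) * (y * s) = (2 * s) ^+ 2 by field; rewrite gt_eqF.
by apply: lerXn2r; rewrite ?nnegrE; lra.
Qed.

(** Integrate the second derivative along the vertical line from z to infinity, where b'
    vanishes by kint_high_le. Along this line omega changes by the factor kratio^(1/2),
    at most a constant times (s / y)^(1/2), which leaves an integrable power of s. *)
Lemma first_derivative_bound m : exists2 C : R, 0 <= C & forall c b A, c != 0 ->
  projection_fixed c b -> 0 <= A ->
  (forall w, halfplane w -> cabs (cderiv (cderiv b) w) <=
     A * (omega w `^ (- m) * complex.Im w `^ (- 2))) ->
  forall z, halfplane z -> cabs (cderiv b z) <= C * A * (omega z `^ (- m) * (complex.Im z)^-1).
Proof.
have h20 : 0 < 2^-1 :> R by rewrite invr_gt0.
have [C C0 H] := omega_powR_le (- m) h20.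
exists (4 * C); first by rewrite mulr_ge0// ltW.
move=> c b A c0 bP A0 bA [x y] z0; set z := x +i* y in z0 *; have y0 : 0 < y by [].
rewrite [complex.Im z]/=.
have [K K0 HK] := kint_high_le x y0 (projection_fixed_kintegrable c0 bP).
pose A1 := 2 * A * C * omega z `^ (- m) * y `^ (- 2^-1).
have A10 : 0 <= A1 by rewrite /A1 !mulr_ge0 ?powR_ge0 ?(ltW C0).
have K20 : 0 <= 2 * cabs c * K by rewrite !mulr_ge0 ?cabs_ge0.
apply: (le_of_le_add_inv y0 K20) => T yT.
have h := @vertical_decay R (cderiv b) (cderiv (cderiv b)) x y T A1 2^-1 y0 yT h20 A10.
apply: (le_trans (h _ _)).
- move=> s /andP[ys _]; have w0 : halfplane (x +i* s) by exact: lt_le_trans ys.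
  have d := cder_cderiv_projection_fixed c0 bP w0.
  by rewrite (cderivE d).
- move=> s /andP[ys _]; have s0 := lt_le_trans y0 ys.
  have w0 : halfplane (x +i* s) by [].
  apply: (le_trans (bA _ w0)); rewrite [complex.Im _]/=.
  have hk : kratio z (x +i* s) `^ 2^-1 <= 2 * (s `^ 2^-1 * y `^ (- 2^-1)).
    have kr0 : 0 <= kratio z (x +i* s) by rewrite (le_trans ler01)// kratio_ge1.
    apply: (le_trans (powR_mono kr0 (kratio_vertical x y0 ys) (ltW h20))).
    rewrite !powRM ?mulr_ge0 ?invr_ge0 ?(ltW s0) ?(ltW y0)//.
    rewrite -[y^-1](powR_inv1 (ltW y0)) -powRrM mulN1r.
    rewrite (_ : 4 = 2 ^+ 2 :> R); last by ring.
    by rewrite -powR_mulrn// -powRrM mulfV// powRr1.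
  have hw := H z _ z0 w0.
  have -> : s `^ (- 2) = s `^ (- (1 + 2^-1)) * s `^ (- 2^-1).
    by rewrite -powRDp//; congr (_ `^ _); field.
  have e1 : s `^ (- 2^-1) * s `^ 2^-1 = 1 by rewrite -powRDp// addNr powRr0.
  have -> : A1 * s `^ (- (1 + 2^-1)) = A * ((C * omega z `^ (- m) *
     (2 * (s `^ 2^-1 * y `^ (- 2^-1)))) * (s `^ (- (1 + 2^-1)) * s `^ (- 2^-1))).
    rewrite /A1; set S1 := s `^ (- 2^-1) in e1 *; set S2 := s `^ 2^-1 in e1 *.
    set S3 := s `^ _; set Y := y `^ _; set O := omega z `^ _.
    have -> : A * (C * O * (2 * (S2 * Y)) * (S3 * S1)) = 2 * A * C * O * Y * S3 * (S1 * S2) by ring.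
    by rewrite e1 mulr1.
  rewrite ler_wpM2l// ler_wpM2r ?mulr_ge0 ?powR_ge0//.
  apply: (le_trans hw); apply: ler_wpM2l hk.
  by rewrite mulr_ge0 ?powR_ge0 ?(ltW C0).
apply: lerD.
  have w0 : halfplane (x +i* T) by exact: lt_le_trans yT.
  rewrite (cderiv_projection_fixed c0 bP w0) !cabsM cabsN cabs_nat.
  rewrite mulrCA -!mulrA ler_wpM2l// ler_wpM2l ?cabs_ge0//; exact: HK.
have e2 : y `^ (- 2^-1) * y `^ (- 2^-1) = y^-1.
  by rewrite -powRDp// -[RHS](powR_inv1 (ltW y0)); congr (_ `^ _); field.
rewrite invrK /A1 -e2; set Y := y `^ _; set O := omega z `^ _.
by rewrite le_eqVlt; apply/orP; left; apply/eqP; ring.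
Qed.

Lemma kintegrable_kernel_mul b z : halfplane z -> cmeas b -> kintegrable 2 b ->
  kintegrable 2 (fun w => (z - w^*%C) ^- 2 * b w).
Proof.
move=> z0 mb bi w1 w10; have /cintegrableP[mk ky] := bi w1 w10.
have mc : hmeas (fun w => cabs ((w1 - w^*%C) ^- 2 * b w)) by exact: measurable_cabs.
have y0 : 0 <= complex.Im z ^- 2 by rewrite invr_ge0 exprn_ge0// ltW.
apply: (le_cintegrable
  (G := fun w => complex.Im z ^- 2 * cabs ((w1 - w^*%C) ^- 2 * b w))).
- apply: cmeasM; first exact: cmeas_kernel.
  by apply: cmeasM => //; exact: cmeas_kernel.
- exact: hmeasZ mc.
- move=> w w0; rewrite !cabsM mulrCA ler_wpM2r ?mulr_ge0 ?cabs_ge0//.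
  rewrite cabsV cabsX lef_pV2 ?posrE ?exprn_gt0 ?kdist_gt0//.
  by apply: lerXn2r; rewrite ?nnegrE ?cabs_ge0 ?(ltW (z0 : 0 < complex.Im z))//; exact: kdist_Iml.
- rewrite aintZ//; first by rewrite lte_mul_pinfty ?lee_fin.
  by move=> *; exact: cabs_ge0.
Qed.

Lemma kint_up_bounded b e : 0 < e -> kintegrable 2 b -> (aint (fun w => cabs (b w)) < +oo)%E ->
  cmeas b -> exists M : R, forall w, halfplane w -> cabs (kint 2 b (up e w)) <= M.
Proof.
move=> e0 bi by_ mb.
have mc : hmeas (fun w => cabs (b w)) by exact: measurable_cabs.
have I0 : (0 <= aint (fun w => cabs (b w)))%E by apply: aint_ge0 => *; exact: cabs_ge0.
have kfin : aint (fun w => cabs (b w)) \is a fin_num by rewrite ge0_fin_numE.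
exists (2 * (e ^- 2 * fine (aint (fun w => cabs (b w))))) => w w0.
have u0 := halfplane_up (ltW e0) w0; have iu := bi _ u0.
rewrite -lee_fin; apply: (le_trans (cintegral_le iu)).
rewrite !EFinM fineK//; apply: lee_wpmul2l => //.
have en : 0 <= e ^- 2 by rewrite invr_ge0 exprn_ge0// ltW.
rewrite -aintZ//; last by move=> *; exact: cabs_ge0.
apply: aint_le.
- exact: measurable_cabs (cintegrable_cmeas iu).
- exact: hmeasZ mc.
move=> w1 w10; rewrite cabs_ge0/= cabsM ler_wpM2r ?cabs_ge0//.
rewrite cabsV cabsX lef_pV2 ?posrE ?exprn_gt0 ?kdist_gt0//.
apply: lerXn2r; rewrite ?nnegrE ?cabs_ge0 ?(ltW e0)//.
apply: le_trans (kdist_Iml u0 w10); rewrite upE /= lerDr ltW//; exact: w0.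
Qed.

Definition logweight (r : R) z : R := omega z `^ r.

Lemma logweight_ge0 r z : 0 <= logweight r z.
Proof. exact: powR_ge0. Qed.

(** Test the operator on the multiple g of the squared kernel (w - conj z)^-2 whose
    norm is at most 1. Then h_b g is, up to this factor, the integral of b against
    (u - conj w)^-2 (z - conj w)^-2, and at u = z this is the integral that represents
    b''(z). So point_evaluation bounds b''(z), and first_derivative_bound turns this
    into the bound of b'(z). *)
Lemma hankel_to_bloch c p l k : bergman_constant c -> 1 < p ->
  exists2 C : R, 0 <= C & forall b M, projection_fixed c b -> 0 <= M ->
   (forall f, bergman_space p (logweight (- l * p)) f ->
     (bergman_norm p (logweight (- l * p)) f <= 1)%E ->
     (bergman_norm p (logweight (k * p)) (hankel c b f) <= M%:E)%E) ->
   forall z, halfplane z ->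
     complex.Im z * omega z `^ (l + k) * cabs (cderiv b z) <= C * M.
Proof.
move=> hc p1; have p0 : 0 < p by lra.
have c0 := bergman_constant_neq0 hc.
have [C2 C20 H2] := point_evaluation k hc p1.
have [C3 C30 H3] := test_fun_norm l p1.
have [C4 C40 H4] := first_derivative_bound (l + k).
exists (C4 * (6 * C3 * C2)); first by rewrite !mulr_ge0// ltW.
move=> b M bP M0 hM.
have bi := projection_fixed_kintegrable c0 bP.
have hb : holomorphic b.
  by move=> z z0; exact: cder_derivable (cder_projection_fixed c0 bP z0).
have mb := cmeas_holomorphic hb.
have b2 z : halfplane z -> cabs (cderiv (cderiv b) z) <=
    6 * C3 * C2 * M * (omega z `^ (- (l + k)) * complex.Im z `^ (- 2)).
  move=> z0; set y := complex.Im z; have y0 : 0 < y by [].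
  have oz := omega_gt0 z.
  (* a is the bound of the norm of the squared kernel at z. *)
  pose a := C3 * (omega z `^ (- l) * y `^ (2 / p - 2)).
  have a0 : 0 < a by rewrite !mulr_gt0 ?powR_gt0.
  pose g w := (a^-1)%:C * test_fun 2 z w.
  have ht := @holomorphic_test_fun R 2 z z0.
  have hg : holomorphic g.
    by move=> w w0; exact: cder_derivable (cder_scale _ (holomorphic_cder ht w0)).
  have mt := measurable_cabs (cmeas_holomorphic ht).
  have mo := hmeas_powR (- l * p) (@hmeas_omega R).
  have gn : (bergman_norm p (logweight (- l * p)) g <= 1)%E.
    apply/(bergman_norm_le g p0 (logweight_ge0 _) ler01).
    rewrite (eq_aint (G := fun w => a `^ (- p) *
        (cabs (test_fun 2 z w) `^ p * omega w `^ (- l * p)))); last first.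
      move=> w _; rewrite /g cabsM cabsR ger0_norm ?invr_ge0 ?(ltW a0)//.
      rewrite powRM ?invr_ge0 ?(ltW a0) ?cabs_ge0// -mulrA; congr (_ * _).
      by rewrite -[a^-1](powR_inv1 (ltW a0)) -powRrM mulN1r.
    rewrite aintZ ?powR_ge0//; last by move=> w _; rewrite mulr_ge0 ?powR_ge0.
      apply: (le_trans (lee_wpmul2l _ (H3 z z0))); first by rewrite lee_fin powR_ge0.
      by rewrite -EFinM -powRDp// addNr powRr0 powR1.
    exact: hmeasM (hmeas_powR p mt) mo.
  have gs : bergman_space p (logweight (- l * p)) g.
    by split=> //; exact: le_lt_trans gn (ltry _).
  pose be w := (z - w^*%C) ^- 2 * b w.
  have mbe : cmeas be by apply: cmeasM => //; exact: cmeas_kernel.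
  have bei : kintegrable 2 be by exact: kintegrable_kernel_mul.
  pose F w := ((a^-1)%:C * c) * kint 2 be w.
  have hF : holomorphic F.
    by move=> w w0; exact: cder_derivable (cder_scale _ (cder_kint bei w0)).
  have FE w : halfplane w -> hankel c b g w = F w.
    move=> w0; rewrite /hankel /projection.
    rewrite (eq_cintegral (g := fun u => ((a^-1)%:C * c) * ((w - u^*%C) ^- 2 * be u))).
      by rewrite cintegralZ//; exact: bei.
    move=> u u0; rewrite /projection_integrand /hankel_arg /g /be /test_fun.
    rewrite conjcM conjc_real conjc_inv conjcX conjcB conjcK.
    have -> : u^*%C - z = - (z - u^*%C) by ring.
    by rewrite sqrrN; move: (_ ^- 2) (_ ^- 2) => X Y; ring.
  have [M1 HM1] : exists M1, forall w, halfplane w -> cabs (F (up (y / 2) w)) <= M1.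
    have [||M1 HM1] := @kint_up_bounded be (y / 2) _ bei _ mbe.
    - by rewrite divr_gt0.
    - by have /cintegrableP[_] := bi z z0.
    exists (cabs ((a^-1)%:C * c) * M1) => w w0.
    by rewrite /F cabsM ler_wpM2l ?cabs_ge0// HM1.
  have FM : (aint (fun w => cabs (F w) `^ p * omega w `^ (k * p))%R <= (M `^ p)%:E)%E.
    have /(bergman_norm_le _ p0 (logweight_ge0 _) M0) := hM g gs gn.
    by apply: le_trans; rewrite le_eqVlt; apply/orP; left; apply/eqP; apply: eq_aint => w w0; rewrite FE.
  have := H2 F z M1 M hF z0 M0 HM1 FM.
  have -> : cabs (cderiv (cderiv b) z) = 6 * a * cabs (F z).
    rewrite (cderivE (cder_cderiv_projection_fixed c0 bP z0)).
    (* At u = z the two squared kernels merge into the fourth power that represents b''. *)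
    have -> : kint 4 b z = kint 2 be z.
      apply: eq_cintegral => w w0; rewrite /be mulrA -invfM -exprD.
      by [].
    rewrite /F !cabsM cabs_nat cabsR ger0_norm ?invr_ge0 ?(ltW a0)//.
    by field; rewrite gt_eqF.
  move=> Fz; apply: (@le_trans _ _ (6 * a * (C2 * M * omega z `^ (- k) * y `^ (- (2 / p))))).
    by rewrite ler_wpM2l// mulr_ge0// ltW.
  rewrite /a; have -> : omega z `^ (- (l + k)) = omega z `^ (- l) * omega z `^ (- k).
    by rewrite -powRDp// opprD.
  have -> : y `^ (- 2) = y `^ (2 / p - 2) * y `^ (- (2 / p)).
    by rewrite -powRDp//; congr (_ `^ _); ring.
  set E1 := omega z `^ _; set E2 := omega z `^ _; set E3 := y `^ _; set E4 := y `^ _.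
  by rewrite le_eqVlt; apply/orP; left; apply/eqP; ring.
have A0 : 0 <= 6 * C3 * C2 * M by rewrite !mulr_ge0// ltW.
move=> z z0; have := H4 c b _ c0 bP A0 b2 z z0; have y0 : 0 < complex.Im z by [].
have oz := powR_gt0 (l + k) (omega_gt0 z).
move=> h; rewrite mulrC.
have {}h := ler_wpM2r (ltW (mulr_gt0 y0 oz)) h.
apply: (le_trans h); rewrite powRN le_eqVlt; apply/orP; left; apply/eqP.
by field; rewrite !gt_eqF.
Qed.

End HankelToBloch.

(** * Integrals of derivatives over boxes *)

Section BoxIntegrals.
Context {R : realType}.
Implicit Types (h : measurableTypeR R * measurableTypeR R -> R) (xa xb ya yb : R).
Local Notation mu := (@lebesgue_measure R).

Definition box xa xb ya yb : set (measurableTypeR R * measurableTypeR R) :=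
  [set` `[xa, xb]] `*` [set` `[ya, yb]].

Lemma measurable_box xa xb ya yb : measurable (box xa xb ya yb).
Proof. by apply: measurableX; exact: measurable_itv. Qed.

Lemma boxP xa xb ya yb q : box xa xb ya yb q <->
  xa <= q.1 <= xb /\ ya <= q.2 <= yb.
Proof. by rewrite /box /= !in_itv. Qed.

Lemma area_box_fin xa xb ya yb : (dV (box xa xb ya yb) < +oo)%E.
Proof.
have BE : dV (box xa xb ya yb) = _ := @product_measure1E _ _ _ _ R lebesgue_measure lebesgue_measure _ _
  (measurable_itv `[xa, xb]) (measurable_itv `[ya, yb]).
have L (a c : R) : (@lebesgue_measure R [set` `[a, c]] < +oo)%E.
  by rewrite lebesgue_measure_itv/=; case: ifP; rewrite // -EFinB ltry.
suff : (dV (box xa xb ya yb) < +oo)%E by apply.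
rewrite BE; apply: lte_mul_pinfty; [exact: measure_ge0| |exact: L].
by rewrite ge0_fin_numE; [exact: L|exact: measure_ge0].
Qed.

Lemma box_integrable h xa xb ya yb (K : R) :
  measurable_fun (box xa xb ya yb) h ->
  (forall q, box xa xb ya yb q -> `|h q| <= K) ->
  dV.-integrable (box xa xb ya yb) (EFin \o h).
Proof.
move=> mh hK; apply: measurable_bounded_integrable => //.
- exact: measurable_box.
- exact: area_box_fin.
- exists K; split => //; first exact: num_real.
  by move=> K' KK' q Bq; exact: le_trans (hK q Bq) (ltW KK').
Qed.

(** The integral of a derivative, whose primitive takes the same value at both ends of
    each vertical segment. *)
Lemma box_integral_y0 h xa xb ya yb (K : R) : ya < yb ->
  measurable_fun (box xa xb ya yb) h ->
  (forall q, box xa xb ya yb q -> `|h q| <= K) ->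
  (forall x, xa <= x <= xb -> exists2 F : R -> R, F ya = F yb &
     forall y, ya <= y <= yb -> is_derive y 1 F (h (x, y)) /\
       {for y, continuous (fun y => h (x, y))}) ->
  (\int[dV]_(q in box xa xb ya yb) (h q)%:E = 0)%E.
Proof.
move=> ab mh hK hF; have mB := measurable_box xa xb ya yb.
have ih := box_integrable mh hK.
have ih' : dV.-integrable setT ((EFin \o h) \_ (box xa xb ya yb)).
  exact/(integrable_mkcond _ mB).
rewrite integral_mkcond.
have /esym := @integral12_prod_meas1 _ _ _ _ R mu mu _ ih'.
rewrite -[X in X = _ -> _]/(\int[dV]_q ((EFin \o h) \_ (box xa xb ya yb)) q)%E => ->.
apply: integral0_eq => x _; rewrite /fubini_F.
have [xI|xI] := boolP (xa <= x <= xb); last first.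
  apply: integral0_eq => y _; rewrite /patch ifF//; apply/negbTE/negP; rewrite inE.
  by move=> /boxP[/= xI']; rewrite xI' in xI.
have [F Fab dF] := hF x xI.
rewrite (_ : (\int[mu]_y _) = \int[mu]_(y in [set` `[ya, yb]]) (h (x, y))%:E)%E.
  have -> := @integral_antiderivative R (fun y => h (x, y)) F ya yb ab
    (fun y yI => (dF y yI).2) (fun y yI => (dF y yI).1).
  by rewrite Fab subrr.
rewrite [RHS]integral_mkcond; apply: eq_integral => y _; rewrite /patch.
have -> : ((x, y) \in box xa xb ya yb) = (y \in [set` `[ya, yb]]).
  apply/idP/idP; rewrite !inE; first by move=> /boxP[]; rewrite /= in_itv.
  by rewrite /= in_itv/= => yJ; apply/boxP.
by [].
Qed.

Lemma box_integral_x0 h xa xb ya yb (K : R) : xa < xb ->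
  measurable_fun (box xa xb ya yb) h ->
  (forall q, box xa xb ya yb q -> `|h q| <= K) ->
  (forall y, ya <= y <= yb -> exists2 F : R -> R, F xa = F xb &
     forall x, xa <= x <= xb -> is_derive x 1 F (h (x, y)) /\
       {for x, continuous (fun x => h (x, y))}) ->
  (\int[dV]_(q in box xa xb ya yb) (h q)%:E = 0)%E.
Proof.
move=> ab mh hK hF; have mB := measurable_box xa xb ya yb.
have ih := box_integrable mh hK.
have ih' : dV.-integrable setT ((EFin \o h) \_ (box xa xb ya yb)).
  exact/(integrable_mkcond _ mB).
rewrite integral_mkcond.
have /esym := @integral21_prod_meas1 _ _ _ _ R mu mu _ ih'.
rewrite -[X in X = _ -> _]/(\int[dV]_q ((EFin \o h) \_ (box xa xb ya yb)) q)%E => ->.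
apply: integral0_eq => y _; rewrite /fubini_G.
have [yI|yI] := boolP (ya <= y <= yb); last first.
  apply: integral0_eq => x _; rewrite /patch ifF//; apply/negbTE/negP; rewrite inE.
  by move=> /boxP[/= _ yI']; rewrite yI' in yI.
have [F Fab dF] := hF y yI.
rewrite (_ : (\int[mu]_x _) = \int[mu]_(x in [set` `[xa, xb]]) (h (x, y))%:E)%E.
  have -> := @integral_antiderivative R (fun x => h (x, y)) F xa xb ab
    (fun x xI => (dF x xI).2) (fun x xI => (dF x xI).1).
  by rewrite Fab subrr.
rewrite [RHS]integral_mkcond; apply: eq_integral => x _; rewrite /patch.
have -> : ((x, y) \in box xa xb ya yb) = (x \in [set` `[xa, xb]]).
  apply/idP/idP; rewrite !inE; first by move=> /boxP[]; rewrite /= in_itv.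
  by rewrite /= in_itv/= => xJ; apply/boxP.
by [].
Qed.

End BoxIntegrals.

(** * Integration by parts in the half-plane *)

Section Lines.
Context {R : realType}.
Implicit Types (f : R[i] -> R[i]) (x y t : R).

(** The Cauchy-Riemann equations, in this lemma and the next one. *)
Lemma line_dx f x y : holomorphic f -> 0 < y ->
  is_derive x 1 (fun s => complex.Re (f (s +i* y))) (complex.Re (cderiv f (x +i* y))) /\
  is_derive x 1 (fun s => complex.Im (f (s +i* y))) (complex.Im (cderiv f (x +i* y))).
Proof.
move=> hf y0; have E s : s +i* y = 0 +i* y + s%:C * 1 by simpc.
have d := holomorphic_cder hf (y0 : halfplane (x +i* y)).
split.
  have := @is_derive_line _ f (0 +i* y) 1 _ x; rewrite -E => /(_ _ d).
  by rewrite mulr1; under eq_fun do rewrite -E.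
have := @is_derive_line _ (fun w => - 'i%C * f w) (0 +i* y) 1 _ x.
rewrite -E => /(_ _ (cder_scale _ d)); rewrite mulr1.
under eq_fun do rewrite -E cReM /= oppr0 mul0r sub0r mulN1r opprK.
by rewrite cReM /= oppr0 mul0r sub0r mulN1r opprK.
Qed.

Lemma line_dy f x y : holomorphic f -> 0 < y ->
  is_derive y 1 (fun s => complex.Re (f (x +i* s))) (- complex.Im (cderiv f (x +i* y))) /\
  is_derive y 1 (fun s => complex.Im (f (x +i* s))) (complex.Re (cderiv f (x +i* y))).
Proof.
move=> hf y0; have E s : x +i* s = x%:C + s%:C * 'i%C by simpc.
have d := holomorphic_cder hf (y0 : halfplane (x +i* y)).
split.
  have := @is_derive_line _ f x%:C 'i%C _ y; rewrite -E => /(_ _ d).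
  rewrite cReM /= mulr0 mulr1 sub0r.
  by under eq_fun do rewrite -E.
have := @is_derive_line _ (fun w => - 'i%C * f w) x%:C 'i%C _ y.
rewrite -E => /(_ _ (cder_scale _ d)).
under eq_fun do rewrite -E cReM /= oppr0 mul0r sub0r mulN1r opprK.
by rewrite mulrAC mulNr -expr2 (_ : - 'i%C ^+ 2 = 1 :> R[i]) ?mul1r//; rewrite expr2; simpc.
Qed.

Lemma derive_continuous (F : R -> R) t d : is_derive t 1 F d -> {for t, continuous F}.
Proof. by case=> h _; exact/differentiable_continuous/derivable1_diffP. Qed.

Lemma continuous_mul (F G : R -> R) t : {for t, continuous F} -> {for t, continuous G} ->
  {for t, continuous (fun s => F s * G s)}.
Proof. by move=> cF cG; apply: cvgM. Qed.

Lemma continuous_add (F G : R -> R) t : {for t, continuous F} -> {for t, continuous G} ->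
  {for t, continuous (fun s => F s + G s)}.
Proof. by move=> cF cG; apply: cvgD. Qed.

Lemma continuous_const (k t : R) : {for t, continuous (fun=> k)}.
Proof. exact: cvg_cst. Qed.

Lemma continuous_opp (F : R -> R) t : {for t, continuous F} ->
  {for t, continuous (fun s => - F s)}.
Proof. by move=> cF; apply: cvgN. Qed.

(** The shape shared by the two cut-off fields of the integration by parts; stating the
    product rule once keeps the eight real functions involved opaque. *)
Lemma derive_bilinear (k t dw dp1 dq1 dp2 dq2 : R) (w p1 q1 p2 q2 : R -> R) :
  is_derive t 1 w dw -> is_derive t 1 p1 dp1 -> is_derive t 1 q1 dq1 ->
  is_derive t 1 p2 dp2 -> is_derive t 1 q2 dq2 ->
  is_derive t 1 (fun s => k * (w s * (p1 s * q1 s + p2 s * q2 s)))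
    (k * (dw * (p1 t * q1 t + p2 t * q2 t) +
          w t * (dp1 * q1 t + p1 t * dq1 + (dp2 * q2 t + p2 t * dq2)))).
Proof.
move=> hw h1 h2 h3 h4.
have d1 := is_deriveD (is_deriveM h1 h2) (is_deriveM h3 h4).
have d2 := is_deriveM (is_derive_cst k t 1) (is_deriveM hw d1).
apply: (is_derive_eq d2); rewrite /GRing.scale/= /cst.
have -> : (p1 * q1 + p2 * q2) t = p1 t * q1 t + p2 t * q2 t by [].
by rewrite mulr0; ring.
Qed.

Lemma continuous_bilinear (k t : R) (w dw p1 q1 p2 q2 dp1 dq1 dp2 dq2 : R -> R) :
  {for t, continuous w} -> {for t, continuous dw} ->
  {for t, continuous p1} -> {for t, continuous q1} ->
  {for t, continuous p2} -> {for t, continuous q2} ->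
  {for t, continuous dp1} -> {for t, continuous dq1} ->
  {for t, continuous dp2} -> {for t, continuous dq2} ->
  {for t, continuous (fun s => k * (dw s * (p1 s * q1 s + p2 s * q2 s) +
    w s * (dp1 s * q1 s + p1 s * dq1 s + (dp2 s * q2 s + p2 s * dq2 s))))}.
Proof.
move=> hw hdw hp1 hq1 hp2 hq2 hdp1 hdq1 hdp2 hdq2.
have A := continuous_add (continuous_mul hp1 hq1) (continuous_mul hp2 hq2).
have B1 := continuous_add (continuous_mul hdp1 hq1) (continuous_mul hp1 hdq1).
have B2 := continuous_add (continuous_mul hdp2 hq2) (continuous_mul hp2 hdq2).
exact: (continuous_mul (@continuous_const k t) (continuous_add (continuous_mul hdw A) (continuous_mul hw (continuous_add B1 B2)))).
Qed.

Lemma inv_shift_cvg : (n.+2%:R^-1 : R) @[n --> \oo] --> (0 : R).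
Proof. by have := @cvg_harmonic R; rewrite -(cvg_shiftS (@harmonic R)). Qed.

Lemma box_exhausts (x y : R) : 0 < y ->
  \forall n \near \oo, @box R (- n.+2%:R^-1^-1) n.+2%:R^-1^-1 n.+2%:R^-1 n.+2%:R^-1^-1 (x, y).
Proof.
move=> y0; near=> n.
have L (r : R) : r <= n%:R -> r <= n.+2%:R by move=> h; rewrite (le_trans h)// ler_nat -addn2 leq_addr.
apply/boxP; rewrite invrK -ler_norml/=; split.
  by apply: L; near: n; exact: nbhs_infty_ger.
apply/andP; split; last by apply: L; near: n; exact: nbhs_infty_ger.
by rewrite invf_ple ?posrE//; apply: L; near: n; exact: nbhs_infty_ger.
Unshelve. all: by end_near.
Qed.

End Lines.

Section BoundedOnBox.
Context {R : realType}.
Variables (B : set (measurableTypeR R * measurableTypeR R)).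
Implicit Types F G : measurableTypeR R * measurableTypeR R -> R.

Definition bounded_meas F := measurable_fun B F /\
  exists K : R, forall q, B q -> `|F q| <= K.

Lemma bounded_measM F G : bounded_meas F -> bounded_meas G ->
  bounded_meas (fun q => F q * G q).
Proof.
move=> [mF [K FK]] [mG [L GL]]; split; first exact: measurable_funM.
exists (K * L) => q Bq; rewrite normrM.
by apply: ler_pM; rewrite ?normr_ge0// ?FK// GL.
Qed.

Lemma bounded_measD F G : bounded_meas F -> bounded_meas G ->
  bounded_meas (fun q => F q + G q).
Proof.
move=> [mF [K FK]] [mG [L GL]]; split; first exact: measurable_funD.
exists (K + L) => q Bq; rewrite (le_trans (ler_normD _ _))//.
by apply: lerD; [exact: FK|exact: GL].
Qed.

Lemma bounded_measN F : bounded_meas F -> bounded_meas (fun q => - F q).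
Proof.
move=> [mF [K FK]]; split; first exact: measurableT_comp.
by exists K => q Bq; rewrite normrN FK.
Qed.

Lemma bounded_meas_cst (k : R) : bounded_meas (fun=> k).
Proof. by split; [exact: measurable_cst|exists `|k|]. Qed.

Lemma bounded_meas_bilinear (k w dw p1 q1 p2 q2 dp1 dq1 dp2 dq2 : measurableTypeR R * measurableTypeR R -> R) :
  bounded_meas k -> bounded_meas w -> bounded_meas dw ->
  bounded_meas p1 -> bounded_meas q1 -> bounded_meas p2 -> bounded_meas q2 ->
  bounded_meas dp1 -> bounded_meas dq1 -> bounded_meas dp2 -> bounded_meas dq2 ->
  bounded_meas (fun s => k s * (dw s * (p1 s * q1 s + p2 s * q2 s) +
    w s * (dp1 s * q1 s + p1 s * dq1 s + (dp2 s * q2 s + p2 s * dq2 s)))).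
Proof.
move=> hk hw hdw hp1 hq1 hp2 hq2 hdp1 hdq1 hdp2 hdq2.
have A := bounded_measD (bounded_measM hp1 hq1) (bounded_measM hp2 hq2).
have B1 := bounded_measD (bounded_measM hdp1 hq1) (bounded_measM hp1 hdq1).
have B2 := bounded_measD (bounded_measM hdp2 hq2) (bounded_measM hp2 hdq2).
exact: (bounded_measM hk (bounded_measD (bounded_measM hdw A) (bounded_measM hw (bounded_measD B1 B2)))).
Qed.

End BoundedOnBox.

Section IntegrationByParts.
Context {R : realType}.
Implicit Types (b g f : R[i] -> R[i]) (t x y : R).
Local Notation box t := (@box R (- t^-1) t^-1 t t^-1).
Let mH := @measurable_halfplane2 R.

Lemma box_halfplane t q : 0 < t -> box t q -> halfplane2 q.
Proof. by move=> t0 /boxP[_ /andP[tq _]]; exact: lt_le_trans tq. Qed.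

Lemma bounded_meas_holomorphic f t : holomorphic f -> 0 < t -> t <= 1 ->
  bounded_meas (box t) (planar (fun w => complex.Re (f w))) /\
  bounded_meas (box t) (planar (fun w => complex.Im (f w))).
Proof.
move=> hf t0 t1; have [mr mi] := cmeas_holomorphic hf.
have i0 : 0 < t^-1 by rewrite invr_gt0.
have [|M HM] := @holomorphic_box_bounded R f 0 (t^-1 + t) t^-1 hf i0.
  by rewrite ltrDl.
have Hq q : box t q -> cabs (f (q.1 +i* q.2)) <= M.
  move=> /boxP[/andP[q1 q2] /andP[q3 q4]]; apply: HM; rewrite ?subr0 ler_norml.
    by rewrite q1.
  by apply/andP; split; lra.
have sub : box t `<=` halfplane2 by move=> q; exact: box_halfplane.
split; split; do ?[exact: measurable_funS mr|exact: measurable_funS mi].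
  by exists M => q /Hq; apply: le_trans; exact: Re_le_cabs.
by exists M => q /Hq; apply: le_trans; exact: Im_le_cabs.
Qed.

Lemma bounded_meas_fst t : 0 < t -> bounded_meas (box t) fst.
Proof.
move=> t0; split; first exact: measurable_funTS.
by exists t^-1 => q /boxP[+ _]; rewrite ler_norml.
Qed.

Lemma bounded_meas_snd t : 0 < t -> bounded_meas (box t) snd.
Proof.
move=> t0; split; first exact: measurable_funTS.
exists t^-1 => q /boxP[_ /andP[q1 q2]].
by rewrite ger0_norm// (le_trans _ q1)// ltW.
Qed.

(** Polynomial cut-offs: cutx t vanishes at both ends of [-1/t, 1/t] and cuty t at both
    ends of [t, 1/t]. As t tends to 0, cutx t x tends to 1, and cuty t y to y, the weight
    that the integration by parts has to produce. *)
Definition cutx t x := 1 - x * x * (t * t).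
Definition dcutx t x := - (2 * x * (t * t)).
Definition cuty t y := (y - t) * (1 - y * t).
Definition dcuty t y := 1 + t * t - 2 * y * t.

Lemma is_derive_cutx t x : is_derive x 1 (cutx t) (dcutx t x).
Proof.
have i := is_derive_id x 1 : is_derive x 1 (fun s : R => s) 1.
have d := is_deriveB (is_derive_cst (1:R^o) x 1)
  (is_deriveM (is_deriveM i i) (is_derive_cst (t * t : R^o) x 1)).
by apply: (is_derive_eq d); rewrite /dcutx /GRing.scale/= /cst; ring.
Qed.

Lemma is_derive_cuty t y : is_derive y 1 (cuty t) (dcuty t y).
Proof.
have i := is_derive_id y 1 : is_derive y 1 (fun s : R => s) 1.
have d := is_deriveM (is_deriveB i (is_derive_cst (t:R^o) y 1))
  (is_deriveB (is_derive_cst (1:R^o) y 1) (is_deriveM i (is_derive_cst (t:R^o) y 1))).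
by apply: (is_derive_eq d); rewrite /dcuty /GRing.scale/= !fctE /cst; ring.
Qed.

Lemma is_derive_dcutx t x : is_derive x 1 (dcutx t) (- (2 * (t * t))).
Proof.
have i := is_derive_id x 1 : is_derive x 1 (fun s : R => s) 1.
have d := is_deriveN (is_deriveM (is_deriveM (is_derive_cst (2:R^o) x 1) i)
  (is_derive_cst (t * t : R^o) x 1)).
by apply: (is_derive_eq d); rewrite /GRing.scale/= /cst; ring.
Qed.

Lemma is_derive_dcuty t y : is_derive y 1 (dcuty t) (- (2 * t)).
Proof.
have i := is_derive_id y 1 : is_derive y 1 (fun s : R => s) 1.
have d := is_deriveB (is_derive_cst (1 + t * t : R^o) y 1)
  (is_deriveM (is_deriveM (is_derive_cst (2:R^o) y 1) i) (is_derive_cst (t:R^o) y 1)).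
by apply: (is_derive_eq d); rewrite /GRing.scale/= /cst; ring.
Qed.

Lemma bounded_meas_cutx t : 0 < t -> bounded_meas (box t) (fun q => cutx t q.1).
Proof.
move=> t0.
have f := bounded_meas_fst t0; have c := bounded_meas_cst (box t).
exact: (bounded_measD (c 1) (bounded_measN (bounded_measM (bounded_measM f f) (c (t * t))))).
Qed.

Lemma bounded_meas_dcutx t : 0 < t -> bounded_meas (box t) (fun q => dcutx t q.1).
Proof.
move=> t0.
have f := bounded_meas_fst t0; have c := bounded_meas_cst (box t).
exact: (bounded_measN (bounded_measM (bounded_measM (c 2) f) (c (t * t)))).
Qed.

Lemma bounded_meas_cuty t : 0 < t -> bounded_meas (box t) (fun q => cuty t q.2).
Proof.
move=> t0.
have f := bounded_meas_snd t0; have c := bounded_meas_cst (box t).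
exact: (bounded_measM (bounded_measD f (bounded_measN (c t)))
  (bounded_measD (c 1) (bounded_measN (bounded_measM f (c t))))).
Qed.

Lemma bounded_meas_dcuty t : 0 < t -> bounded_meas (box t) (fun q => dcuty t q.2).
Proof.
move=> t0.
have f := bounded_meas_snd t0; have c := bounded_meas_cst (box t).
exact: (bounded_measD (c (1 + t * t)) (bounded_measN (bounded_measM (bounded_measM (c 2) f) (c t)))).
Qed.

(** Uniform bounds in t, for dominated convergence. For the last one, the derivative of
    cutx is O(t) while y t <= 1. *)
Lemma cutoff_bounds t x y : 0 < t -> t < 1 -> - t^-1 <= x <= t^-1 -> t <= y <= t^-1 ->
  [/\ 0 <= cutx t x <= 1, `|dcuty t y| <= 1, 0 <= cuty t y <= y &
      `|cuty t y * dcutx t x| <= 2].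
Proof.
move=> t0 t1 /andP[x1 x2] /andP[y1 y2].
have y0 : 0 < y := lt_le_trans t0 y1.
have yt : y * t <= 1 by rewrite -ler_pdivlMr// div1r.
have ytt : t * t <= y * t by rewrite ler_pM2r.
have xt : x * t <= 1 by rewrite -ler_pdivlMr// div1r.
have xt' : - 1 <= x * t by rewrite lerNl -mulNr -ler_pdivlMr// div1r lerNl.
have cy : 0 <= cuty t y <= y.
  rewrite /cuty mulr_ge0 ?subr_ge0//=.
  apply: (le_trans (_ : _ <= y * 1)); last by rewrite mulr1.
  by apply: ler_pM; rewrite ?subr_ge0 ?gerBl ?(ltW t0)// mulr_ge0// ltW.
split=> //.
- rewrite /cutx (_ : x * x * (t * t) = (x * t) ^+ 2); last by ring.
  by apply/andP; split; nra.
- by rewrite /dcuty ler_norml; apply/andP; split; nra.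
- rewrite /dcutx (_ : _ * _ = - (2 * (cuty t y * t) * (x * t))); last by ring.
  have /andP[c0 c1] := cy.
  have h1 : 0 <= cuty t y * t <= 1.
    rewrite mulr_ge0 ?(ltW t0)//=; by apply: le_trans yt; rewrite ler_wpM2r// ltW.
  have /andP[h2 h3] := h1.
  by rewrite ler_norml; apply/andP; split; nra.
Qed.

Lemma mul_conj_parts_le (p q : R[i]) :
  [/\ `|complex.Re p * complex.Re q + complex.Im p * complex.Im q| <= cabs p * cabs q &
      `|complex.Im p * complex.Re q - complex.Re p * complex.Im q| <= cabs p * cabs q].
Proof.
have E : cabs p * cabs q = cabs (p * q^*%C) by rewrite cabsM cabs_conj.
split.
  apply: le_trans (_ : `|complex.Re (p * q^*%C)| <= _); last by rewrite E; exact: Re_le_cabs.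
  by case: p {E} => ? ?; case: q => ? ? /=; rewrite mulrN opprK.
apply: le_trans (_ : `|complex.Im (p * q^*%C)| <= _); last by rewrite E; exact: Im_le_cabs.
by case: p {E} => ? ?; case: q => ? ? /=; rewrite mulrN addrC.
Qed.

Section Pair.
Variables b g : R[i] -> R[i].
Hypotheses (hb : holomorphic b) (hg : holomorphic g)
  (hb' : holomorphic (cderiv b)) (hg' : holomorphic (cderiv g)).

Let br w := complex.Re (b w). Let bi w := complex.Im (b w).
Let gr w := complex.Re (g w). Let gi w := complex.Im (g w).
Let br' w := complex.Re (cderiv b w). Let bi' w := complex.Im (cderiv b w).
Let gr' w := complex.Re (cderiv g w). Let gi' w := complex.Im (cderiv g w).

(* With A = b conj(g), alpha = cutx t and gamma = cuty t: Yd is the derivative of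
   alpha gamma Re A in y, and Xd that of alpha gamma Im A in x, both expressed by
   complex derivatives through the Cauchy-Riemann equations. *)
Let Yd t w : R := cutx t (complex.Re w) * (dcuty t (complex.Im w) * (br w * gr w + bi w * gi w) +
  cuty t (complex.Im w) * (- bi' w * gr w + br w * - gi' w + (br' w * gi w + bi w * gr' w))).
Let Xd t w : R := cuty t (complex.Im w) * (dcutx t (complex.Re w) * (bi w * gr w + - br w * gi w) +
  cutx t (complex.Re w) * (bi' w * gr w + bi w * gr' w + (- br' w * gi w + - br w * gi' w))).

Lemma integral_Yd t : 0 < t -> t < 1 ->
  bounded_meas (box t) (planar (Yd t)) /\
  (\int[dV]_(q in box t) (planar (Yd t) q)%:E = 0)%E.
Proof.
move=> t0 t1; have t1' := ltW t1.
have ti : t < t^-1 by rewrite (lt_trans t1)// invf_gt1.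
have [b1 b2] := bounded_meas_holomorphic hb t0 t1'.
have [g1 g2] := bounded_meas_holomorphic hg t0 t1'.
have [b3 b4] := bounded_meas_holomorphic hb' t0 t1'.
have [g3 g4] := bounded_meas_holomorphic hg' t0 t1'.
have bm : bounded_meas (box t) (planar (Yd t)).
  exact: (bounded_meas_bilinear (bounded_meas_cutx t0) (bounded_meas_cuty t0)
    (bounded_meas_dcuty t0) b1 g1 b2 g2 (bounded_measN b4) (bounded_measN g4) b3 g3).
split=> //; have [mh [K HK]] := bm.
apply: (box_integral_y0 ti mh HK) => x _.
exists (fun y => cutx t x * (cuty t y * (br (x +i* y) * gr (x +i* y) + bi (x +i* y) * gi (x +i* y)))).
  by rewrite /cuty subrr mul0r mulVf ?gt_eqF// subrr mulr0 !mul0r.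
move=> y /andP[ty _]; have y0 := lt_le_trans t0 ty.
have [db1 db2] := line_dy x hb y0; have [dg1 dg2] := line_dy x hg y0.
have [db3 db4] := line_dy x hb' y0; have [dg3 dg4] := line_dy x hg' y0.
split; first exact: (derive_bilinear _ (is_derive_cuty t y) db1 dg1 db2 dg2).
exact: (continuous_bilinear (k := cutx t x) (derive_continuous (is_derive_cuty t y))
  (derive_continuous (is_derive_dcuty t y))
  (derive_continuous db1) (derive_continuous dg1) (derive_continuous db2) (derive_continuous dg2)
  (continuous_opp (derive_continuous db4)) (continuous_opp (derive_continuous dg4))
  (derive_continuous db3) (derive_continuous dg3)).
Qed.

Lemma integral_Xd t : 0 < t -> t < 1 ->
  bounded_meas (box t) (planar (Xd t)) /\
  (\int[dV]_(q in box t) (planar (Xd t) q)%:E = 0)%E.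
Proof.
move=> t0 t1; have t1' := ltW t1.
have ti : - t^-1 < t^-1 by rewrite gtrN ?invr_gt0.
have [b1 b2] := bounded_meas_holomorphic hb t0 t1'.
have [g1 g2] := bounded_meas_holomorphic hg t0 t1'.
have [b3 b4] := bounded_meas_holomorphic hb' t0 t1'.
have [g3 g4] := bounded_meas_holomorphic hg' t0 t1'.
have bm : bounded_meas (box t) (planar (Xd t)).
  exact: (bounded_meas_bilinear (bounded_meas_cuty t0) (bounded_meas_cutx t0)
    (bounded_meas_dcutx t0) b2 g1 (bounded_measN b1) g2 b4 g3 (bounded_measN b3) g4).
split=> //; have [mh [K HK]] := bm.
apply: (box_integral_x0 ti mh HK) => y /andP[ty _]; have y0 := lt_le_trans t0 ty.
exists (fun x => cuty t y * (cutx t x * (bi (x +i* y) * gr (x +i* y) + - br (x +i* y) * gi (x +i* y)))).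
  have tt : t^-1 * t^-1 * (t * t) = 1 by field; rewrite gt_eqF.
  by rewrite /cutx mulrNN tt subrr !mul0r.
move=> x _.
have [db1 db2] := line_dx x hb y0; have [dg1 dg2] := line_dx x hg y0.
have [db3 db4] := line_dx x hb' y0; have [dg3 dg4] := line_dx x hg' y0.
split; first exact: (derive_bilinear _ (is_derive_cutx t x) db2 dg1 (is_deriveN db1) dg2).
exact: (continuous_bilinear (k := cuty t y) (derive_continuous (is_derive_cutx t x))
  (derive_continuous (is_derive_dcutx t x))
  (derive_continuous db2) (derive_continuous dg1) (continuous_opp (derive_continuous db1)) (derive_continuous dg2)
  (derive_continuous db4) (derive_continuous dg3)
  (continuous_opp (derive_continuous db3)) (derive_continuous dg4)).
Qed.

Let a1 w := br w * gr w + bi w * gi w.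
Let d1 w := bi' w * gr w - br' w * gi w.
Let a2 w := bi w * gr w - br w * gi w.

Let V t w : R := cutx t (complex.Re w) * dcuty t (complex.Im w) * a1 w
  - 2 * (cutx t (complex.Re w) * cuty t (complex.Im w)) * d1 w
  - cuty t (complex.Im w) * dcutx t (complex.Re w) * a2 w.

Lemma integral_cutoff t : 0 < t -> t < 1 ->
  measurable_fun (box t) (planar (V t)) /\
  (\int[dV]_(q in halfplane2) (((EFin \o planar (V t)) \_ (box t)) q) = 0)%E.
Proof.
move=> t0 t1; have mB := measurable_box (- t^-1) t^-1 t t^-1.
have [[mY [K1 HY]] IY] := integral_Yd t0 t1.
have [[mX [K2 HX]] IX] := integral_Xd t0 t1.
have VE q : planar (V t) q = planar (Yd t) q - planar (Xd t) q.
  have H (k w dk dw p1 p2 q1 q2 r1 r2 s1 s2 : R) :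
    k * dw * (p1 * q1 + p2 * q2) - 2 * (k * w) * (r2 * q1 - r1 * q2) - w * dk * (p2 * q1 - p1 * q2) =
    k * (dw * (p1 * q1 + p2 * q2) + w * (- r2 * q1 + p1 * - s2 + (r1 * q2 + p2 * s1))) -
    w * (dk * (p2 * q1 + - p1 * q2) + k * (r2 * q1 + p2 * s1 + (- r1 * q2 + - p1 * s2))).
    by ring.
  exact: H.
split.
  by rewrite (_ : planar (V t) = fun q => planar (Yd t) q - planar (Xd t) q);
    [exact: measurable_funB|apply/funext].
have HB : halfplane2 `&` box t = box t.
  by apply/setIidPr => q; exact: box_halfplane.
rewrite -integral_mkcondr HB.
have iY := box_integrable mY HY; have iX := box_integrable mX HX.
have := integralB mB iY iX; rewrite [X in _ = (X - _)%E]IY [X in _ = (_ - X)%E]IX sube0 => <-.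
by apply: eq_integral => q _ /=; rewrite VE EFinB.
Qed.

Lemma cutoff_bound t (w : R[i]) : 0 < t -> t < 1 -> box t (complex.Re w, complex.Im w) ->
  `|V t w| <= 3 * (cabs (b w) * cabs (g w)) +
     2 * (complex.Im w * (cabs (cderiv b w) * cabs (g w))).
Proof.
move=> t0 t1 /boxP[/= xI yI].
have [cx dy cy dx] := cutoff_bounds t0 t1 xI yI.
have [h1 h2] := mul_conj_parts_le (b w) (g w); have [_ h3] := mul_conj_parts_le (cderiv b w) (g w).
have /andP[cx0 cx1] := cx; have /andP[cy0 cy1] := cy.
have B0 := mulr_ge0 (cabs_ge0 (b w)) (cabs_ge0 (g w)).
rewrite /V; apply: le_trans (ler_normB _ _) _.
apply: (le_trans (lerD (ler_normB _ _) (lexx _))).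
rewrite [leRHS](_ : _ = cabs (b w) * cabs (g w) + 2 * (complex.Im w * (cabs (cderiv b w) * cabs (g w)))
  + 2 * (cabs (b w) * cabs (g w))); last by ring.
apply: lerD; first apply: lerD.
- rewrite normrM -[leRHS]mul1r; apply: ler_pM => //.
  by rewrite normrM -[leRHS]mulr1; apply: ler_pM => //; rewrite ger0_norm.
- rewrite normrM [leRHS]mulrA; apply: ler_pM => //.
  rewrite normrM (@ger0_norm _ 2)//; apply: ler_wpM2l => //.
  by apply: le_trans cy1; rewrite ger0_norm; [exact: ler_piMl|exact: mulr_ge0].
- by rewrite normrM; apply: ler_pM.
Qed.

(** Put A = b conj(g), with cut-offs alpha in x and gamma in y. The integral of
    d/dy (alpha gamma Re A) - d/dx (alpha gamma Im A) over a box is zero. By the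
    Cauchy-Riemann equations the terms with g' cancel, and what is left is
    alpha gamma' Re A - 2 alpha gamma Im (b' conj(g)) - alpha' gamma Im A. As the box
    fills the half-plane, gamma' tends to 1, gamma to y and alpha' gamma to 0. *)
Lemma integral_by_parts :
  (aint (fun w => (cabs (b w) * cabs (g w))%R) < +oo)%E ->
  (aint (fun w => (complex.Im w * (cabs (cderiv b w) * cabs (g w)))%R) < +oo)%E ->
  (\int[dV]_(q in halfplane2) (planar (fun w => (a1 w - 2 * (complex.Im w * d1 w))%R) q)%:E = 0)%E.
Proof.
move=> i1 i2.
have mbc := measurable_cabs (cmeas_holomorphic hb).
have mgc := measurable_cabs (cmeas_holomorphic hg).
have mbc' := measurable_cabs (cmeas_holomorphic hb').
have [mb1 mb2] := cmeas_holomorphic hb; have [mg1 mg2] := cmeas_holomorphic hg.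
have [mc1 mc2] := cmeas_holomorphic hb'.
pose B w := 3 * (cabs (b w) * cabs (g w)) + 2 * (complex.Im w * (cabs (cderiv b w) * cabs (g w))).
have mB1 : hmeas (fun w => cabs (b w) * cabs (g w)) by exact: hmeasM.
have mB2 : hmeas (fun w => complex.Im w * (cabs (cderiv b w) * cabs (g w))).
  by apply: hmeasM; [exact: hmeas_Im|exact: hmeasM].
have iB : dV.-integrable halfplane2 (EFin \o planar B).
  apply/hintegrableP; split; first by apply: hmeasD; apply: hmeasZ.
  have B1 w : halfplane w -> 0 <= cabs (b w) * cabs (g w) by rewrite mulr_ge0 ?cabs_ge0.
  have B2 w : halfplane w -> 0 <= complex.Im w * (cabs (cderiv b w) * cabs (g w)).
    by move=> w0; rewrite mulr_ge0 ?(ltW w0)// mulr_ge0 ?cabs_ge0.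
  rewrite (@eq_aint _ _ B); last first.
    by move=> w w0; rewrite ger0_norm// addr_ge0// mulr_ge0// ?B1// B2.
  rewrite aintD; [|exact: hmeasZ|exact: hmeasZ| |].
  - by rewrite !aintZ// lte_add_pinfty// lte_mul_pinfty.
  - by move=> w w0; rewrite mulr_ge0// B1.
  - by move=> w w0; rewrite mulr_ge0// B2.
pose T (n : nat) : R := n.+2%:R^-1.
have T0 n : 0 < T n by rewrite invr_gt0.
have T1 n : T n < 1 by rewrite invf_lt1// ltr1n.
pose U w := a1 w - 2 * (complex.Im w * d1 w).
have mU : hmeas U.
  have ma : hmeas a1 by apply: hmeasD; exact: hmeasM.
  have md : hmeas d1 by apply: measurable_funB; exact: hmeasM.
  exact: (measurable_funB ma (hmeasZ 2 (hmeasM hmeas_Im md))).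
have [|||||_ _] := @dominated_convergence _ _ R dV halfplane2 mH
  (fun n => (EFin \o planar (V (T n))) \_ (box (T n))) (EFin \o planar U) (EFin \o planar B).
- move=> n; apply/measurable_restrict => //; first exact: measurable_box.
  have [mV _] := integral_cutoff (T0 n) (T1 n).
  by apply/measurable_EFinP; apply: measurable_funS mV => //; exact: measurable_box.
- exact/measurable_EFinP.
- apply: aeW => q q0; set x : R := q.1; set y : R := q.2.
  have cT := @inv_shift_cvg R.
  have ci : {for (0:R), continuous (fun t : R => t)} by exact: cvg_id.
  have cc k := @continuous_const R k 0.
  have c1 := continuous_add (cc 1) (continuous_opp (continuous_mul (cc (x * x)) (continuous_mul ci ci))).
  have c2 := continuous_add (continuous_add (cc 1) (continuous_mul ci ci))
    (continuous_opp (continuous_mul (cc (2 * y)) ci)).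
  have c3 := continuous_mul (continuous_add (cc y) (continuous_opp ci))
    (continuous_add (cc 1) (continuous_opp (continuous_mul (cc y) ci))).
  have c4 := continuous_opp (continuous_mul (cc (2 * x)) (continuous_mul ci ci)).
  have c := continuous_add (continuous_add
     (continuous_mul (continuous_mul c1 c2) (cc (a1 (x +i* y))))
     (continuous_opp (continuous_mul (continuous_mul (cc 2) (continuous_mul c1 c3)) (cc (d1 (x +i* y))))))
     (continuous_opp (continuous_mul (continuous_mul c3 c4) (cc (a2 (x +i* y))))).
  have cV : {for 0, continuous (fun t => V t (x +i* y))} := c.
  have UE : U (x +i* y) = V 0 (x +i* y).
    by rewrite /U /V /cutx /dcuty /cuty /dcutx /=; ring.
  have lV := cvg_comp _ _ cT cV.
  apply: cvg_trans (_ : (V (T n) (x +i* y))%:E @[n --> \oo] --> _); last first.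
    have -> : (EFin \o planar U) q = (V 0 (x +i* y))%:E by rewrite -UE.
    by apply: cvg_EFin; [exact: nearW|exact: lV].
  apply: near_eq_cvg; apply: filterS (box_exhausts x (q0 : 0 < y)) => n Bn.
  by rewrite /patch ifT// inE; rewrite /x /y in Bn; case: (q) Bn.
- exact: iB.
- apply: aeW => q n q0; rewrite /patch; case: ifP => [|_]; last first.
    rewrite -[X in (`|X| <= _)%E]/(0%E) abse0 lee_fin /planar /B /= addr_ge0//.
      by rewrite mulr_ge0// mulr_ge0 ?cabs_ge0.
    by rewrite mulr_ge0// mulr_ge0 ?(ltW q0)// mulr_ge0 ?cabs_ge0.
  rewrite inE => qB; rewrite /= lee_fin.
  exact: (@cutoff_bound (T n) (q.1 +i* q.2) (T0 n) (T1 n)).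
rewrite (_ : (fun _ => _) = fun=> 0%E); last first.
  by apply/funext => n; have [_ ->] := integral_cutoff (T0 n) (T1 n).
by move=> /(cvg_unique _ (cvg_cst _)) <-.
Qed.

Lemma pairing_Re_le :
  (aint (fun w => (cabs (b w) * cabs (g w))%R) < +oo)%E ->
  (aint (fun w => (complex.Im w * (cabs (cderiv b w) * cabs (g w)))%R) < +oo)%E ->
  (`|Rintegral dV halfplane2 (planar (fun w => complex.Re (b w * (g w)^*%C)))|%:E <=
   2%:E * aint (fun w => (complex.Im w * (cabs (cderiv b w) * cabs (g w)))%R))%E.
Proof.
move=> i1 i2; have := integral_by_parts i1 i2.
have [mb1 mb2] := cmeas_holomorphic hb; have [mg1 mg2] := cmeas_holomorphic hg.
have [mc1 mc2] := cmeas_holomorphic hb'.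
have mbc := measurable_cabs (cmeas_holomorphic hb).
have mgc := measurable_cabs (cmeas_holomorphic hg).
have mbc' := measurable_cabs (cmeas_holomorphic hb').
have ma : hmeas a1 by apply: hmeasD; exact: hmeasM.
have md : hmeas d1 by apply: measurable_funB; exact: hmeasM.
have md' := hmeasZ 2 (hmeasM hmeas_Im md).
pose D w := complex.Im w * (cabs (cderiv b w) * cabs (g w)).
have mD : hmeas D := hmeasM hmeas_Im (hmeasM mbc' mgc).
have D0 w : halfplane w -> 0 <= D w.
  by move=> w0; rewrite /D mulr_ge0 ?(ltW w0)// mulr_ge0 ?cabs_ge0.
have dD w : halfplane w -> `|2 * (complex.Im w * d1 w)| <= 2 * D w.
  move=> w0; rewrite normrM (@ger0_norm _ 2)// ler_wpM2l// normrM ger0_norm ?(ltW w0)//.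
  by apply: ler_wpM2l; [exact: ltW|have [_ ?] := mul_conj_parts_le (cderiv b w) (g w)].
have ia : dV.-integrable halfplane2 (EFin \o planar a1).
  apply/hintegrableP; split=> //; apply: le_lt_trans i1; apply: aint_le.
  - exact: hmeas_norm.
  - exact: hmeasM.
  by move=> w _; rewrite normr_ge0; have [? _] := mul_conj_parts_le (b w) (g w).
have lD : (aint (fun w => `|(2 * (complex.Im w * d1 w))%R|%R) <= 2%:E * aint D)%E.
  rewrite -aintZ//; apply: aint_le; [exact: hmeas_norm|exact: hmeasZ|].
  by move=> w w0; rewrite normr_ge0 dD.
have id : dV.-integrable halfplane2 (EFin \o planar (fun w => 2 * (complex.Im w * d1 w))).
  apply/hintegrableP; split=> //; apply: (le_lt_trans lD).
  by rewrite lte_mul_pinfty.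
have := integralB mH ia id => IB.
have -> : (\int[dV]_(q in halfplane2)
     (planar (fun w => (a1 w - 2 * (complex.Im w * d1 w))%R) q)%:E =
   \int[dV]_(x in halfplane2) ((EFin \o planar a1) x -
     (EFin \o planar (fun w => (2 * (complex.Im w * d1 w))%R)) x))%E.
  by apply: eq_integral => q _ /=; rewrite -EFinB.
rewrite IB => /eqP.
have f1 := integrable_fin_num mH ia; have f2 := integrable_fin_num mH id.
rewrite sube_eq ?fin_num_adde_defl// add0e => /eqP E12.
have -> : Rintegral dV halfplane2 (planar (fun w => complex.Re (b w * (g w)^*%C))) =
    Rintegral dV halfplane2 (planar (fun w => 2 * (complex.Im w * d1 w))).
  rewrite [RHS]/Rintegral -[X in _ = fine X]E12 /Rintegral; congr fine.
  apply: eq_integral => q _; rewrite /planar /a1 /br /bi /gr /gi /=; congr EFin.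
  by case: (b _) => ? ?; case: (g _) => ? ? /=; rewrite mulrN opprK.
apply: le_trans lD; rewrite /Rintegral.
have := le_abse_integral dV mH (measurable_int _ id).
rewrite -[X in (`|X| <= _)%E](fineK f2) => /le_trans; apply.
by rewrite le_eqVlt; apply/orP; left; apply/eqP; apply: eq_integral.
Qed.

End Pair.

(** The substitute for the identity of the pairings of b with g and of -2 i Im(w) b'(w)
    with g: only the size of the right-hand side matters. The imaginary part
    is the real part for - i b. *)
Lemma pairing_le b g : holomorphic b -> holomorphic g ->
  holomorphic (cderiv b) -> holomorphic (cderiv g) ->
  (aint (fun w => (cabs (b w) * cabs (g w))%R) < +oo)%E ->
  (aint (fun w => (complex.Im w * (cabs (cderiv b w) * cabs (g w)))%R) < +oo)%E ->
  ((cabs (cintegral (fun w => b w * (g w)^*%C)))%:E <=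
   4%:E * aint (fun w => (complex.Im w * (cabs (cderiv b w) * cabs (g w)))%R))%E.
Proof.
move=> hb hg hb' hg' i1 i2.
have r1 := pairing_Re_le hb hg hb' hg' i1 i2.
pose c (w : R[i]) : R[i] := - 'i%C * b w.
have dc w : halfplane w -> cder c w (- 'i%C * cderiv b w).
  by move=> w0; apply: cder_scale; exact: holomorphic_cder.
have hc : holomorphic c by move=> w w0; exact: cder_derivable (dc w w0).
have cE w : halfplane w -> cderiv c w = - 'i%C * cderiv b w.
  by move=> w0; apply: cderivE; exact: dc.
have n1 (z : R[i]) : cabs (- 'i%C * z) = cabs z :> R.
  by rewrite cabsM cabsN [cabs 'i%C](_ : _ = 1) ?mul1r// /cabs /= expr0n expr1n add0r sqrtr1.
have hc' : holomorphic (cderiv c).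
  move=> w w0; apply: (cder_derivable (d := - 'i%C * cderiv (cderiv b) w)).
  apply: (cder_ext (f := fun w => - 'i%C * cderiv b w) w0) => [h hw|].
    by rewrite cE//; exact: halfplane_shift.
  by apply: cder_scale; exact: holomorphic_cder.
pose J := aint (fun w => (complex.Im w * (cabs (cderiv b w) * cabs (g w)))%R).
have ED : aint (fun w => (complex.Im w * (cabs (cderiv c w) * cabs (g w)))%R) = J.
  by apply: eq_aint => w w0; rewrite cE// n1.
have i1' : (aint (fun w => (cabs (c w) * cabs (g w))%R) < +oo)%E.
  have EB : aint (fun w => (cabs (c w) * cabs (g w))%R) = aint (fun w => (cabs (b w) * cabs (g w))%R).
    by apply: eq_aint => w w0; rewrite n1.
  by rewrite EB; exact: i1.
have i2' : (aint (fun w => (complex.Im w * (cabs (cderiv c w) * cabs (g w)))%R) < +oo)%E.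
  by rewrite ED; exact: i2.
have r2 := pairing_Re_le hc hg hc' hg' i1' i2'.
rewrite [X in (_ <= _ * X)%E]ED in r2.
apply: (@le_trans _ _ (`|Rintegral dV halfplane2 (planar (fun w => complex.Re (b w * (g w)^*%C)))|%:E
  + `|Rintegral dV halfplane2 (planar (fun w => complex.Re (c w * (g w)^*%C)))|%:E)%E).
  rewrite -EFinD lee_fin.
  have -> : Rintegral dV halfplane2 (planar (fun w => complex.Re (c w * (g w)^*%C))) =
    Rintegral dV halfplane2 (planar (fun w => complex.Im (b w * (g w)^*%C))).
    apply: eq_Rintegral => q _; rewrite /planar /c -mulrA cReM /=.
    by rewrite oppr0 mul0r sub0r mulN1r opprK.
  exact: cabs_le.
apply: (le_trans (leeD r1 r2)).
have -> : 4%:E = (2%:E + 2%:E)%E :> \bar R by rewrite -EFinD; congr EFin; ring.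
by rewrite ge0_muleDl.
Qed.

End IntegrationByParts.

(** * Tonelli for the kernel *)

Section SchurTest.
Context {R : realType}.
Implicit Types (z w : R[i]) (F G H u W : R[i] -> R).
Local Notation X := (measurableTypeR R * measurableTypeR R)%type.
Let mH := @measurable_halfplane2 R.

(** Restriction to the half-plane in both variables, so that Tonelli's theorem can be
    applied on the whole product space. *)
Definition pair_kernel u W : X * X -> R := fun t =>
  (planar u \_ (@halfplane2 R)) t.1 * (planar W \_ (@halfplane2 R)) t.2 *
  kdist (t.1.1 +i* t.1.2) (t.2.1 +i* t.2.2) `^ (- 2).

Lemma measurable_pair_kernel u W : hmeas u -> hmeas W ->
  measurable_fun setT (EFin \o pair_kernel u W).
Proof.
move=> mu mW; apply/measurable_EFinP; apply: measurable_funM; first apply: measurable_funM.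
- apply: (measurableT_comp (f := planar u \_ (@halfplane2 R))) => //.
  exact/(measurable_restrictT _ mH).
- apply: (measurableT_comp (f := planar W \_ (@halfplane2 R))) => //.
  exact/(measurable_restrictT _ mH).
apply: (measurableT_comp (@measurable_powR R (- 2))).
have E : (fun t : X * X => kdist (t.1.1 +i* t.1.2) (t.2.1 +i* t.2.2)) =
    (fun t : X * X => ((t.1.1 - t.2.1) ^+ 2 + (t.1.2 + t.2.2) ^+ 2) `^ 2^-1).
  by apply/funext => t; rewrite powR12_sqrt ?addr_ge0 ?sqr_ge0// /kdist /cabs /= opprK.
rewrite E; apply: (measurableT_comp (@measurable_powR R 2^-1)).
by apply: measurable_funD; apply: measurable_funX; [apply: measurable_funB|apply: measurable_funD];
  repeat apply: measurableT_comp => //.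
Qed.

Lemma pair_kernel_ge0 u W t : (forall w, halfplane w -> 0 <= u w) ->
  (forall w, halfplane w -> 0 <= W w) -> 0 <= pair_kernel u W t.
Proof.
move=> u0 W0; rewrite /pair_kernel mulr_ge0 ?powR_ge0// mulr_ge0 // /patch;
  case: ifP => //; rewrite inE => h; [exact: u0|exact: W0].
Qed.

Lemma pair_kernel_section u W q : hmeas u -> hmeas W ->
  (forall w, halfplane w -> 0 <= u w) -> (forall w, halfplane w -> 0 <= W w) ->
  (\int[dV]_t (pair_kernel u W (q, t))%:E =
    ((fun q => (planar u q)%:E * aint (fun w => W w * kdist (q.1 +i* q.2) w `^ (- 2))%R)
      \_ (@halfplane2 R)) q)%E.
Proof.
move=> mu mW u0 W0; rewrite /patch; case: ifPn => qH; last first.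
  by apply: integral0_eq => t _; rewrite /pair_kernel /patch /= (negbTE qH) !mul0r.
move: qH; rewrite inE => qH.
rewrite /aint -ge0_integralZl//; last 3 first.
- apply/measurable_EFinP.
  apply: hmeasM => //; apply: hmeas_powR; exact: hmeas_kdist.
- by move=> t t0; rewrite lee_fin mulr_ge0 ?powR_ge0// W0.
- by rewrite lee_fin; exact: u0.
rewrite [RHS]integral_mkcond; apply: eq_integral => t _.
rewrite /pair_kernel /patch /= mem_set//; case: ifP => _.
  by rewrite -EFinM /planar mulrA.
by rewrite mulr0 mul0r.
Qed.

Lemma area_sigma_finite : sigma_finite setT (@dV R).
Proof.
exists (fun n => @box R (- n%:R) n%:R (- n%:R) n%:R); last first.
  by move=> n; split; [exact: measurable_box|exact: area_box_fin].
apply/esym; rewrite -subTset => -[x y] _.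
pose n := Num.bound (`|x| + `|y|).
have h : `|x| + `|y| < n%:R.
  by apply: le_lt_trans (archi_boundP _); rewrite ?addr_ge0.
by exists n => //; apply/boxP; rewrite /= -!ler_norml; split;
  apply: le_trans (ltW h); rewrite ?lerDl ?lerDr.
Qed.

Lemma area_tonelli (f : X * X -> \bar R) : measurable_fun setT f -> (forall t, (0 <= f t)%E) ->
  (\int[dV]_x \int[dV]_y f (x, y) = \int[dV]_y \int[dV]_x f (x, y))%E /\
  measurable_fun setT (fun x => \int[dV]_y f (x, y))%E.
Proof.
move=> mf f0.
pose m : {sigma_finite_measure set X -> \bar R} := HB.pack (@lebesgue_measure R \x @lebesgue_measure R)%E
  (Measure_isSigmaFinite.Build _ _ _ (@lebesgue_measure R \x @lebesgue_measure R)%E area_sigma_finite).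
split; first exact: (@fubini_tonelli _ _ _ _ R m m f mf f0).
exact: (@measurable_fun_fubini_tonelli_F _ _ _ _ R m f mf f0).
Qed.

Lemma kdist_tonelli u W : hmeas u -> hmeas W ->
  (forall w, halfplane w -> 0 <= u w) -> (forall w, halfplane w -> 0 <= W w) ->
  measurable_fun (@halfplane2 R) (fun q => (planar u q)%:E *
    aint (fun w => W w * kdist (q.1 +i* q.2) w `^ (- 2))%R)%E /\
  (\int[dV]_(q in halfplane2) ((planar u q)%:E *
    aint (fun w => W w * kdist (q.1 +i* q.2) w `^ (- 2))%R) =
   \int[dV]_(q in halfplane2) ((planar W q)%:E *
    aint (fun w => u w * kdist (q.1 +i* q.2) w `^ (- 2))%R))%E.
Proof.
move=> mu mW u0 W0.
have mK := measurable_pair_kernel mu mW.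
have K0 t : (0 <= (EFin \o pair_kernel u W) t)%E by rewrite lee_fin pair_kernel_ge0.
have [T mF] := area_tonelli mK K0.
split.
  apply/(measurable_restrictT _ mH).
  by move: mF; congr measurable_fun; apply/funext => q; exact: pair_kernel_section.
rewrite [LHS]integral_mkcond [RHS]integral_mkcond.
have -> : (\int[dV]_q (((fun q => (planar u q)%:E *
    aint (fun w => W w * kdist (q.1 +i* q.2) w `^ (- 2))%R) \_ (@halfplane2 R)) q) =
   \int[dV]_x \int[dV]_y (EFin \o pair_kernel u W) (x, y))%E.
  by apply: eq_integral => q _; rewrite -pair_kernel_section.
rewrite T; apply: eq_integral => q _.
apply: etrans (pair_kernel_section q mW mu W0 u0).
apply: eq_integral => t _; rewrite /pair_kernel /=; congr EFin.
by rewrite kdistC; congr (_ * _); exact: mulrC.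
Qed.

End SchurTest.

(** * The Schur test *)

Section SchurBound.
Context {R : realType}.
Implicit Types (z w : R[i]) (F G H u W : R[i] -> R).
Let mH := @measurable_halfplane2 R.

Lemma powR_root (x p : R) : 0 <= x -> p != 0 -> (x `^ p^-1) `^ p = x.
Proof. by move=> x0 p0; rewrite -powRrM mulVf// powRr1. Qed.

Lemma weighted_kernel_fin u a z : 0 < a -> a < 2 -> hmeas u ->
  (forall w, halfplane w -> 0 <= u w) -> (aint u < +oo)%E -> halfplane z ->
  (aint (fun w => complex.Im w `^ a * u w * kdist z w `^ (- 2))%R < +oo)%E.
Proof.
move=> a0 a2 mu u0 uy z0; have y0 : 0 < complex.Im z by [].
apply: (@le_lt_trans _ _ (aint (fun w => complex.Im z `^ (a - 2) * u w)%R)).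
  apply: aint_le.
  - apply: hmeasM; last by apply: hmeas_powR; exact: hmeas_kdist.
    by apply: hmeasM => //; apply: hmeas_powR; exact: hmeas_Im.
  - exact: hmeasZ.
  move=> w w0; have v0 : 0 < complex.Im w by [].
  have D0 := kdist_gt0 z0 w0.
  rewrite !mulr_ge0 ?powR_ge0 ?u0//= mulrAC ler_wpM2r ?u0//.
  apply: (@le_trans _ _ (kdist z w `^ (a - 2))).
    rewrite powRD; last by apply/implyP => _; rewrite gt_eqF.
    rewrite ler_wpM2r ?powR_ge0// ge0_ler_powR ?nnegrE ?(ltW v0) ?(ltW D0) ?(ltW a0)//.
    by rewrite kdistC kdist_Iml.
  rewrite -opprB; apply: powRN_le => //; last by lra.
  exact: kdist_Iml.
by rewrite aintZ// ?powR_ge0// lte_mul_pinfty ?lee_fin ?powR_ge0.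
Qed.

(** The Schur test with a power of the height as test function. With 1/p + 1/q = 1 and
    e = 1 / (2 p), Hoelder's inequality splits the integrand of the bound of H z into
    F omega^-l v^(e/q) D^(-2/p) and omega^-k v^(-e/q) D^(-2/q), where D = kdist z w. The
    second factor is integrated by kernel_integral_omega; it produces the weight
    omega^(-k p) that the left-hand side asks for. After Tonelli the integral in z is
    again a kernel integral, with weight y^-a, a = e (p - 1) < 1. *)
Lemma schur_bound (p l k : R) : 1 < p -> exists2 C : R, 0 <= C &
  forall F A H, hmeas F -> (forall w, halfplane w -> 0 <= F w) -> 0 <= A ->
    (aint (fun w => F w `^ p * omega w `^ (- l * p))%R <= (A `^ p)%:E)%E ->
    hmeas H -> (forall w, halfplane w -> 0 <= H w) ->
    (forall z, halfplane z -> ((H z)%:E <=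
      aint (fun w => omega w `^ (- (l + k)) * F w * kdist z w `^ (- 2))%R)%E) ->
    (aint (fun w => H w `^ p * omega w `^ (k * p))%R <= ((C * A) `^ p)%:E)%E.
Proof.
move=> p1; have [p0 q1 pq] := conjugate_exponent p1.
set q := p / (p - 1) in q1 pq; have q0 : 0 < q by lra.
have pN0 : p != 0 by rewrite gt_eqF.
have qN0 : q != 0 by rewrite gt_eqF.
have pm1 : 0 < p - 1 by lra.
have pqE : p / q = p - 1 by rewrite /q; field; apply/andP; split=> //; rewrite gt_eqF.
(* Any e with e < 1 and e (p - 1) < 1 would do. *)
pose e : R := (2 * p)^-1.
have e0 : 0 < e by rewrite invr_gt0 mulr_gt0.
have ep : e * p = 2^-1 by rewrite /e; field.
have e1 : e < 2^-1 by rewrite -ep ltr_pMr.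
pose a := e * (p - 1).
have a0 : 0 < a by rewrite mulr_gt0.
have a1 : a < 2^-1 by rewrite /a mulrBr mulr1 ep; lra.
have aE : e / q * p = a by rewrite mulrAC -mulrA pqE.
have [C1 C10 H1] := @kernel_integral_omega R (- k * q) (1 - e) 2 ltac:(lra) ltac:(lra).
have [C2 C20 H2] := @kernel_integral R (1 - a) 2 ltac:(lra) ltac:(lra).
pose C := (C1 `^ (p - 1) * C2) `^ p^-1.
have CE : C `^ p = C1 `^ (p - 1) * C2 by rewrite powR_root// mulr_ge0 ?powR_ge0.
have C0 : 0 <= C by exact: powR_ge0.
exists C; first exact: C0.
move=> F A H mF F0 A0 FA mHH H0 HF.
pose u w := F w `^ p * omega w `^ (- l * p).
have mu : hmeas u by apply: hmeasM; apply: hmeas_powR => //; exact: hmeas_omega.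
have u0 w : 0 <= u w by rewrite mulr_ge0 ?powR_ge0.
have uy : (aint u < +oo)%E by apply: le_lt_trans FA _; rewrite ltry.
pose W w := complex.Im w `^ a * u w.
have mW : hmeas W by apply: hmeasM => //; apply: hmeas_powR; exact: hmeas_Im.
have W0 w : 0 <= W w by rewrite mulr_ge0 ?powR_ge0.
pose I z := aint (fun w => W w * kdist z w `^ (- 2))%R.
pose Y w := complex.Im w `^ (- a).
have mY : hmeas Y by apply: hmeas_powR; exact: hmeas_Im.
have Y0 w : 0 <= Y w by exact: powR_ge0.
have key z : halfplane z -> ((H z `^ p * omega z `^ (k * p))%:E <=
    (C1 `^ (p - 1))%:E * ((Y z)%:E * I z))%E.
  move=> z0; have y0 : 0 < complex.Im z by [].
  have Iz : (I z < +oo)%E by apply: weighted_kernel_fin => //; lra.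
  have I0 : (0 <= I z)%E by apply: aint_ge0 => w w0; rewrite mulr_ge0 ?powR_ge0.
  have If : I z \is a fin_num by rewrite ge0_fin_numE.
  have IR0 : 0 <= fine (I z) by exact: fine_ge0.
  pose P1 w := F w * omega w `^ (- l) * complex.Im w `^ (e / q) * kdist z w `^ (- 2 / p).
  pose P2 w := omega w `^ (- k) * complex.Im w `^ (- (e / q)) * kdist z w `^ (- 2 / q).
  have mk s : hmeas (fun w => kdist z w `^ s) by apply: hmeas_powR; exact: hmeas_kdist.
  have mI s : hmeas (fun w : R[i] => complex.Im w `^ s) by apply: hmeas_powR; exact: hmeas_Im.
  have mo s : hmeas (fun w : R[i] => omega w `^ s) by apply: hmeas_powR; exact: hmeas_omega.
  have mP1 : hmeas P1 by apply: hmeasM => //; apply: hmeasM => //; exact: hmeasM.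
  have mP2 : hmeas P2 by apply: hmeasM => //; exact: hmeasM.
  have P10 w : halfplane w -> 0 <= P1 w by move=> w0; rewrite !mulr_ge0 ?powR_ge0// F0.
  have P20 w : halfplane w -> 0 <= P2 w by move=> w0; rewrite !mulr_ge0 ?powR_ge0.
  pose B := C1 * (omega z `^ (- k * q) * complex.Im z `^ (- e)).
  have B0 : 0 <= B by rewrite !mulr_ge0 ?powR_ge0.
  have h1 : (aint (fun w => P1 w `^ p)%R <= ((fine (I z) `^ p^-1) `^ p)%:E)%E.
    rewrite powR_root// fineK// le_eqVlt; apply/orP; left; apply/eqP.
    apply: eq_aint => w w0; have F0w := F0 w w0.
    rewrite /P1 !powRM ?mulr_ge0 ?powR_ge0// -!powRrM aE /W /u.
    by rewrite divfK//; ring.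
  have h2 : (aint (fun w => P2 w `^ q)%R <= ((B `^ q^-1) `^ q)%:E)%E.
    rewrite powR_root//.
    have := H1 z z0; rewrite (_ : 1 - e - 1 = - e); last by ring.
    rewrite (_ : 1 - e + 1 - 2 = - e); last by ring.
    apply: le_trans; rewrite le_eqVlt; apply/orP; left; apply/eqP.
    apply: eq_aint => w w0.
    have E1 : - (e / q) * q = - e by rewrite mulNr divfK.
    have E2 : -2 / q * q = -2 by rewrite divfK.
    by rewrite /P2 !powRM ?mulr_ge0 ?powR_ge0// -!powRrM E1 E2 mulrA.
  have := @aint_hoelder R P1 P2 p q _ _ p0 q0 pq mP1 mP2 P10 P20 (powR_ge0 _ _) (powR_ge0 _ _) h1 h2.
  have -> : aint (fun w => P1 w * P2 w)%R =
      aint (fun w => omega w `^ (- (l + k)) * F w * kdist z w `^ (- 2))%R.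
    apply: eq_aint => w w0; have v0 : 0 < complex.Im w by [].
    have D0 := kdist_gt0 z0 w0; have o0 := omega_gt0 w.
    have -> : - (l + k) = - l - k by ring.
    have -> : -2 = -2 / p + -2 / q by rewrite -mulrDr pq mulr1.
    rewrite /P1 /P2 !powRD ?(gt_eqF D0) ?(gt_eqF o0) ?implybT// !powRN.
    by field; rewrite !gt_eqF ?powR_gt0.
  move=> /(le_trans (HF z z0)); rewrite lee_fin => HAB.
  have HP : H z `^ p <= fine (I z) * (C1 `^ (p - 1) * (omega z `^ (- (k * p)) * Y z)).
    apply: (@le_trans _ _ ((fine (I z) `^ p^-1 * B `^ q^-1) `^ p)).
      by apply: ge0_ler_powR; rewrite ?nnegrE ?(ltW p0) ?mulr_ge0 ?powR_ge0 ?H0.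
    rewrite powRM ?powR_ge0// powR_root// -powRrM mulrC [q^-1 * p]mulrC pqE.
    rewrite mulrC /B !powRM ?mulr_ge0 ?powR_ge0// -!powRrM.
    have -> : - k * q * (p - 1) = - (k * p) by rewrite /q; field; rewrite gt_eqF.
    by rewrite mulNr.
  rewrite -[I z](fineK If) -!EFinM lee_fin.
  apply: (le_trans (ler_wpM2r (powR_ge0 _ _) HP)).
  rewrite le_eqVlt; apply/orP; left; apply/eqP; rewrite powRN.
  by field; rewrite gt_eqF// powR_gt0// omega_gt0.
have [mT T] := kdist_tonelli mY mW (fun w _ => Y0 w) (fun w _ => W0 w).
have [mT' _] := kdist_tonelli mW mY (fun w _ => W0 w) (fun w _ => Y0 w).
have S : (\int[dV]_(t in halfplane2) ((planar Y t)%:E * I (t.1 +i* t.2)) <=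
    C2%:E * aint u)%E.
  apply: (@le_trans _ _ (\int[dV]_(t in halfplane2) ((planar W t)%:E *
    aint (fun w => Y w * kdist (t.1 +i* t.2) w `^ (- 2))%R))%E).
    by rewrite le_eqVlt; apply/orP; left; apply/eqP; exact: T.
  have cu : (C2%:E * aint u = aint (fun w => (C2 * u w)%R))%E by rewrite aintZ.
  rewrite cu; apply: ge0_le_integral; [exact: mH| |exact: mT'| |].
  - move=> t t0; apply: mule_ge0; first by rewrite lee_fin; exact: W0.
    by apply: aint_ge0 => w w0; rewrite mulr_ge0 ?powR_ge0.
  - by apply/measurable_EFinP; exact: hmeasZ.
  move=> [x y] y0; have z0 : halfplane (x +i* y) by [].
  have := H2 _ z0; rewrite (_ : 1 - a - 1 = - a); last by ring.
  rewrite (_ : 1 - a + 1 - 2 = - a); last by ring.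
  move=> h; apply: (@le_trans _ _ ((W (x +i* y))%:E * (C2 * y `^ (- a))%:E)%E).
    by apply: lee_wpmul2l; [rewrite lee_fin; exact: W0|exact: h].
  rewrite -EFinM lee_fin /planar /W /= le_eqVlt; apply/orP; left; apply/eqP.
  by rewrite powRN; field; rewrite gt_eqF// powR_gt0.
apply: (@le_trans _ _ ((C1 `^ (p - 1))%:E * (C2%:E * (A `^ p)%:E))%E); last first.
  by rewrite -!EFinM lee_fin (powRM _ C0 A0) CE mulrA lexx.
apply: (@le_trans _ _ ((C1 `^ (p - 1))%:E * (\int[dV]_(t in halfplane2) ((planar Y t)%:E * I (t.1 +i* t.2))))%E).
  have J0 t : halfplane2 t -> (0 <= (planar Y t)%:E * I (t.1 +i* t.2))%E.
    move=> t0; apply: mule_ge0; first by rewrite lee_fin; exact: Y0.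
    by apply: aint_ge0 => w w0; rewrite mulr_ge0 ?powR_ge0.
  have c0 : (0 <= (C1 `^ (p - 1))%:E)%E by rewrite lee_fin powR_ge0.
  have Z := ge0_integralZl dV mH mT J0 c0.
  apply: (@le_trans _ _ (\int[dV]_(t in halfplane2)
    ((C1 `^ (p - 1))%:E * ((planar Y t)%:E * I (t.1 +i* t.2))))%E); last first.
    by rewrite le_eqVlt; apply/orP; left; apply/eqP; exact: Z.
  apply: ge0_le_integral; first exact: mH.
  - by move=> t t0; rewrite lee_fin mulr_ge0 ?powR_ge0.
  - by apply/measurable_EFinP; apply: hmeasM; apply: hmeas_powR => //; exact: hmeas_omega.
  - exact: (measurable_funeM _ mT).
  by move=> t t0; exact: key.
rewrite lee_wpmul2l ?lee_fin ?powR_ge0//; apply: (le_trans S).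
by rewrite lee_wpmul2l ?lee_fin.
Qed.

End SchurBound.

(** * Growth of Bloch functions *)

Section BlochGrowth.
Context {R : realType}.
Implicit Types (z w c : R[i]) (b f g : R[i] -> R[i]).

Lemma powR_div (x s d : R) : 0 <= x -> 0 < s -> (x / s) `^ d = x `^ d * s `^ (- d).
Proof.
move=> x0 s0; rewrite powRM ?invr_ge0 ?(ltW s0)//; congr (_ * _).
by rewrite -(powR_inv1 (ltW s0)) -powRrM mulN1r.
Qed.

(** Seen from a point w of the cone |Re w| <= Im w above height 1, the kernel is at most
    a constant times the kernel at i. *)
Lemma kint_high_bound b : cmeas b -> kintegrable 2 b -> exists2 K : R, 0 <= K &
  forall w, halfplane w -> 1 <= complex.Im w -> `|complex.Re w| <= complex.Im w ->
    cabs (kint 2 b w) <= K.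
Proof.
move=> mb bi; have i0 := @halfplane_i R.
pose I := aint (fun w => cabs (b w) * kdist 'i%C w ^- 2).
have kE z w : cabs ((z - w^*%C) ^- 2 * b w) = cabs (b w) * kdist z w ^- 2.
  by rewrite cabsM cabsV cabsX mulrC.
have I0 : (0 <= I)%E by apply: aint_ge0 => w w0; rewrite mulr_ge0 ?cabs_ge0 ?invr_ge0 ?exprn_ge0 ?cabs_ge0.
have If : I \is a fin_num.
  rewrite ge0_fin_numE//; have /cintegrableP[_] := bi _ i0.
  by under eq_aint do rewrite kE.
exists (2 * (9 * fine I)); first by rewrite !mulr_ge0// fine_ge0.
move=> w w0 w1 wx; have y0 : 0 < complex.Im w by [].
rewrite -lee_fin; apply: (le_trans (cintegral_le (bi w w0))).
rewrite EFinM; apply: lee_wpmul2l; first by rewrite lee_fin.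
have mk z : halfplane z -> hmeas (fun v => cabs (b v) * kdist z v ^- 2).
  by move=> z0; apply: hmeasM; [exact: measurable_cabs|exact: hmeas_kernel].
rewrite EFinM fineK// /I -aintZ//; last 2 first.
- exact: mk.
- by move=> v v0; rewrite mulr_ge0 ?cabs_ge0 ?invr_ge0 ?exprn_ge0 ?cabs_ge0.
apply: aint_le; first by under eq_fun do rewrite kE; exact: mk.
  by apply: hmeasZ; exact: mk.
move=> v v0; rewrite cabs_ge0 kE mulrCA /= ler_wpM2l ?cabs_ge0//.
have D1 := kdist_gt0 i0 v0; have D2 := kdist_gt0 w0 v0.
rewrite ler_pdivlMr ?exprn_gt0// mulrC ler_pdivrMr ?exprn_gt0//.
have h : kdist 'i%C v <= 3 * kdist w v.
  apply: (le_trans (kdist_le _ w0 v0)); rewrite ler_wpM2r ?(ltW D2)//.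
  have : cabs ('i%C - w) <= 2 * complex.Im w.
    apply: (le_trans (cabs_le _)); rewrite cReD cImD cReN cImN /= sub0r normrN mulr_natl mulr2n.
    by apply: lerD => //; rewrite distrC ger0_norm ?subr_ge0// gerBl.
  by rewrite -ler_pdivrMr// => h; lra.
by rewrite (_ : 9 * _ = (3 * kdist w v) ^+ 2); [rewrite ler_pXn2r ?nnegrE ?mulr_ge0 ?(ltW D1) ?(ltW D2)|ring].
Qed.

(** Integrate b' downwards from the height 1 + |x| + y, where kint_high_bound applies.
    On this segment omega^-m is bounded by an arbitrarily small power of kratio. *)
Lemma bloch_growth c b m N d : c != 0 -> holomorphic b -> projection_fixed c b -> 0 <= N -> 0 < d ->
  (forall w, halfplane w -> complex.Im w * omega w `^ m * cabs (cderiv b w) <= N) ->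
  exists2 K : R, 0 <= K & forall w, halfplane w -> cabs (b w) <= K * kratio 'i%C w `^ d.
Proof.
move=> c0 hb bP N0 d0 HN; have i0 := @halfplane_i R.
have [K1 K10 HK1] := kint_high_bound (cmeas_holomorphic hb) (projection_fixed_kintegrable c0 bP).
have [C C0 HC] := @omega_powR_le R (- m) d d0.
pose C' := C * omega ('i%C : R[i]) `^ (- m).
have C'0 : 0 <= C' by rewrite mulr_ge0 ?powR_ge0 ?(ltW C0).
exists (cabs c * K1 + N * C' / d * 16 `^ d).
  apply: addr_ge0; first by rewrite mulr_ge0 ?cabs_ge0.
  by apply: mulr_ge0; [apply: divr_ge0; [exact: mulr_ge0|exact: ltW]|exact: powR_ge0].
case=> x y y0; have {}y0 : 0 < y by []. 
(* x + i T is in the cone of kint_high_bound, and T <= 2 kdist 'i (x + i y). *)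
pose T := 1 + `|x| + y.
have yT : y <= T by rewrite /T lerDr addr_ge0.
have T0 : 0 < T := lt_le_trans y0 yT.
have T1 : 1 <= T by rewrite /T -addrA lerDl addr_ge0// ltW.
have xT : `|x| <= T by rewrite /T -addrA addrCA lerDl addr_ge0// ltW.
pose A := N * C' * (4 * T ^+ 2) `^ d.
have A0 : 0 <= A by apply: mulr_ge0 (powR_ge0 _ _); exact: mulr_ge0.
have hd s : y <= s <= T -> cder b (x +i* s) (cderiv b (x +i* s)).
  move=> /andP[ys _]; apply: holomorphic_cder => //; exact: lt_le_trans ys.
have hA s : y <= s <= T -> cabs (cderiv b (x +i* s)) <= A * s `^ (- (1 + d)).
  move=> /andP[ys sT]; have s0 : 0 < s := lt_le_trans y0 ys.
  have sH : halfplane (x +i* s) by [].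
  have o0 := omega_gt0 (x +i* s).
  have := HN _ sH => /=; rewrite mulrAC -ler_pdivlMr ?powR_gt0// -powRN mulrC -ler_pdivlMr// => h.
  apply: (le_trans h).
  have r : kratio 'i%C (x +i* s) <= 4 * T ^+ 2 / s.
    rewrite /kratio /= mul1r ler_wpM2r ?invr_ge0 ?(ltW s0)//.
    rewrite (_ : 4 * T ^+ 2 = (2 * T) ^+ 2); last by ring.
    rewrite ler_pXn2r ?nnegrE ?mulr_ge0 ?(ltW T0) ?(ltW (kdist_gt0 i0 sH))//.
    apply: (le_trans (cabs_le _)); rewrite cReD cImD cReN cImN cReJ cImJ /= sub0r normrN opprK.
    rewrite (@ger0_norm _ (1 + s)) ?addr_ge0 ?(ltW s0)//.
    by move: sT; rewrite /T => sT; have := normr_ge0 x; lra.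
  have r0 : 0 <= kratio 'i%C (x +i* s) by rewrite (le_trans _ (kratio_ge1 i0 sH)).
  have rd : kratio 'i%C (x +i* s) `^ d <= (4 * T ^+ 2) `^ d * s `^ (- d).
    apply: (@le_trans _ _ ((4 * T ^+ 2 / s) `^ d)).
      exact: (ge0_ler_powR (ltW d0) r0 (le_trans r0 r) r).
    by rewrite powR_div// mulr_ge0 ?sqr_ge0.
  rewrite (_ : - (1 + d) = - d - 1); last by ring.
  rewrite powRD; last by rewrite (gt_eqF s0) implybT.
  rewrite powR_inv1 ?(ltW s0)// mulrA ler_wpM2r ?invr_ge0 ?(ltW s0)//.
  rewrite /A -!mulrA ler_wpM2l//; apply: (le_trans (HC _ _ i0 sH)).
  by rewrite mulrA; exact: (ler_wpM2l C'0 rd).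
have := vertical_decay y0 yT d0 A0 hd hA => h; apply: (le_trans h).
have wH : halfplane (x +i* y) by [].
have k1 := kratio_ge1 i0 wH; rewrite mulrDl; apply: lerD.
  have TH : halfplane (x +i* T) by [].
  rewrite (projection_fixed_kint c0 bP TH) cabsM -[leLHS]mulr1.
  apply: ler_pM => //; first by rewrite mulr_ge0 ?cabs_ge0.
    by rewrite ler_wpM2l ?cabs_ge0// HK1.
  have := @ge0_ler_powR _ d (ltW d0) 1 (kratio 'i%C (x +i* y)) ler01 (le_trans ler01 k1) k1.
  by rewrite powR1.
have E : (4 * T ^+ 2) `^ d * y `^ (- d) <= 16 `^ d * kratio 'i%C (x +i* y) `^ d.
  have kr0 : 0 <= kratio 'i%C (x +i* y) by rewrite (le_trans _ k1).
  have T2 : 0 <= 4 * T ^+ 2 by rewrite mulr_ge0 ?sqr_ge0.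
  rewrite -powR_div// -powRM//.
  suff hT : 4 * T ^+ 2 / y <= 16 * kratio 'i%C (x +i* y).
    have h0 : 0 <= 4 * T ^+ 2 / y by rewrite divr_ge0// ltW.
    exact: (ge0_ler_powR (ltW d0) h0 (le_trans h0 hT) hT).
  rewrite /kratio /= mul1r mulrA ler_wpM2r ?invr_ge0 ?(ltW y0)//.
  have D0 := kdist_gt0 i0 wH.
  have := kdist_Im i0 wH; have := kdist_Re 'i%C (x +i* y); rewrite /= sub0r normrN => h1 h2.
  have h3 : T <= 2 * kdist 'i%C (x +i* y) by rewrite /T; lra.
  by nra.
have -> : A / d * y `^ (- d) = N * C' / d * ((4 * T ^+ 2) `^ d * y `^ (- d)).
  by rewrite /A; ring.
have n0 : 0 <= N * C' / d by apply: divr_ge0; [exact: mulr_ge0|exact: ltW].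
by rewrite -[leRHS]mulrA; exact: (ler_wpM2l n0 E).
Qed.
End BlochGrowth.

(** * Integrability of the Hankel integrand *)

Section BlochToHankel.
Context {R : realType}.
Implicit Types (z w c : R[i]) (b f g : R[i] -> R[i]) (F G : R[i] -> R).

Lemma hoelder_fin (p q : R) F G : 0 < p -> 0 < q -> p^-1 + q^-1 = 1 ->
  hmeas F -> hmeas G -> (forall z, halfplane z -> 0 <= F z) ->
  (forall z, halfplane z -> 0 <= G z) ->
  (aint (fun z => F z `^ p)%R < +oo)%E -> (aint (fun z => G z `^ q)%R < +oo)%E ->
  (aint (fun z => F z * G z)%R < +oo)%E.
Proof.
move=> p0 q0 pq mF mG F0 G0 Fy Gy.
have root (r : R) (x : \bar R) : 0 < r -> (0 <= x)%E -> (x < +oo)%E ->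
    (x <= ((fine x `^ r^-1) `^ r)%:E)%E.
  move=> r0 x0 xy; rewrite powR_root ?fine_ge0 ?gt_eqF// fineK//.
  by rewrite ge0_fin_numE.
have i0 H r : (0 <= aint (fun z => H z `^ r)%R)%E by apply: aint_ge0 => z z0; exact: powR_ge0.
apply: le_lt_trans (aint_hoelder p0 q0 pq mF mG F0 G0 (powR_ge0 _ _) (powR_ge0 _ _)
  (root _ _ p0 (i0 _ _) Fy) (root _ _ q0 (i0 _ _) Gy)) _.
exact: ltry.
Qed.

Lemma kdist_comparable z : halfplane z -> exists2 L : R, 0 < L & forall w, halfplane w ->
  kdist z w ^- 2 <= L * kdist 'i%C w ^- 2.
Proof.
move=> z0; have i0 := @halfplane_i R.
pose L := 1 + cabs ('i%C - z) / complex.Im z.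
have L0 : 0 < L by rewrite /L ltr_pwDl// divr_ge0 ?cabs_ge0// ltW.
exists (L ^+ 2) => [|w w0]; first by rewrite exprn_gt0.
have D1 := kdist_gt0 i0 w0; have D2 := kdist_gt0 z0 w0.
rewrite ler_pdivlMr ?exprn_gt0// mulrC ler_pdivrMr ?exprn_gt0// -exprMn.
rewrite ler_pXn2r ?nnegrE ?(ltW D1)// ?mulr_ge0 ?(ltW L0) ?(ltW D2)//.
exact: kdist_le.
Qed.

(** Hoelder's inequality against f omega^-l. The growth of b costs a power kratio^d,
    and the dual exponent q requires d q < 1 for convergence at the boundary and
    d q < 2 (q - 1) for convergence at infinity. *)
Lemma bloch_pairing_fin c b f p l m N : c != 0 -> 1 < p -> holomorphic b -> projection_fixed c b ->
  0 <= N -> (forall w, halfplane w -> complex.Im w * omega w `^ m * cabs (cderiv b w) <= N) ->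
  bergman_space p (logweight (- l * p)) f ->
  (aint (fun w => (cabs (b w) * (cabs (f w) * kdist 'i%C w ^- 2))%R) < +oo)%E /\
  (aint (fun w => (omega w `^ (- m) * (cabs (f w) * kdist 'i%C w ^- 2))%R) < +oo)%E.
Proof.
move=> c0 p1 hb bP N0 HN [hf fy]; have i0 := @halfplane_i R.
have [p0 q1 pq] := conjugate_exponent p1.
set q := p / (p - 1) in q1 pq; have q0 : 0 < q by lra.
have qN0 : q != 0 by rewrite gt_eqF.
have mf := measurable_cabs (cmeas_holomorphic hf).
have mb := measurable_cabs (cmeas_holomorphic hb).
have mo s : hmeas (fun w : R[i] => omega w `^ s) by apply: hmeas_powR; exact: hmeas_omega.
have mD := hmeas_kernel 2 i0.
pose F w := cabs (f w) * omega w `^ (- l).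
have mF : hmeas F by exact: hmeasM.
have F0 w : halfplane w -> 0 <= F w by rewrite mulr_ge0 ?cabs_ge0 ?powR_ge0.
have Fy : (aint (fun w => F w `^ p)%R < +oo)%E.
  have Y : bergman_norm p (logweight (- l * p)) f \is a fin_num.
    by rewrite ge0_fin_numE ?bergman_norm_ge0.
  have := @bergman_norm_le R p (logweight (- l * p)) f (fine (bergman_norm p (logweight (- l * p)) f))
    p0 (logweight_ge0 _) (fine_ge0 (bergman_norm_ge0 _ _ _)).
  rewrite fineK// lexx => -[/(_ isT) h _].
  apply: le_lt_trans (_ : (_ <= _)%E) (ltry (fine (bergman_norm p (logweight (- l * p)) f) `^ p)).
  apply: le_trans h; rewrite le_eqVlt; apply/orP; left; apply/eqP; apply: eq_aint => w w0.
  by rewrite /F powRM ?cabs_ge0 ?powR_ge0// -powRrM.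
(* Both integrals are instances of one: the factor G that multiplies f is only
   known up to a power of omega and of kratio, and that is enough for the kernel
   integral of the dual exponent to converge. *)
have dual G K s d : hmeas G -> (forall w, halfplane w -> 0 <= G w) -> 0 <= K -> 0 <= d ->
    d * q < 1 -> d * q < 2 * (q - 1) ->
    (forall w, halfplane w -> G w <= K * (omega w `^ s * kratio 'i%C w `^ d)) ->
    (aint (fun w => G w * (cabs (f w) * kdist 'i%C w ^- 2))%R < +oo)%E.
  move=> mG G0 K0 d0 dq1 dq2 HG.
  pose P w := omega w `^ l * G w * kdist 'i%C w ^- 2.
  have mP : hmeas P by apply: hmeasM => //; exact: hmeasM.
  have P0 w : halfplane w -> 0 <= P w.
    by move=> w0; rewrite !mulr_ge0 ?powR_ge0 ?invr_ge0 ?exprn_ge0 ?cabs_ge0 ?G0.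
  rewrite (@eq_aint _ _ (fun w => F w * P w)); last first.
    move=> w w0; rewrite /F /P powRN; have := omega_gt0 w => o0.
    by field; rewrite !gt_eqF ?powR_gt0 ?kdist_gt0.
  apply: (@hoelder_fin p q F P p0 q0 pq mF mP F0 P0 Fy).
  have [C C0 HC] := @kernel_integral_omega R ((l + s) * q) (1 - d * q) (2 * q - 2 * d * q)
    ltac:(lra) ltac:(lra).
  apply: (@le_lt_trans _ _ (aint (fun w => K `^ q * (omega w `^ ((l + s) * q) *
     (complex.Im w `^ (1 - d * q - 1) * kdist 'i%C w `^ (- (2 * q - 2 * d * q)))))%R)); last first.
    rewrite aintZ ?powR_ge0//.
    - by rewrite lte_mul_pinfty ?lee_fin ?powR_ge0//; apply: le_lt_trans (HC _ i0) _; exact: ltry.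
    - apply: hmeasM => //; apply: hmeasM; apply: hmeas_powR; [exact: hmeas_Im|exact: hmeas_kdist].
    - by move=> w w0; rewrite !mulr_ge0 ?powR_ge0.
  apply: aint_le; first exact: hmeas_powR.
    apply: hmeasZ; apply: hmeasM => //; apply: hmeasM; apply: hmeas_powR; [exact: hmeas_Im|exact: hmeas_kdist].
  move=> w w0; rewrite powR_ge0 /=.
  have v0 : 0 < complex.Im w by []. 
  have D0 := kdist_gt0 i0 w0; have o0 := omega_gt0 w.
  have E : K * (omega w `^ (l + s) * (complex.Im w `^ (- d) * kdist 'i%C w `^ (2 * d - 2))) =
      omega w `^ l * (K * (omega w `^ s * kratio 'i%C w `^ d)) * kdist 'i%C w ^- 2.
    rewrite /kratio /= mul1r powR_div ?exprn_ge0 ?(ltW D0)//.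
    rewrite !powRD ?(gt_eqF D0) ?(gt_eqF o0) ?implybT//.
    rewrite -[kdist _ _ ^+ 2]powR_mulrn ?(ltW D0)// -powRrM !powRN.
    by ring.
  apply: (@le_trans _ _ ((K * (omega w `^ (l + s) * (complex.Im w `^ (- d) * kdist 'i%C w `^ (2 * d - 2)))) `^ q)).
    have h : P w <= K * (omega w `^ (l + s) * (complex.Im w `^ (- d) * kdist 'i%C w `^ (2 * d - 2))).
      rewrite E /P ler_wpM2r ?invr_ge0 ?exprn_ge0 ?(ltW D0)//.
      by rewrite ler_wpM2l ?powR_ge0// HG.
    exact: (ge0_ler_powR (ltW q0) (P0 w w0) (le_trans (P0 w w0) h) h).
  rewrite !powRM ?mulr_ge0 ?powR_ge0// -!powRrM.
  rewrite (_ : 1 - d * q - 1 = - d * q); last by ring.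
  by rewrite (_ : - (2 * q - 2 * d * q) = (2 * d - 2) * q); last by ring.
(* This makes d q = 1 / (p + 1), less than 1 and than 2 (q - 1) = 2 / (p - 1). *)
pose d := (p + 1)^-1 / q.
have d0 : 0 < d by rewrite divr_gt0// invr_gt0; lra.
have dq : d * q = (p + 1)^-1 by rewrite divfK.
have pp0 : 0 < p + 1 by lra.
have dq1 : d * q < 1 by rewrite dq invf_lt1//; lra.
have q2 : q - 1 = (p - 1)^-1 by rewrite /q; field; rewrite gt_eqF//; lra.
have dq2 : d * q < 2 * (q - 1).
  rewrite dq q2; have p10 : 0 < p - 1 by lra.
  apply: (@lt_trans _ _ (p - 1)^-1); first by rewrite ltf_pV2 ?posrE//; lra.
  by rewrite mulrC ltr_pMr ?invr_gt0//; lra.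
split.
  have [K K0 HK] := bloch_growth c0 hb bP N0 d0 HN.
  apply: (dual _ K 0 d) => //; [|exact: ltW|].
    by move=> w _; exact: cabs_ge0.
  by move=> w w0; rewrite powRr0 mul1r; exact: HK.
apply: (dual _ 1 (- m) 0) => //.
- by move=> w _; exact: powR_ge0.
- by rewrite mul0r.
- by rewrite mul0r; lra.
- by move=> w w0; rewrite powRr0 mulr1 mul1r.
Qed.

End BlochToHankel.

(** * A Bloch symbol has a bounded Hankel operator *)

Section HankelBound.
Context {R : realType}.
Implicit Types (z w c : R[i]) (b f g : R[i] -> R[i]) (F G : R[i] -> R).

Lemma kernel_pairing b f z w :
  (z - w^*%C) ^- 2 * hankel_arg b f w = b w * (f w * test_fun 2 z w)^*%C.
Proof.
rewrite /hankel_arg /test_fun conjcM conjc_inv conjcX conjcB conjcK.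
by rewrite -[w^*%C - z]opprB sqrrN mulrC -mulrA.
Qed.

(** h_b f (z) is the pairing of b with g = f (w - conj z)^-2. Integration by parts
    replaces b by Im(w) b'(w), which the seminorm bounds by N omega^-(l+k), and the
    operator with the positive kernel |z - conj w|^-2 is bounded by the Schur test. The
    absolute convergence required for this comes from bloch_pairing_fin. *)
Lemma bloch_to_hankel c (p l k : R) : bergman_constant c -> 1 < p ->
  exists2 C : R, 0 <= C & forall b N f, holomorphic b -> projection_fixed c b -> 0 <= N ->
    (forall w, halfplane w -> complex.Im w * omega w `^ (l + k) * cabs (cderiv b w) <= N) ->
    bergman_space p (logweight (- l * p)) f ->
    [/\ forall z, halfplane z -> projection_defined c (hankel_arg b f) z,
        holomorphic (hankel c b f) &
        (bergman_norm p (logweight (k * p)) (hankel c b f) <=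
          (C * N)%:E * bergman_norm p (logweight (- l * p)) f)%E].
Proof.
move=> hc p1; have c0 := bergman_constant_neq0 hc; have p0 : 0 < p by lra.
have [C C0 HC] := schur_bound l k p1.
exists (C * (4 * cabs c)); first by rewrite !mulr_ge0 ?cabs_ge0.
move=> b N f hb bP N0 HN fB; have [hf fy] := fB.
have i0 := @halfplane_i R.
have mfc := cmeas_holomorphic hf; have mf := measurable_cabs mfc.
have mbc := cmeas_holomorphic hb; have mb := measurable_cabs mbc.
have hb' := holomorphic_cderiv hc hb.
have mb' := measurable_cabs (cmeas_holomorphic hb').
have mo s : hmeas (fun w : R[i] => omega w `^ s) by apply: hmeas_powR; exact: hmeas_omega.
have [fin1 fin2] := bloch_pairing_fin c0 p1 hb bP N0 HN fB.
have mk z : halfplane z -> hmeas (fun w => kdist z w ^- 2) by exact: hmeas_kernel.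
have spread (G : R[i] -> R) z : halfplane z -> hmeas G -> (forall w, halfplane w -> 0 <= G w) ->
    (aint (fun w => G w * (cabs (f w) * kdist 'i%C w ^- 2))%R < +oo)%E ->
    (aint (fun w => G w * (cabs (f w) * kdist z w ^- 2))%R < +oo)%E.
  move=> z0 mG G0 Gy; have [L L0 HL] := kdist_comparable z0.
  apply: (@le_lt_trans _ _ (aint (fun w => L * (G w * (cabs (f w) * kdist 'i%C w ^- 2)))%R)).
    apply: aint_le.
    - by apply: hmeasM => //; apply: hmeasM => //; exact: mk.
    - by apply: hmeasZ; apply: hmeasM => //; apply: hmeasM => //; exact: mk.
    move=> w w0; have ? := G0 w w0.
    rewrite !mulr_ge0 ?cabs_ge0 ?invr_ge0 ?exprn_ge0 ?cabs_ge0//=.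
    rewrite [leRHS](_ : _ = G w * (cabs (f w) * (L * kdist 'i%C w ^- 2))); last by ring.
    by rewrite ler_wpM2l// ler_wpM2l ?cabs_ge0// HL.
  rewrite aintZ ?(ltW L0)//.
  - by rewrite lte_mul_pinfty ?lee_fin ?(ltW L0).
  - by apply: hmeasM => //; apply: hmeasM => //; exact: mk.
  - by move=> w w0; rewrite !mulr_ge0 ?G0 ?cabs_ge0 ?invr_ge0 ?exprn_ge0 ?cabs_ge0.
have marg : cmeas (hankel_arg b f) by apply: cmeasM => //; exact: cmeas_conj.
have kE z w : cabs ((z - w^*%C) ^- 2 * hankel_arg b f w) =
    cabs (b w) * (cabs (f w) * kdist z w ^- 2).
  by rewrite kernel_pairing cabsM cabs_conj cabsM cabs_test_fun.
have ki : kintegrable 2 (hankel_arg b f).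
  move=> z z0; apply/cintegrableP; split; first by apply: cmeasM => //; exact: cmeas_kernel.
  under eq_aint do rewrite kE.
  by apply: spread => // w _; exact: cabs_ge0.
have pd z : halfplane z -> projection_defined c (hankel_arg b f) z.
  by move=> z0; apply: kintegrable_projection_defined; exact: ki.
have hE z : halfplane z -> hankel c b f z = c * kint 2 (hankel_arg b f) z.
  by move=> z0; apply: projectionE; exact: ki.
have hh : holomorphic (hankel c b f).
  move=> z z0; apply: (cder_derivable (d := c * (- 2%:R * kint 3 (hankel_arg b f) z))).
  apply: (cder_ext (f := fun z => c * kint 2 (hankel_arg b f) z) z0) => [h hz|].
    by rewrite hE//; exact: halfplane_shift.
  by apply: cder_scale; exact: cder_kint.
split=> //.
(* N may be 0, so the constant is put on the side of f and not divided out. *)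
pose S := 4 * cabs c * N.
have S0 : 0 <= S by rewrite !mulr_ge0 ?cabs_ge0.
have pw z : halfplane z -> ((cabs (hankel c b f z))%:E <=
    aint (fun w => omega w `^ (- (l + k)) * (S * cabs (f w)) * kdist z w `^ (- 2))%R)%E.
  move=> z0; pose g w := f w * test_fun 2 z w.
  have hg : holomorphic g := holomorphicM hf (@holomorphic_test_fun R 2 z z0).
  have gE w : cabs (g w) = cabs (f w) * kdist z w ^- 2 by rewrite cabsM cabs_test_fun.
  have mg := measurable_cabs (cmeas_holomorphic hg).
  pose J := aint (fun w => omega w `^ (- (l + k)) * (cabs (f w) * kdist z w ^- 2))%R.
  have Jy : (J < +oo)%E by apply: spread => // w _; exact: powR_ge0.
  have mJ : hmeas (fun w => omega w `^ (- (l + k)) * (cabs (f w) * kdist z w ^- 2)).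
    by apply: hmeasM => //; apply: hmeasM => //; exact: mk.
  have J0 w : halfplane w -> 0 <= omega w `^ (- (l + k)) * (cabs (f w) * kdist z w ^- 2).
    by move=> w0; rewrite !mulr_ge0 ?powR_ge0 ?cabs_ge0 ?invr_ge0 ?exprn_ge0 ?cabs_ge0.
  have i1 : (aint (fun w => (cabs (b w) * cabs (g w))%R) < +oo)%E.
    under eq_aint do rewrite gE.
    by apply: spread => // w _; exact: cabs_ge0.
  have JN : (aint (fun w => (complex.Im w * (cabs (cderiv b w) * cabs (g w)))%R) <= N%:E * J)%E.
    rewrite -aintZ//; apply: aint_le; [|exact: hmeasZ|].
      by apply: hmeasM; [exact: hmeas_Im|exact: hmeasM].
    move=> w w0; have v0 : 0 < complex.Im w by [].
    rewrite !mulr_ge0 ?cabs_ge0 ?(ltW v0)//= gE !mulrA.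
    rewrite ler_wpM2r ?invr_ge0 ?exprn_ge0 ?cabs_ge0// ler_wpM2r ?cabs_ge0//.
    have o0 := omega_gt0 w; have := HN w w0.
    by rewrite powRN mulrAC -ler_pdivlMr ?powR_gt0.
  have NJ : (N%:E * J < +oo)%E by rewrite lte_mul_pinfty ?lee_fin.
  have i2 := le_lt_trans JN NJ.
  have := pairing_le hb hg hb' (holomorphic_cderiv hc hg) i1 i2 => PL.
  rewrite hE// cabsM EFinM.
  have -> : kint 2 (hankel_arg b f) z = cintegral (fun w => b w * (g w)^*%C).
    by apply: eq_cintegral => w _; exact: kernel_pairing.
  apply: (@le_trans _ _ ((cabs c)%:E * (4%:E * (N%:E * J)))%E).
    apply: lee_wpmul2l; first by rewrite lee_fin cabs_ge0.
    by apply: (le_trans PL); apply: lee_wpmul2l.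
  have -> : aint (fun w => omega w `^ (- (l + k)) * (S * cabs (f w)) * kdist z w `^ (- 2))%R =
      aint (fun w => S * (omega w `^ (- (l + k)) * (cabs (f w) * kdist z w ^- 2)))%R.
    apply: eq_aint => w w0; have D0 := kdist_gt0 z0 w0.
    by rewrite [kdist _ _ `^ _]powRN powR_mulrn ?(ltW D0)//; ring.
  rewrite aintZ// !muleA -!EFinM le_eqVlt; apply/orP; left; apply/eqP; congr (_%:E * _)%E.
  by rewrite /S; ring.
pose A := fine (bergman_norm p (logweight (- l * p)) f).
have Af : bergman_norm p (logweight (- l * p)) f = A%:E.
  by rewrite fineK// ge0_fin_numE ?bergman_norm_ge0.
have A0 : 0 <= A by exact: fine_ge0 (bergman_norm_ge0 _ _ _).
have [/(_ _) hA _] := @bergman_norm_le R p (logweight (- l * p)) f A p0 (logweight_ge0 _) A0.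
have SA : (aint (fun w => (S * cabs (f w)) `^ p * omega w `^ (- l * p))%R <= ((S * A) `^ p)%:E)%E.
  apply: (@le_trans _ _ (aint (fun w => S `^ p * (cabs (f w) `^ p * logweight (- l * p) w))%R)).
    rewrite le_eqVlt; apply/orP; left; apply/eqP; apply: eq_aint => w _.
    by rewrite powRM ?cabs_ge0// mulrA.
  rewrite aintZ ?powR_ge0//.
  - rewrite powRM// EFinM; apply: lee_wpmul2l; first by rewrite lee_fin powR_ge0.
    by apply: hA; rewrite Af.
  - by apply: hmeasM; [exact: hmeas_powR|exact: mo].
  - by move=> w _; rewrite mulr_ge0 ?powR_ge0.
have := HC (fun w => S * cabs (f w)) (S * A) (fun z => cabs (hankel c b f z)) (hmeasZ S mf)
  (fun w _ => mulr_ge0 S0 (cabs_ge0 _)) (mulr_ge0 S0 A0) SA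
  (measurable_cabs (cmeas_holomorphic hh)) (fun w _ => cabs_ge0 _) pw => B.
rewrite Af -EFinM.
have -> : C * (4 * cabs c) * N * A = C * (S * A) by rewrite /S; ring.
apply/(bergman_norm_le _ p0 (logweight_ge0 _)); last exact: B.
exact: mulr_ge0 C0 (mulr_ge0 S0 A0).
Qed.

End HankelBound.

(** * The theorem *)

Section Seminorm.
Context {R : realType}.
Implicit Types (b : R[i] -> R[i]).

Lemma bloch_seminorm_le (m N : R) b :
  (bloch_seminorm m b <= N%:E)%E <->
  (forall z, halfplane z -> complex.Im z * omega z `^ m * cabs (cderiv b z) <= N).
Proof.
split=> [h z z0|h].
  by rewrite -lee_fin; apply: le_trans h; apply: ereal_sup_ubound; exists z.
by apply: ge_ereal_sup => _ [z z0 <-]; rewrite lee_fin; exact: h.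
Qed.

Lemma bloch_seminorm_ge0 (m : R) b : (0 <= bloch_seminorm m b)%E.
Proof.
apply: (@le_trans _ _ (complex.Im ('i%C : R[i]) * omega ('i%C : R[i]) `^ m * cabs (cderiv b 'i%C))%:E).
  by rewrite lee_fin /= mul1r mulr_ge0 ?powR_ge0 ?cabs_ge0.
by apply: ereal_sup_ubound; exists 'i%C => //; exact: halfplane_i.
Qed.

(** The zero function is in the unit ball, so that the supremum is not over an empty
    set. *)
Lemma hankel_norm_ge0 c (p l : R) (Om2 : R[i] -> R) b : 0 < p ->
  (0 <= hankel_norm c p (logweight l) Om2 b)%E.
Proof.
move=> p0; apply: (@le_trans _ _ (bergman_norm p Om2 (hankel c b (fun=> 0)))).
  exact: bergman_norm_ge0.
have h0 : holomorphic (fun=> 0 : R[i]) by move=> z _; exact: cder_derivable (cder_cst 0 z).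
have n0 : (bergman_norm p (logweight l) (fun=> (0 : R[i])%R) <= 0%:E)%E.
  apply/bergman_norm_le => //; first exact: logweight_ge0.
  rewrite [X in (X <= _)%E](_ : _ = 0%E) ?lee_fin ?powR_ge0//.
  apply: integral0_eq => q _; rewrite /planar cabs0 powR0 ?mul0r//.
  by rewrite gt_eqF.
apply: ereal_sup_ubound; exists (fun=> 0) => //; split; last by apply: (le_trans n0); rewrite lee_fin.
by split=> //; apply: (le_lt_trans n0); rewrite ltry.
Qed.

End Seminorm.

Theorem corollary1 (R : realType) (c0 : R[i]) (hc0 : bergman_constant c0)
    (p l k : R) (hp : 1 < p) :
  let Om1 := fun z : R[i] => omega z `^ (- l * p) in
  let Om2 := fun z : R[i] => omega z `^ (k * p) in
  (forall b : R[i] -> R[i], holomorphic b -> projection_fixed c0 b ->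
     (bloch (l + k) b <-> hankel_bounded c0 p Om1 Om2 b)) /\
  (exists C1 C2 : R, [/\ 0 < C1, 0 < C2 &
     forall b : R[i] -> R[i], holomorphic b -> projection_fixed c0 b ->
       bloch (l + k) b ->
       (bloch_seminorm (l + k) b <= C1%:E * hankel_norm c0 p Om1 Om2 b)%E /\
       (hankel_norm c0 p Om1 Om2 b <= C2%:E * bloch_norm (l + k) b)%E]).
Proof.
move=> Om1 Om2; have p0 : 0 < p by rewrite (lt_trans ltr01).
have [C C_ge0 lower] := hankel_to_bloch l k hc0 hp.
have [D D_ge0 upper] := bloch_to_hankel l k hc0 hp.
have bound b : bloch (l + k) b -> exists2 N : R, 0 <= N & bloch_seminorm (l + k) b = N%:E.
  move=> [_ by_]; exists (fine (bloch_seminorm (l + k) b)); first exact: fine_ge0 (bloch_seminorm_ge0 _ _).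
  by rewrite fineK// ge0_fin_numE ?bloch_seminorm_ge0.
split.
  move=> b hb bP; split.
    move=> bB; have [N N0 NE] := bound b bB.
    have HN : forall w, halfplane w -> complex.Im w * omega w `^ (l + k) * cabs (cderiv b w) <= N.
      by apply/bloch_seminorm_le; rewrite NE.
    split=> [f fB|f fB|]; have H := upper b N _ hb bP N0 HN.
    - by have [] := H f fB.
    - have [_ hh hN] := H f fB; split=> //; apply: (le_lt_trans hN).
      by case: fB => _ fy; rewrite lte_mul_pinfty ?lee_fin ?mulr_ge0.
    - by exists (D * N) => f fB; have [] := H f fB.
  move=> [_ _ [M HM]]; split=> //.
  (* The bound M in the definition of boundedness may be negative when all norms are 0. *)
  have M0 : 0 <= Num.max 0 M by rewrite le_max lexx.
  have HM1 f : bergman_space p Om1 f -> (bergman_norm p Om1 f <= 1)%E ->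
      (bergman_norm p Om2 (hankel c0 b f) <= (Num.max 0 M)%:E)%E.
    move=> fB f1; apply: (le_trans (HM f fB)).
    apply: (@le_trans _ _ ((Num.max 0 M)%:E * bergman_norm p Om1 f)%E).
      by apply: lee_wpmul2r; [exact: bergman_norm_ge0|rewrite lee_fin le_max lexx orbT].
    by rewrite -[leRHS]mule1; apply: lee_wpmul2l; rewrite ?lee_fin.
  apply: (@le_lt_trans _ _ (C * Num.max 0 M)%:E); last exact: ltry.
  by apply/bloch_seminorm_le; exact: lower HM1.
exists (C + 1), (D + 1); split; [by rewrite ltr_wpDl|by rewrite ltr_wpDl|].
move=> b hb bP bB; have [N N0 NE] := bound b bB; split.
  have H0 := @hankel_norm_ge0 R c0 p (- l * p) Om2 b p0.
  case E : (hankel_norm c0 p Om1 Om2 b) H0 => [M| |] // M0; last first.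
    by rewrite mulry gtr0_sg ?mul1e ?leey// ltr_wpDl.
  have M0' : 0 <= M by rewrite -lee_fin -E; exact: hankel_norm_ge0.
  have HM f : bergman_space p Om1 f -> (bergman_norm p Om1 f <= 1)%E ->
      (bergman_norm p Om2 (hankel c0 b f) <= M%:E)%E.
    by move=> fB f1; rewrite -E; apply: ereal_sup_ubound; exists f.
  apply: (@le_trans _ _ (C * M)%:E); first by apply/bloch_seminorm_le; exact: lower HM.
  by rewrite -EFinM lee_fin ler_wpM2r// lerDl.
have HN : forall w, halfplane w -> complex.Im w * omega w `^ (l + k) * cabs (cderiv b w) <= N.
  by apply/bloch_seminorm_le; rewrite NE.
apply: (@le_trans _ _ (D * N)%:E).
  apply: ge_ereal_sup => _ [f [fB f1] <-].
  have [_ _ h] := upper b N f hb bP N0 HN fB; apply: (le_trans h).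
  by rewrite -[leRHS]mule1; apply: lee_wpmul2l; rewrite ?lee_fin ?mulr_ge0.
rewrite /bloch_norm NE -EFinD -EFinM lee_fin.
by apply: ler_pM => //; rewrite ?lerDl ?lerDr ?cabs_ge0.
Qed.
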